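(* Let $\Omega$ be a domain in the $2$-dimensional round sphere $(S^2,g_{S^2})$ whose closure is contained in the hemisphere $S^2_+$. Let $d$ be the geodesic distance from the north pole (with respect to $g_{S^2}$), let $\tilde g=\cos(d)\,g_{S^2}$ on $S^2_+$, and let $\tilde\Delta$ be the Laplace operator of $\tilde g$. Then there exist a nonzero constant $c$ and a solution $u$ of $$ \begin{cases} \tilde\Delta u = 2 & \text{in } \Omega,\\ u=0 & \text{on } \partial\Omega,\\ \partial_\nu u = c & \text{on } \partial\Omega \end{cases} $$ if and only if $\Omega$ is a geodesic ball about the north pole; and in this case every such solution $u$ is a radial function.
   Context: $S^2_+$ denotes the open hemisphere centered at the north pole, i.e. the set of points at $g_{S^2}$-geodesic distance less than $\pi/2$ from the north pole. A domain is a nonempty connected open set. $\nu$ is the outward unit normal to $\partial\Omega$ with respect to $g_{S^2}$ and $\partial_\nu u=du(\nu)$. ''Geodesic ball'' refers to $g_{S^2}$, and a radial function is a function that depends only on $d$. Standing regularity conventions: $\partial\Omega$ is regular enough for the divergence theorem to hold on $\Omega$ (e.g. of class $C^1$), and solutions are understood to be of class $C^2$ on $\overline\Omega$. *)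

(* Defs.v *)
From HB Require Import structures.
From mathcomp Require Import all_boot all_order all_algebra.
From mathcomp Require Import all_classical all_reals all_analysis.

Set Implicit Arguments.
Unset Strict Implicit.
Unset Printing Implicit Defensive.

Import Order.TTheory GRing.Theory Num.Theory.
Import numFieldNormedType.Exports.

Local Open Scope classical_set_scope.
Local Open Scope ring_scope.

(* The library norm of 'rV[R]_n is the sup norm, so the Euclidean structure
   is introduced separately; both give the same topology. *)
Definition dot (R : realType) (n : nat) (v w : 'rV[R]_n) : R :=
  \sum_(i < n) v 0 i * w 0 i.

Definition enorm (R : realType) (n : nat) (v : 'rV[R]_n) : R :=
  Num.sqrt (dot v v).

Definition sphere (R : realType) : set 'rV[R]_3 := [set p | dot p p = 1].

Definition north (R : realType) : 'rV[R]_3 := delta_mx 0 ord_max.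

(* Every C^1 map from [0, 1] to R^3 is the restriction of a C^1 map defined
   on R, so asking for C^1 on all of R is no restriction; only the values on
   [0, 1] have to lie on the sphere. *)
Definition sphere_curve (R : realType) (p q : 'rV[R]_3)
    (gam : R -> 'rV[R]_3) : Prop :=
  [/\ forall t, derivable gam t 1,
      continuous (derive1 gam),
      forall t, 0 <= t <= 1 -> sphere (gam t),
      gam 0 = p
    & gam 1 = q].

Definition curve_length (R : realType) (gam : R -> 'rV[R]_3) : R :=
  \int[lebesgue_measure]_(t in `[0, 1]) enorm (derive1 gam t).

Definition geodist (R : realType) (p q : 'rV[R]_3) : R :=
  inf [set curve_length gam | gam in sphere_curve p q].

Definition hemisphere (R : realType) : set 'rV[R]_3 :=
  [set p | sphere p /\ geodist (north R) p < pi / 2].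

Definition geoball (R : realType) (p : 'rV[R]_3) (r : R) : set 'rV[R]_3 :=
  [set q | sphere q /\ geodist p q < r].

(* The sphere is closed in R^3, so closures of subsets of the sphere may be
   taken in R^3. *)
Definition sphere_domain (R : realType) (Om : set 'rV[R]_3) : Prop :=
  [/\ Om !=set0,
      connected Om
    & exists2 U : set 'rV[R]_3, open U & Om = U `&` @sphere R].

(* The topological boundary, for relatively open Om. *)
Definition bd (R : realType) (Om : set 'rV[R]_3) : set 'rV[R]_3 :=
  closure Om `\` Om.

Definition partial (R : realType) (V : normedModType R) (n : nat)
    (i : 'I_n.+1) (f : 'rV[R]_n.+1 -> V) : 'rV[R]_n.+1 -> V :=
  fun x => 'D_(delta_mx 0 i) f x.

Definition C1_on (R : realType) (n : nat) (W : set 'rV[R]_n.+1)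
    (f : 'rV[R]_n.+1 -> R) : Prop :=
  forall x, W x -> forall i : 'I_n.+1,
    derivable f x (delta_mx 0 i) /\ {for x, continuous (partial i f)}.

Definition C2_on (R : realType) (n : nat) (W : set 'rV[R]_n.+1)
    (f : 'rV[R]_n.+1 -> R) : Prop :=
  C1_on W f /\ forall i : 'I_n.+1, C1_on W (partial i f).

(* A metric is given by its Gram matrices (g_ij), a vector field by its
   components X^i. *)
Definition vol (R : realType) (n : nat) (g : 'rV[R]_n -> 'M[R]_n)
  (x : 'rV[R]_n) : R := Num.sqrt (\det (g x)).

Definition gradient (R : realType) (n : nat) (g : 'rV[R]_n.+1 -> 'M[R]_n.+1)
    (f : 'rV[R]_n.+1 -> R) (x : 'rV[R]_n.+1) : 'rV[R]_n.+1 :=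
  (\row_i partial i f x) *m invmx (g x).

Definition divergence (R : realType) (n : nat)
    (g : 'rV[R]_n.+1 -> 'M[R]_n.+1) (X : 'rV[R]_n.+1 -> 'rV[R]_n.+1)
    (x : 'rV[R]_n.+1) : R :=
  (vol g x)^-1 * \sum_(i < n.+1) partial i (fun y => vol g y * X y 0 i) x.

Definition laplacian (R : realType) (n : nat)
    (g : 'rV[R]_n.+1 -> 'M[R]_n.+1) (f : 'rV[R]_n.+1 -> R) :
    'rV[R]_n.+1 -> R :=
  divergence g (gradient g f).

Definition chart (R : realType) (x : 'rV[R]_2) : 'rV[R]_3 :=
  (1 + dot x x)^-1 *: (row_mx (2 *: x) (1 - dot x x)%:M : 'rV[R]_(2 + 1)).

(* The inverse of [chart]: projection from the south pole. *)
Definition stereo (R : realType) (p : 'rV[R]_3) : 'rV[R]_2 :=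
  (1 + p 0 ord_max)^-1 *: lsubmx (p : 'rV[R]_(2 + 1)).

Definition round_metric (R : realType) (x : 'rV[R]_2) : 'M[R]_2 :=
  \matrix_(i, j) dot (partial i (@chart R) x) (partial j (@chart R) x).

(* cos(d) g_{S^2}; positive definite on the hemisphere only. *)
Definition tilde_metric (R : realType) (x : 'rV[R]_2) : 'M[R]_2 :=
  cos (geodist (north R) (chart x)) *: round_metric x.

(* The components, in the basis of the partial derivatives of [chart] at x,
   of a vector w of R^3 tangent to the sphere at chart x. *)
Definition tcoord (R : realType) (x : 'rV[R]_2) (w : 'rV[R]_3) : 'rV[R]_2 :=
  (\row_i dot w (partial i (@chart R) x)) *m invmx (round_metric x).

(* A function on (a subset of) the sphere is given by a map on R^3 of which
   only the values on the sphere matter: everything is read off f \o chart. *)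

(* C^k on the closure of Om: C^k in an open neighbourhood of it. *)
Definition C2_closure (R : realType) (Om : set 'rV[R]_3)
    (f : 'rV[R]_3 -> R) : Prop :=
  exists W : set 'rV[R]_2,
    [/\ open W, forall p, closure Om p -> W (stereo p)
      & C2_on W (f \o @chart R)].

Definition field_coord (R : realType) (X : 'rV[R]_3 -> 'rV[R]_3)
  (x : 'rV[R]_2) : 'rV[R]_2 := tcoord x (X (chart x)).

Definition C1_field_closure (R : realType) (Om : set 'rV[R]_3)
    (X : 'rV[R]_3 -> 'rV[R]_3) : Prop :=
  exists W : set 'rV[R]_2,
    [/\ open W, forall p, closure Om p -> W (stereo p),
        forall x, W x -> dot (X (chart x)) (chart x) = 0
      & forall i, C1_on W (fun x => field_coord X x 0 i)].

(* du_p(w) for w tangent to the sphere at p. *)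
Definition tdiff (R : realType) (u : 'rV[R]_3 -> R) (p w : 'rV[R]_3) : R :=
  'D_(tcoord (stereo p) w) (u \o @chart R) (stereo p).

Definition sphere_div (R : realType) (X : 'rV[R]_3 -> 'rV[R]_3)
    (p : 'rV[R]_3) : R :=
  divergence (@round_metric R) (field_coord X) (stereo p).

Definition pt2 (R : realType) (z : R * R) : 'rV[R]_2 :=
  row_mx (z.1)%:M (z.2)%:M : 'rV[R]_(1 + 1).

(* The integral over Om with respect to the area of g_{S^2}. *)
Definition area_int (R : realType) (Om : set 'rV[R]_3)
    (f : 'rV[R]_3 -> R) : R :=
  \int[(@lebesgue_measure R \x @lebesgue_measure R)%E]_(z in
      [set z : R * R | Om (chart (pt2 z))])
    (f (chart (pt2 z)) * vol (@round_metric R) (pt2 z)).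

(* nu p is a unit tangent vector at p, and at p the set Om is tangent to the
   half-plane of the directions w with <w, nu p> < 0.  When the boundary is
   of class C^1 this is the usual outward unit normal. *)
Definition outward_normal_at (R : realType) (Om : set 'rV[R]_3)
    (nu p : 'rV[R]_3) : Prop :=
  [/\ dot nu p = 0, dot nu nu = 1
    & forall e : R, 0 < e -> exists2 del : R, 0 < del &
        forall q, sphere q -> enorm (q - p) < del ->
          (dot (q - p) nu < - e * enorm (q - p) -> Om q) /\
          (e * enorm (q - p) < dot (q - p) nu -> ~ Om q)].

Definition borel3 (R : realType) :=
  g_sigma_algebraType (@open 'rV[R]_3).

(* For unit nu, the identity determines the measure sigma on the boundary:
   it is the perimeter measure of Om, that is, the arc length of the boundary
   when the latter is of class C^1. *)
Definition divergence_theorem (R : realType) (Om : set 'rV[R]_3)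
    (nu : 'rV[R]_3 -> 'rV[R]_3) : Prop :=
  exists sigma : {finite_measure set (borel3 R) -> \bar R},
    forall X : 'rV[R]_3 -> 'rV[R]_3, C1_field_closure Om X ->
      sigma.-integrable (bd Om) (fun p => (dot (X p) (nu p))%:E) /\
      area_int Om (sphere_div X) =
        \int[sigma]_(p in bd Om) dot (X p) (nu p).

(* Boundaries of class C^1 are regular in this sense. *)
Definition regular_boundary (R : realType) (Om : set 'rV[R]_3)
    (nu : 'rV[R]_3 -> 'rV[R]_3) : Prop :=
  (forall p, bd Om p -> outward_normal_at Om (nu p) p) /\
  divergence_theorem Om nu.

Definition overdetermined_solution (R : realType) (Om : set 'rV[R]_3)
    (nu : 'rV[R]_3 -> 'rV[R]_3) (c : R) (u : 'rV[R]_3 -> R) : Prop :=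
  [/\ C2_closure Om u,
      forall p, Om p ->
        laplacian (@tilde_metric R) (u \o @chart R) (stereo p) = 2,
      forall p, bd Om p -> u p = 0
    & forall p, bd Om p -> tdiff u p (nu p) = c].

Definition polar_ball (R : realType) (Om : set 'rV[R]_3) : Prop :=
  exists2 r : R, 0 < r & Om = geoball (north R) r.

Definition radial_on (R : realType) (A : set 'rV[R]_3)
    (u : 'rV[R]_3 -> R) : Prop :=
  exists f : R -> R, forall p, A p -> u p = f (geodist (north R) p).

(* Main.v *)
(* In the stereographic chart x of the round sphere, with z = p_3 = 2 / (1 + |x|^2) - 1, the
   equation for the Laplacian of cos(d) g says that u + z is harmonic, because
   cos d = z and the Laplacian is conformally covariant in dimension 2.

   Let u be a solution and h = u + z. The maximum principle gives u < 0 in Om. Put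
   Q = |grad u|^2 - u^2 - 2 u z, with the round metric; it equals c^2 on the
   boundary, and it is subharmonic since, with F = h_1 - i h_2 in the chart, its flat
   Laplacian is |(1 + |x|^2) F' + 2 conj(x) F|^2. Hence Q <= c^2 in Om. The field
     (grad z . grad u) grad u - |grad u|^2 grad z / 2 - c^2 grad z / 2
       - u (z grad u + 2 z grad z + (3/2) u grad z + u grad u)
   has no normal component on the boundary, where u = 0 and grad u = c nu, and its
   divergence is, up to a positive factor, z (c^2 - Q) plus a nonnegative multiple of
   - u |grad h|^2. By the divergence theorem grad h = 0, so u = k - z, first along
   segments of the chart through the origin, and Om is the cap {z > k}.
   Conversely u = cos r - z solves the problem on the ball of radius r, with c = sin r. *)

From HB Require Import structures.
Require Import Defs.
From mathcomp Require Import all_boot all_order all_algebra.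
From mathcomp Require Import all_classical all_reals all_analysis.
From mathcomp Require Import measurable_realfun.
From mathcomp Require Import ring lra.

Set Implicit Arguments.
Unset Strict Implicit.
Unset Printing Implicit Defensive.

Import Order.TTheory GRing.Theory Num.Theory.
Import numFieldNormedType.Exports.

Local Open Scope classical_set_scope.
Local Open Scope ring_scope.

(** * Calculus along lines and in the plane *)

(** The field is of Pohozaev type. On the sphere [Hess z = - z g], so [grad z] is conformal, and in
    dimension two all Hessian terms cancel in the divergence of [(grad z . grad u) grad u - |grad
    u|^2 grad z / 2]. What remains is [2 z (grad z . grad u)], because the Laplacian of [u] for [g]
    is [2 z]. The summand with [c^2] contributes [c^2 z], and the multiples of [u], invisible on the
    boundary, complete the sum to [z (c^2 - Q) - 2 u |grad h|^2]. Regularity shapes the argument.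
    [u] is only C^2 up to the boundary and the divergence theorem is assumed for C^1 fields, so
    [grad Q] cannot be fed to it, whereas the field above contains first derivatives of [u] only.
    For the same reason the maximum principle for [Q] cannot differentiate [Q] twice. The normal is
    known only through a first-order cone condition at each boundary point. Hence [grad u] is shown
    to be normal there by using [u < 0] along inward directions, not by differentiating along the
    boundary. *)

Lemma is_derive_line (R : realType) (V : normedModType R) (f : V -> R)
    (x v : V) (t d : R) :
  is_derive (x + t *: v) v f d ->
  is_derive t (1 : R) (fun r : R => f (x + r *: v)) d.
Proof.
move=> [df vf].
have E : (fun h : R => h^-1 *: (((fun r : R => f (x + r *: v)) \o shift t) (h *: 1)
    - f (x + t *: v))) =
  (fun h : R => h^-1 *: ((f \o shift (x + t *: v)) (h *: v) - f (x + t *: v))).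
  apply/funext => h /=; congr (_ *: (f _ - _)).
  by rewrite scalerDl scaler1 addrCA.
by split; [rewrite /derivable E | rewrite /derive E].
Qed.

(** The symmetric range [|t| <= |a|] lets one statement serve both signs of [a], and callers only
    have to check a ball. *)
Lemma mvt_line (R : realType) (V : normedModType R) (f : V -> R) (x v : V) (a : R) :
  (forall t : R, `|t| <= `|a| -> derivable f (x + t *: v) v) ->
  exists2 t : R, `|t| <= `|a| & f (x + a *: v) - f x = a * 'D_v f (x + t *: v).
Proof.
move=> df.
have D (t : R) : `|t| <= `|a| ->
    is_derive t (1 : R) (fun r : R => f (x + r *: v)) ('D_v f (x + t *: v)).
  by move=> ta; apply: is_derive_line; apply: derivableP; exact: df.
have C (s : interval R) : (forall t : R, t \in s -> `|t| <= `|a|) ->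
    {within [set` s], continuous (fun r : R => f (x + r *: v))}.
  move=> H; apply: derivable_within_continuous => t /H/D [] //.
have [a0|a0|->] := ltgtP a 0; last first.
- by exists 0; rewrite ?scale0r ?addr0 ?subrr ?mul0r.
- have H (t : R) : t \in `[0, a] -> `|t| <= `|a|.
    by rewrite in_itv/= => /andP[t0 ta]; rewrite !ger0_norm// ltW.
  have [||c cI E] := MVT (a := 0) (b := a) (f := fun r : R => f (x + r *: v)) (df := fun t => 'D_v f (x + t *: v)) a0.
  + by move=> t tI; apply: D; apply: H; exact: subset_itv_oo_cc tI.
  + exact: C.
  exists c; first by apply: H; exact: subset_itv_oo_cc cI.
  by move: E; rewrite scale0r addr0 => ->; rewrite subr0 mulrC.
- have H (t : R) : t \in `[a, 0] -> `|t| <= `|a|.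
    by rewrite in_itv/= => /andP[ta t0]; rewrite !ler0_norm ?lerN2// ltW.
  have [||c cI E] := MVT (a := a) (b := 0) (f := fun r : R => f (x + r *: v)) (df := fun t => 'D_v f (x + t *: v)) a0.
  + by move=> t tI; apply: D; apply: H; exact: subset_itv_oo_cc tI.
  + exact: C.
  exists c; first by apply: H; exact: subset_itv_oo_cc cI.
  move: E; rewrite scale0r addr0 sub0r mulrN => E.
  by rewrite -opprB E opprK mulrC.
Qed.

(** If the second derivative were positive, the first derivative along the line, which vanishes at
    the maximum, would be positive just to the right of it, and the mean value theorem would push
    [f] above its maximum. *)
Lemma second_derive_at_max (R : realType) (V : normedModType R) (f : V -> R) (x v : V) :
  (\forall y \near x, derivable f y v) -> derivable ('D_v f) x v ->
  (\forall y \near x, f y <= f x) -> 'D_v ('D_v f) x <= 0.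
Proof.
move=> df ddf fmax; rewrite leNgt; apply/negP => lam0.
have line0 : (fun r : R => x + r *: v) @ 0 --> x.
  rewrite -[X in _ --> X]addr0 -(scale0r v).
  by apply: cvgD; [exact: cvg_cst|apply: cvgZr_tmp; exact: cvg_id].
pose g (r : R) : R := f (x + r *: v); pose dg (r : R) : R := 'D_v f (x + r *: v).
have nD : \forall r \near (0 : R), is_derive r (1 : R) g (dg r).
  have : nbhs (0 : R) (fun r : R => derivable f (x + r *: v) v) by exact: line0 df.
  apply: filterS => r dr.
  by apply: is_derive_line; apply: derivableP.
have nM : \forall r \near (0 : R), g r <= g 0.
  have : nbhs (0 : R) (fun r : R => f (x + r *: v) <= f x) by exact: line0 fmax.
  apply: filterS => r.
  by rewrite /g scale0r addr0.
have : nbhs (0 : R) [set r | is_derive r (1 : R) g (dg r) /\ g r <= g 0].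
  exact: filterI nD nM.
move=> /nbhs_ballP[d /= d0 dP].
have {}dP (r : R) : `|r| < d -> is_derive r (1 : R) g (dg r) /\ g r <= g 0.
  by move=> rd; apply: dP; rewrite /ball/= sub0r normrN.
have g0 : dg 0 = 0.
  have [||||_ dg0] := @derive1_at_max R g (- d) d 0; rewrite ?in_itv/=.
  - by rewrite (@le_trans _ _ 0)// ?oppr_le0 ltW.
  - by move=> t; rewrite in_itv/= -ltr_norml => /dP[[]].
  - by rewrite oppr_lt0 d0.
  - by move=> t; rewrite in_itv/= -ltr_norml => /dP[].
  have /dP[[_ E] _] : `|0 : R| < d by rewrite normr0.
  exact: etrans (esym E) dg0.
have dd : is_derive (0 : R) (1 : R) dg ('D_v ('D_v f) x).
  apply: (@is_derive_line _ _ ('D_v f)); rewrite scale0r addr0; exact: derivableP.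
have : (fun h : R => h^-1 * dg h) @ 0^' --> 'D_v ('D_v f) x.
  have [d1 <-] := dd; rewrite /derive.
  have -> : (fun h : R => h^-1 * dg h) = (fun h : R => h^-1 *: ((dg \o shift 0) (h *: 1) - dg 0)).
    by apply/funext => h /=; rewrite g0 subr0 addr0 scaler1.
  exact: d1.
move/cvgr_gt => /(_ _ lam0) [/= d1 d10 d1P].
pose m := Num.min d d1 / 2.
have m0 : 0 < m by rewrite divr_gt0// lt_min d0.
have md : m < Num.min d d1 by rewrite /m ltr_pdivrMr// mulr_natr mulr2n ltrDl lt_min d0.
have /andP[{}md md1] : (m < d) && (m < d1) by rewrite -lt_min.
have [||c cI E] := MVT (a := 0) (b := m) (f := g) (df := dg) m0.
- move=> t; rewrite in_itv/= => /andP[t0 tm]; apply: (dP t _).1.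
  by rewrite gtr0_norm// (lt_trans tm).
- apply: derivable_within_continuous => t; rewrite in_itv/= => /andP[t0 tm].
  by have /dP[[]] : `|t| < d by rewrite ger0_norm// (le_lt_trans tm).
move: cI; rewrite in_itv/= => /andP[c0 cm].
have : 0 < c^-1 * dg c.
  apply: d1P; last by rewrite gt_eqF.
  by rewrite /ball/= sub0r normrN gtr0_norm// (lt_trans cm).
rewrite pmulr_rgt0 ?invr_gt0// => dc0.
have /dP[_] : `|m| < d by rewrite gtr0_norm.
by rewrite -subr_le0 E subr0 leNgt mulr_gt0.
Qed.

Lemma ord2_ind (P : 'I_2 -> Prop) : P 0 -> P 1 -> forall i, P i.
Proof.
move=> P0 P1 i.
case: i => -[|[|//]] Hi; [move: P0|move: P1]; by congr P; apply: val_inj.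
Qed.

Lemma sum_ord2 (V : nmodType) (F : 'I_2 -> V) : \sum_(i < 2) F i = F 0 + F 1.
Proof.
by rewrite !big_ord_recl big_ord0 addr0; congr (F _ + F _); apply: val_inj.
Qed.

Lemma rV2_decomp (R : realType) (x y : 'rV[R]_2) :
  y = x + (y 0 0 - x 0 0) *: delta_mx 0 0 + (y 0 1 - x 0 1) *: delta_mx 0 1.
Proof.
apply/rowP; apply: ord2_ind; rewrite !mxE /=; lra.
Qed.

Lemma rV2_norm_lt (R : realType) (v : 'rV[R]_2) (d : R) :
  (`|v| < d) = (`|v 0 0| < d) && (`|v 0 1| < d).
Proof.
apply/idP/andP => [vd|[v0 v1]].
  by split; apply: le_lt_trans vd; rewrite [leRHS]mx_normrE; apply: (le_bigmax _ _ (0, _)).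
rewrite [ltLHS]mx_normrE; apply/bigmax_ltP; split; first exact: le_lt_trans v0.
by move=> [i j] _ /=; rewrite (ord1 i); move: j; exact: ord2_ind.
Qed.

Lemma rV2_norm_le (R : realType) (v : 'rV[R]_2) (d : R) :
  (`|v| <= d) = (`|v 0 0| <= d) && (`|v 0 1| <= d).
Proof.
apply/idP/andP => [vd|[v0 v1]].
  by split; apply: le_trans vd; rewrite [leRHS]mx_normrE; apply: (le_bigmax _ _ (0, _)).
rewrite [leLHS]mx_normrE; apply/bigmax_leP; split; first exact: le_trans v0.
by move=> [i j] _ /=; rewrite (ord1 i); move: j; exact: ord2_ind.
Qed.

Lemma near_dist_le (R : realType) (V : normedModType R) (x : V) (e : R) :
  0 < e -> \forall y \near x, `|x - y| <= e.
Proof. by move: e; apply/cvgrPdist_le; exact: cvg_id. Qed.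

(** [C1_on] speaks of partial derivatives only; this is the classical passage to differentiability.
    The increment is split along a corner path parallel to the axes, and the mean value theorem on
    each leg bounds the error by the oscillation of one partial derivative, at most [e / 2]. *)
Lemma C1_on_expansion (R : realType) (W : set 'rV[R]_2) (f : 'rV[R]_2 -> R)
    (x : 'rV[R]_2) (e : R) :
  open W -> C1_on W f -> W x -> 0 < e ->
  \forall y \near x, `|f y - f x - ((y - x) 0 0 * partial 0 f x +
    (y - x) 0 1 * partial 1 f x)| <= e * `|y - x|.
Proof.
move=> oW fW Wx e0.
have nW : \forall y \near x, W y by exact: open_nbhs_nbhs.
have near_partial i : \forall y \near x, `|partial i f x - partial i f y| <= e / 2.
  have [_ c] := fW x Wx i.
  by move/cvgrPdist_le: c; apply; rewrite divr_gt0.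
have /nbhs_normP[d /= d0 dP] : \forall y \near x,
    W y /\ (`|partial 0 f x - partial 0 f y| <= e / 2 /\
            `|partial 1 f x - partial 1 f y| <= e / 2).
  by apply: filterI; [exact: nW|apply: filterI; exact: near_partial].
have {}dP a b : `|a| < d -> `|b| < d ->
    let y := x + a *: delta_mx 0 0 + b *: delta_mx 0 1 in
    W y /\ (`|partial 0 f x - partial 0 f y| <= e / 2 /\
            `|partial 1 f x - partial 1 f y| <= e / 2).
  move=> ad bd; apply: dP; rewrite /ball_/= opprD addrA opprD addrA subrr sub0r.
  rewrite -opprD normrN rV2_norm_lt !mxE /=.
  by rewrite !mulr0 !mulr1 addr0 add0r ad bd.
near=> y.
have /andP[] : (`|(y - x) 0 0| < d) && (`|(y - x) 0 1| < d).
  rewrite -rV2_norm_lt distrC; near: y.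
  by apply: cvgr_dist_lt; [exact: cvg_id|].
rewrite (rV2_decomp x y); set a := y 0 0 - x 0 0; set b := y 0 1 - x 0 1.
have ya : (y - x) 0 0 = a by rewrite !mxE.
have yb : (y - x) 0 1 = b by rewrite !mxE.
rewrite -(rV2_decomp x y) ya yb => ad bd.
have ka : `|a| <= `|y - x| by rewrite -ya; have := lexx `|y - x|; rewrite {1}rV2_norm_le => /andP[].
have kb : `|b| <= `|y - x| by rewrite -yb; have := lexx `|y - x|; rewrite {1}rV2_norm_le => /andP[].
have [t1 t1a E1] : exists2 t : R, `|t| <= `|a| &
    f (x + a *: delta_mx 0 0) - f x = a * partial 0 f (x + t *: delta_mx 0 0).
  apply: mvt_line => t ta; have := dP t 0; rewrite normr0 scale0r addr0.
  by move=> /(_ (le_lt_trans ta ad) d0)[Wt _]; have [] := fW _ Wt 0.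
have [t2 t2a E2] : exists2 t : R, `|t| <= `|b| &
    f (x + a *: delta_mx 0 0 + b *: delta_mx 0 1) - f (x + a *: delta_mx 0 0) =
    b * partial 1 f (x + a *: delta_mx 0 0 + t *: delta_mx 0 1).
  apply: mvt_line => t ta; have := dP a t ad (le_lt_trans ta bd).
  by move=> [Wt _]; have [] := fW _ Wt 1.
rewrite [in f y](rV2_decomp x y) -/a -/b.
have -> : f (x + a *: delta_mx 0 0 + b *: delta_mx 0 1) - f x =
    b * partial 1 f (x + a *: delta_mx 0 0 + t2 *: delta_mx 0 1) +
    a * partial 0 f (x + t1 *: delta_mx 0 0) by rewrite -E1 -E2; ring.
have [_ [P0 _]] := dP t1 0 (le_lt_trans t1a ad) ltac:(by rewrite normr0).
rewrite scale0r addr0 distrC in P0.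
have [_ [_ P1]] := dP a t2 ad (le_lt_trans t2a bd).
rewrite distrC in P1.
set A := partial 0 f _ in P0 *; set B := partial 1 f (_ + _ + _) in P1 *.
set A0 := partial 0 f x in P0 *; set B0 := partial 1 f x in P1 *.
have -> : b * B + a * A - (a * A0 + b * B0) = b * (B - B0) + a * (A - A0) by ring.
apply: (le_trans (ler_normD _ _)); rewrite !normrM.
rewrite (splitr e) mulrDl lerD//.
  by rewrite mulrC ler_pM.
by rewrite mulrC ler_pM.
Unshelve. all: by end_near. Qed.

Lemma C1_on_continuous (R : realType) (W : set 'rV[R]_2) (f : 'rV[R]_2 -> R)
    (x : 'rV[R]_2) : open W -> C1_on W f -> W x -> {for x, continuous f}.
Proof.
move=> oW fW Wx.
suff H (e : R) : 0 < e -> \forall y \near x, `|f x - f y| <= e.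
  suff : f @ nbhs x --> f x by [].
  exact/cvgrPdist_le.
move=> e0; set A := partial 0 f x; set B := partial 1 f x.
have k0 : 0 < 1 + `|A| + `|B| by rewrite -addrA ltr_pwDl.
near=> y.
have : `|f y - f x - ((y - x) 0 0 * A + (y - x) 0 1 * B)| <= 1 * `|y - x|.
  by near: y; move: (C1_on_expansion oW fW Wx ltr01).
have : `|x - y| <= e / (1 + `|A| + `|B|).
  by near: y; exact: (near_dist_le x (divr_gt0 e0 k0)).
rewrite mul1r distrC; set h := y - x => he E.
have /andP[h0 h1] : (`|h 0 0| <= `|h|) && (`|h 0 1| <= `|h|) by rewrite -rV2_norm_le.
rewrite distrC (_ : f y - f x = (f y - f x - (h 0 0 * A + h 0 1 * B)) + (h 0 0 * A + h 0 1 * B)); last by ring.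
apply: (le_trans (ler_normD _ _)).
have : `|h 0 0 * A + h 0 1 * B| <= `|h| * `|A| + `|h| * `|B|.
  by apply: (le_trans (ler_normD _ _)); rewrite !normrM lerD// ler_wpM2r.
move: he; rewrite ler_pdivlMr//; set H := _ + h 0 1 * B; move: E.
move: (`|h|) => n; move: (`|_|) (`|H|) => m1 m2; lra.
Unshelve. all: by end_near. Qed.

Lemma C1_on_is_derive (R : realType) (W : set 'rV[R]_2) (f : 'rV[R]_2 -> R)
    (x v : 'rV[R]_2) : open W -> C1_on W f -> W x ->
  is_derive x v f (v 0 0 * partial 0 f x + v 0 1 * partial 1 f x).
Proof.
move=> oW fW Wx; set A := partial 0 f x; set B := partial 1 f x.
suff C : (fun h : R => h^-1 *: ((f \o shift x) (h *: v) - f x)) @ 0^' -->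
    (v 0 0 * A + v 0 1 * B : R).
  by split; [apply/cvg_ex; eexists; exact: C | exact: cvg_lim C].
apply/cvgrPdist_le => /= e e0.
have v0 : 0 < 1 + `|v| by rewrite ltr_pwDl.
have line0 : (fun r : R => r *: v + x) @ (0 : R) --> x.
  rewrite -[X in _ --> X]add0r -(scale0r v).
  by apply: cvgD; [apply: cvgZr_tmp; exact: cvg_id|exact: cvg_cst].
have : nbhs (0 : R) (fun r : R => `|f (r *: v + x) - f x - ((r *: v + x - x) 0 0 * A +
    (r *: v + x - x) 0 1 * B)| <= (e / (1 + `|v|)) * `|r *: v + x - x|).
  exact: (line0 _ (C1_on_expansion oW fW Wx (divr_gt0 e0 v0))).
rewrite /dnbhs /within; apply: filterS => r /=; rewrite addrK !mxE normrZ => E r0.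
rewrite distrC.
have rp : 0 < `|r| by rewrite normr_gt0.
rewrite -(ler_pM2l rp) -normrM mulrBr -[r * (r^-1 *: _)]/(r * (r^-1 * _)) mulrA mulfV// mul1r.
have -> : r * (v 0 0 * A + v 0 1 * B) = r * v 0 0 * A + r * v 0 1 * B by ring.
apply: (le_trans E); rewrite mulrCA ler_pM2l// mulrAC ler_pdivrMr// ler_pM2l//.
by rewrite lerDr.
Qed.

Lemma is_derive_comp_addr (R : realType) (V : normedModType R) (f : V -> R)
    (x v w : V) (d : R) :
  is_derive (x + w) v f d -> is_derive x v (fun y => f (y + w)) d.
Proof.
move=> [df vf].
have E : (fun h : R => h^-1 *: (((fun y => f (y + w)) \o shift x) (h *: v)
    - f (x + w))) =
  (fun h : R => h^-1 *: ((f \o shift (x + w)) (h *: v) - f (x + w))).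
  by apply/funext => h /=; rewrite addrA.
by split; [rewrite /derivable E | rewrite /derive E].
Qed.

(** The mean value theorem is applied twice: in direction [v] to the increment of [f] along
    [s *: w], then in direction [w] to ['D_v f]. The second-order increment on the left is symmetric
    in [v] and [w], which is what [partialC] exploits. *)
Lemma mixed_increment (R : realType) (V : normedModType R) (f : V -> R)
    (x v w : V) (s : R) :
  (forall a b : R, `|a| <= `|s| -> `|b| <= `|s| ->
    derivable f (x + a *: v + b *: w) v /\
    derivable ('D_v f) (x + a *: v + b *: w) w) ->
  exists2 ab : R * R, `|ab.1| <= `|s| /\ `|ab.2| <= `|s| &
    f (x + s *: v + s *: w) - f (x + s *: v) - f (x + s *: w) + f x =
    s * (s * 'D_w ('D_v f) (x + ab.1 *: v + ab.2 *: w)).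
Proof.
move=> H; pose F y := f (y + s *: w) - f y.
have dF a : `|a| <= `|s| -> is_derive (x + a *: v) v F
    ('D_v f (x + a *: v + s *: w) - 'D_v f (x + a *: v)).
  move=> aS; apply: is_deriveB; last first.
    apply: derivableP; have [+ _] := H a 0 aS ltac:(by rewrite normr0).
    by rewrite scale0r addr0.
  have [ds _] := H a s aS (lexx _).
  by apply: is_derive_comp_addr; apply: derivableP; exact: ds.
have [a aS E1] : exists2 a : R, `|a| <= `|s| &
    F (x + s *: v) - F x = s * 'D_v F (x + a *: v).
  by apply: mvt_line => t /dF[].
have [b bS E2] : exists2 b : R, `|b| <= `|s| &
    'D_v f (x + a *: v + s *: w) - 'D_v f (x + a *: v) =
    s * 'D_w ('D_v f) (x + a *: v + b *: w).
  by apply: (@mvt_line _ _ ('D_v f)) => t tS; have [_ dw] := H a t aS tS; exact: dw.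
exists (a, b) => //=; rewrite -E2.
by have [_ <-] := dF a aS; rewrite -E1 /F; ring.
Qed.

(** Schwarz's theorem: the same increment over a small square is [s ^+ 2] times either mixed
    derivative at some point of the square, and both are continuous at [x]. *)
Lemma partialC (R : realType) (W : set 'rV[R]_2) (f : 'rV[R]_2 -> R)
    (x : 'rV[R]_2) : open W -> C2_on W f -> W x ->
  partial 1 (partial 0 f) x = partial 0 (partial 1 f) x.
Proof.
move=> oW [fW f2W] Wx; apply/eqP; rewrite -subr_eq0 -normr_le0.
apply/ler_addgt0Pr => e e0; rewrite add0r.
have near2 i j : \forall y \near x,
    `|partial i (partial j f) x - partial i (partial j f) y| <= e / 2.
  have [_ c] := f2W j x Wx i.
  by move/cvgrPdist_le: c; apply; rewrite divr_gt0.
have nW : \forall y \near x, W y by exact: open_nbhs_nbhs.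
have /nbhs_normP[d /= d0 dP] : \forall y \near x, W y /\
    (`|partial 1 (partial 0 f) x - partial 1 (partial 0 f) y| <= e / 2 /\
     `|partial 0 (partial 1 f) x - partial 0 (partial 1 f) y| <= e / 2).
  by apply: filterI; [exact: nW|apply: filterI; exact: near2].
pose s := d / 2.
have s0 : 0 < s by rewrite divr_gt0.
have sd : s < d by rewrite /s ltr_pdivrMr// mulr_natr mulr2n ltrDl.
have {}dP (i j : 'I_2) a b : i != j -> `|a| <= `|s| -> `|b| <= `|s| ->
    let y := x + a *: delta_mx 0 i + b *: delta_mx 0 j in W y /\
    (`|partial 1 (partial 0 f) x - partial 1 (partial 0 f) y| <= e / 2 /\
     `|partial 0 (partial 1 f) x - partial 0 (partial 1 f) y| <= e / 2).
  rewrite (gtr0_norm s0) => ij aS bS; apply: dP.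
  have {}aS := le_lt_trans aS sd; have {}bS := le_lt_trans bS sd.
  rewrite /ball_/= opprD addrA opprD addrA subrr sub0r -opprD normrN rV2_norm_lt !mxE /=.
  by move: i j ij; apply: ord2_ind; apply: ord2_ind => //= _; rewrite ?mulr0 ?mulr1 ?addr0 ?add0r ?aS ?bS.
have [ab [ha hb] E1] := @mixed_increment _ _ f x (delta_mx 0 0) (delta_mx 0 1) s
  (fun a b aS bS => let: conj Wy _ := dP 0 1 a b isT aS bS in
     conj (fW _ Wy 0).1 (f2W 0 _ Wy 1).1).
have [ab' [ha' hb'] E2] := @mixed_increment _ _ f x (delta_mx 0 1) (delta_mx 0 0) s
  (fun a b aS bS => let: conj Wy _ := dP 1 0 a b isT aS bS in
     conj (fW _ Wy 1).1 (f2W 1 _ Wy 0).1).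
have [_ [K1 _]] := dP 0 1 _ _ isT ha hb.
have [_ [_ K2]] := dP 1 0 _ _ isT ha' hb'.
have : s * (s * partial 1 (partial 0 f) (x + ab.1 *: delta_mx 0 0 + ab.2 *: delta_mx 0 1)) =
  s * (s * partial 0 (partial 1 f) (x + ab'.1 *: delta_mx 0 1 + ab'.2 *: delta_mx 0 0)).
  rewrite -[LHS]E1 -[RHS]E2 [in RHS](addrAC x (s *: delta_mx 0 1)).
  by congr (_ + f x); exact: addrAC.
move=> /(mulfI (lt0r_neq0 s0)) /(mulfI (lt0r_neq0 s0)) E.
rewrite -E in K2; move: K1 K2.
set A := partial 1 (partial 0 f) x; set B := partial 0 (partial 1 f) x.
move: (partial 1 _ _) A B => C A B; rewrite !ler_norml => /andP[a1 a2] /andP[b1 b2].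
clear E E1 E2; by apply/andP; split; lra.
Qed.

Lemma second_is_derive_at_max (R : realType) (V : normedModType R) (f g : V -> R)
    (x v : V) (d : R) :
  (\forall y \near x, is_derive y v f (g y)) -> is_derive x v g d ->
  (\forall y \near x, f y <= f x) -> d <= 0.
Proof.
move=> fg gd fmax.
have E : \forall y \near x, g y = 'D_v f y by apply: filterS fg => y [_ ->].
have [dd <-] := near_eq_is_derive E gd.
by apply: second_derive_at_max => //; apply: filterS fg => y [].
Qed.

(** * Subharmonicity of the P-function *)

Definition diffquot (R : realType) (V : normedModType R) (e : R) (w : V) (f : V -> R) : V -> R :=
  fun y => e^-1 *: (f (y + e *: w) - f y).

Lemma is_derive_diffquot (R : realType) (V : normedModType R) (e : R) (w x v : V) (f df : V -> R) :
  is_derive x v f (df x) -> is_derive (x + e *: w) v f (df (x + e *: w)) ->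
  is_derive x v (diffquot e w f) (diffquot e w df x).
Proof.
move=> h1 h2; rewrite /diffquot.
apply: (@is_deriveZ _ _ _ (fun y => f (y + e *: w) - f y)).
by apply: is_deriveB => //; apply: is_derive_comp_addr.
Qed.

Lemma diffquot_mvt (R : realType) (V : normedModType R) (e : R) (w x : V) (f : V -> R) :
  0 < e -> (forall t : R, `|t| <= e -> derivable f (x + t *: w) w) ->
  exists2 t : R, `|t| <= e & diffquot e w f x = 'D_w f (x + t *: w).
Proof.
move=> e0 H; have [|t te E] := @mvt_line _ _ f x w e.
  by rewrite gtr0_norm.
exists t; first by rewrite -(gtr0_norm e0).
by rewrite /diffquot E -[_ *: _]/(_ * _) mulrA mulVf ?mul1r// gt_eqF.
Qed.

(* Typeclass search for [is_derive] diverges on products of several factors. *)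
Ltac is_derive_tac :=
  lazymatch goal with
  | |- is_derive _ _ (cst _) _ => apply: is_derive_cst
  | |- is_derive _ _ (_ - _) _ => eapply is_deriveB; is_derive_tac
  | |- is_derive _ _ (_ + _) _ => eapply is_deriveD; is_derive_tac
  | |- is_derive _ _ (_ * _) _ => eapply is_deriveM; is_derive_tac
  | |- _ => eassumption
  end.

Ltac is_derive_eq_tac := eapply is_derive_eq; [is_derive_tac|rewrite ?fctE /cst /GRing.scale /=].

Section Pfunction.
Variables (R : realType) (V : normedModType R).

(* For [h = u + z] with gradient [(F, G)] at the point [(X, Y)] of the chart, this is
   [4 * (|grad u|^2 - u^2 - 2 * u * z)]. *)
Definition Pfn (X Y F G h : V -> R) : V -> R :=
  (cst 1 + X * X + Y * Y) * (cst 1 + X * X + Y * Y) * (F * F + G * G)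
  + cst 8 * (X * F + Y * G) + cst 4 - cst 4 * (h * h).

(* The derivative of [Pfn] in a direction [(cX, cY)]. *)
Definition Pfn1 (cX cY : R) (X Y F G h F1 G1 h1 : V -> R) : V -> R :=
  cst 4 * (cst 1 + X * X + Y * Y) * (cst cX * X + cst cY * Y) * (F * F + G * G) +
  cst 2 * (cst 1 + X * X + Y * Y) * (cst 1 + X * X + Y * Y) * (F * F1 + G * G1) +
  cst 8 * (cst cX * F + X * F1 + cst cY * G + Y * G1) - cst 8 * h * h1.

Lemma is_derive_Pfn (X Y F G h : V -> R) z v cX cY (F1 G1 h1 : V -> R) :
 is_derive z v X cX -> is_derive z v Y cY ->
 is_derive z v F (F1 z) -> is_derive z v G (G1 z) -> is_derive z v h (h1 z) ->
 is_derive z v (Pfn X Y F G h) (Pfn1 cX cY X Y F G h F1 G1 h1 z).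
Proof.
move=> dX dY dF dG dh; rewrite /Pfn /Pfn1.
is_derive_eq_tac; ring.
Qed.

Lemma is_derive_Pfn1 (X Y F G h : V -> R) z v cX cY (F1 G1 h1 : V -> R) (F2 G2 h2 : R) :
 is_derive z v X cX -> is_derive z v Y cY ->
 is_derive z v F (F1 z) -> is_derive z v G (G1 z) -> is_derive z v h (h1 z) ->
 is_derive z v F1 F2 -> is_derive z v G1 G2 -> is_derive z v h1 h2 ->
 is_derive z v (Pfn1 cX cY X Y F G h F1 G1 h1)
  ((8 * (X z * cX + Y z * cY)^+2 + 4 * (1 + X z^+2+Y z^+2) * (cX^+2 + cY^+2)) * (F z^+2 + G z^+2)
   + 16 * (1 + X z^+2+Y z^+2) * (X z * cX + Y z * cY) * (F z * F1 z + G z * G1 z)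
   + 2 * (1 + X z^+2+Y z^+2)^+2 * (F1 z^+2 + G1 z^+2 + F z * F2 + G z * G2)
   + 8 * (2 * cX * F1 z + X z * F2 + 2 * cY * G1 z + Y z * G2)
   - 8 * h1 z ^+2 - 8 * h z * h2).
Proof.
move=> dX dY dF dG dh dF1 dG1 dh1; rewrite /Pfn1.
is_derive_eq_tac; ring.
Qed.

End Pfunction.

Ltac continuous_tac :=
  lazymatch goal with
  | H : {for ?x, continuous ?f} |- {for ?x, continuous ?f} => exact H
  | |- {for _, continuous (cst _)} => exact: cst_continuous
  | |- {for _, continuous (_ - _)} => apply: continuousB; continuous_tac
  | |- {for _, continuous (_ + _)} => apply: continuousD; continuous_tac
  | |- {for _, continuous (_ * _)} => apply: continuousM; continuous_tac
  | |- _ => auto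
  end.

(* The Laplacian of [Pfn] for harmonic [F], [G], [h]: [p, q, r, s] are the derivatives of
   [F] and [G], and [(f', g')] is the gradient of [h], kept apart from [(F, G) = (f, g)]
   because [F] and [G] will be difference quotients of [h]. *)
Definition Pfn_lap (R : realType) (x y f g f' g' p q r s : R) : R :=
  (8 * (x * x + y * y) + 8 * (1 + x * x + y * y)) * (f * f + g * g)
  + 16 * (1 + x * x + y * y) * (x * (f * p + g * q) + y * (f * r + g * s))
  + 2 * (1 + x * x + y * y) * (1 + x * x + y * y) * (p * p + q * q + r * r + s * s)
  + 16 * (p + s) - 8 * (f' * f' + g' * g').

(** The arguments [q q] and [- p] encode the symmetry of the Hessian and harmonicity, that is, the
    Cauchy-Riemann equations for [F = f - i g] with [F' = p - i q]. Up to sign, the two squared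
    terms are the real and imaginary parts of [s F' + 2 conj(x) F], where [s = 1 + |x|^2]; this is
    [s^-1] times the complex derivative of [s^2 F]. *)
Lemma Pfn_lap_ge0 (R : realType) (x y f g p q : R) :
  0 <= Pfn_lap x y f g f g p q q (- p).
Proof.
rewrite (_ : Pfn_lap _ _ _ _ _ _ _ _ _ _ =
  4 * (((1 + x * x + y * y) * p + 2 * (x * f - y * g)) ^+ 2 +
       ((1 + x * x + y * y) * q + 2 * (x * g + y * f)) ^+ 2)).
  by rewrite mulr_ge0// addr_ge0// sqr_ge0.
by rewrite /Pfn_lap; ring.
Qed.

(** The ten arguments are packed into one row vector, so that continuity for the sup norm yields a
    single tolerance valid for all of them. *)
Lemma Pfn_lap_continuous (R : realType) (b : nat -> R) (d : R) : 0 < d ->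
  exists2 e : R, 0 < e & forall a : nat -> R, (forall i, (i < 10)%N -> `|b i - a i| < e) ->
    Pfn_lap (b 0%N) (b 1%N) (b 2%N) (b 3%N) (b 4%N) (b 5%N) (b 6%N) (b 7%N) (b 8%N) (b 9%N) - d <
    Pfn_lap (a 0%N) (a 1%N) (a 2%N) (a 3%N) (a 4%N) (a 5%N) (a 6%N) (a 7%N) (a 8%N) (a 9%N).
Proof.
move=> d0.
pose c (i : nat) (v : 'rV[R]_10) : R := v 0 (inord i).
pose P (v : 'rV[R]_10) := Pfn_lap (c 0%N v) (c 1%N v) (c 2%N v) (c 3%N v) (c 4%N v)
  (c 5%N v) (c 6%N v) (c 7%N v) (c 8%N v) (c 9%N v).
pose w (a : nat -> R) : 'rV[R]_10 := \row_(i < 10) a i.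
have cw a i : (i < 10)%N -> c i (w a) = a i by move=> i10; rewrite /c mxE inordK.
have cc i : {for w b, continuous (c i)} by exact: coord_continuous.
have PC : {for w b, continuous P}.
  rewrite (_ : P =
    (cst 8 * (c 0%N * c 0%N + c 1%N * c 1%N) + cst 8 * (cst 1 + c 0%N * c 0%N + c 1%N * c 1%N))
      * (c 2%N * c 2%N + c 3%N * c 3%N)
    + cst 16 * (cst 1 + c 0%N * c 0%N + c 1%N * c 1%N) *
      (c 0%N * (c 2%N * c 6%N + c 3%N * c 7%N) + c 1%N * (c 2%N * c 8%N + c 3%N * c 9%N))
    + cst 2 * (cst 1 + c 0%N * c 0%N + c 1%N * c 1%N) * (cst 1 + c 0%N * c 0%N + c 1%N * c 1%N)
      * (c 6%N * c 6%N + c 7%N * c 7%N + c 8%N * c 8%N + c 9%N * c 9%N)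
    + cst 16 * (c 6%N + c 9%N) - cst 8 * (c 4%N * c 4%N + c 5%N * c 5%N)); last by apply/funext => v; rewrite !fctE.
  by continuous_tac.
have : nbhs (w b) [set v | P (w b) - d < P v].
  by apply: (cvgr_gt _ PC); rewrite ltrBlDr ltrDl.
move=> /nbhs_ballP[e /= e0 eP]; exists e => // a ab.
have := eP (w a); rewrite /P /= !cw//; apply.
by split => // i j; rewrite !mxE; apply: ab; exact: ltn_ord.
Qed.

Lemma rV2_coord_derive (R : realType) (x v : 'rV[R]_2) (j : 'I_2) :
  is_derive x v (fun y : 'rV[R]_2 => y 0 j) (v 0 j).
Proof.
have dI : derivable (@id 'rV[R]_2) x v by exact: derivable_id.
split; first by move/derivable_mxP : dI => /(_ 0 j).
have := derive_mx dI; rewrite derive_id => /matrixP/(_ 0 j).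
by rewrite mxE => ->.
Qed.

Lemma Pfn_continuous (R : realType) (X Y F G h : 'rV[R]_2 -> R) (z : 'rV[R]_2) :
  {for z, continuous X} -> {for z, continuous Y} -> {for z, continuous F} ->
  {for z, continuous G} -> {for z, continuous h} ->
  {for z, continuous (Pfn X Y F G h)}.
Proof.
move=> cX cY cF cG ch; rewrite /Pfn.
by continuous_tac.
Qed.

(** [p] and [p0] are perturbations of [q] and [q0]. The two errors together gain at most
    [2 * k = t / 4], while the penalty [s] costs at least [t / 2]; this is the origin of the [8] in
    the choice of [kap] below. *)
Lemma penalty_absurd (R : realType) (q q0 p p0 k t r r0 s : R) :
  `|p - q| <= k -> `|p0 - q0| <= k -> q + r <= q0 + r0 ->
  p0 + r0 <= p + r - s -> t / 2 <= s -> k = t / 8 -> 0 < t -> False.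
Proof.
rewrite !ler_norml => /andP[h1 h2] /andP[h3 h4] h5 h6 h7 h8 h9; lra.
Qed.

Lemma rV2_sqr_dist (R : realType) (x y : 'rV[R]_2) (r : R) : 0 <= r -> r <= `|x - y| ->
  r * r <= (y 0 0 - x 0 0) * (y 0 0 - x 0 0) + (y 0 1 - x 0 1) * (y 0 1 - x 0 1).
Proof.
move=> r0; rewrite leNgt rV2_norm_lt negb_and -!leNgt !mxE ![`|x _ _ - _|]distrC.
move: (y 0 0 - x 0 0) (y 0 1 - x 0 1) => p q.
have sqn (z : R) : z * z = `|z| * `|z| by rewrite -normrM -expr2 ger0_norm// sqr_ge0.
rewrite (sqn p) (sqn q) => /orP[] H.
  by rewrite ler_wpDr ?mulr_ge0// ler_pM.
by rewrite ler_wpDl ?mulr_ge0// ler_pM.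
Qed.

(** The three hypotheses say that the two difference quotients and [h] itself are harmonic, so their
    second derivatives cancel between the two axis directions. Each direction contributes one [d]
    from the quadratic penalties. *)
Lemma Pfn_lap_sum (R : realType) (x y f g f' g' p q r s a0 b0 a1 b1 k0 k1 hh d : R) :
  a0 + b0 = 0 -> a1 + b1 = 0 -> k0 + k1 = 0 ->
  ((8 * (x * 1 + y * 0)^+2 + 4 * (1 + x^+2+y^+2) * (1^+2 + 0^+2)) * (f^+2 + g^+2)
   + 16 * (1 + x^+2+y^+2) * (x * 1 + y * 0) * (f * p + g * q)
   + 2 * (1 + x^+2+y^+2)^+2 * (p^+2 + q^+2 + f * a0 + g * a1)
   + 8 * (2 * 1 * p + x * a0 + 2 * 0 * q + y * a1)
   - 8 * f' ^+2 - 8 * hh * k0 + d * (1 ^+ 2 + 0 ^+ 2)) +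
  ((8 * (x * 0 + y * 1)^+2 + 4 * (1 + x^+2+y^+2) * (0^+2 + 1^+2)) * (f^+2 + g^+2)
   + 16 * (1 + x^+2+y^+2) * (x * 0 + y * 1) * (f * r + g * s)
   + 2 * (1 + x^+2+y^+2)^+2 * (r^+2 + s^+2 + f * b0 + g * b1)
   + 8 * (2 * 0 * r + x * b0 + 2 * 1 * s + y * b1)
   - 8 * g' ^+2 - 8 * hh * k1 + d * (0 ^+ 2 + 1 ^+ 2)) =
  Pfn_lap x y f g f' g' p q r s + 2 * d.
Proof.
move=> /eqP; rewrite addrC addr_eq0 => /eqP-> /eqP; rewrite addrC addr_eq0 => /eqP->.
move=> /eqP; rewrite addrC addr_eq0 => /eqP->.
rewrite /Pfn_lap; ring.
Qed.

Section no_local_max.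
Variables (R : realType) (W : set 'rV[R]_2) (h : 'rV[R]_2 -> R).
Hypotheses (oW : open W) (hW : C2_on W h)
  (harm : forall x, W x -> partial 0 (partial 0 h) x + partial 1 (partial 1 h) x = 0).

Let X (y : 'rV[R]_2) : R := y 0 0.
Let Y (y : 'rV[R]_2) : R := y 0 1.
Let E (i : 'I_2) : 'rV[R]_2 := delta_mx 0 i.

Let D1 x i : W x -> is_derive x (E i) h (partial i h x).
Proof. by move=> Wx; apply: derivableP; have [] := hW.1 x Wx i. Qed.

Let D2 x i j : W x -> is_derive x (E i) (partial j h) (partial i (partial j h) x).
Proof. by move=> Wx; apply: derivableP; have [] := hW.2 j x Wx i. Qed.

Let C0 x : W x -> {for x, continuous h}.
Proof. by move=> Wx; exact: (C1_on_continuous oW hW.1 Wx). Qed.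

Let C1 x i : W x -> {for x, continuous (partial i h)}.
Proof. by move=> Wx; have [] := hW.1 x Wx i. Qed.

Let C2 x i j : W x -> {for x, continuous (partial i (partial j h))}.
Proof. by move=> Wx; have [] := hW.2 j x Wx i. Qed.

(** One mean value turns the quotient into a partial derivative at a shifted point, a second one
    estimates the shift. The rate is uniform as long as the second derivatives are bounded by
    [M]. *)
Lemma harmonic_diffquot_dist x (i : 'I_2) (e M : R) : 0 < e ->
  (forall t : R, `|t| <= e -> W (x + t *: E i) /\
     `|partial i (partial i h) (x + t *: E i)| <= M) ->
  `|diffquot e (E i) h x - partial i h x| <= e * M.
Proof.
move=> e0 H.
have [t te ->] : exists2 t : R, `|t| <= e & diffquot e (E i) h x = partial i h (x + t *: E i).
  by apply: diffquot_mvt => // t /H[Wt _]; exact: (hW.1 _ Wt i).1.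
have [s st ->] : exists2 s : R, `|s| <= `|t| & partial i h (x + t *: E i) - partial i h x =
    t * partial i (partial i h) (x + s *: E i).
  apply: (@mvt_line _ _ (partial i h)) => s st.
  by have [Wt _] := H s (le_trans st te); exact: (hW.2 i _ Wt i).1.
by rewrite normrM ler_pM//; have [] := H s (le_trans st te).
Qed.

(** [Pfn] is applied to constant functions and evaluated at [0] so as to be read as a polynomial in
    numbers. Factoring the differences of squares makes the bound linear in [e], which is how the
    step of the difference quotients is chosen later. *)
Lemma Pfn_perturb (x y f g f' g' hh M e : R) : 0 <= e -> 0 <= M ->
  `|x| <= M -> `|y| <= M -> `|f| <= M -> `|g| <= M -> `|f'| <= M -> `|g'| <= M ->
  `|f' - f| <= e * M -> `|g' - g| <= e * M ->
  `|Pfn (fun _ : R => x) (fun _ => y) (fun _ => f') (fun _ => g') (fun _ => hh) 0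
   - Pfn (fun _ : R => x) (fun _ => y) (fun _ => f) (fun _ => g) (fun _ => hh) 0|
  <= e * ((1 + M * M + M * M) * (1 + M * M + M * M) * (M * (M + M) + M * (M + M)) + 8 * (M * M + M * M)).
Proof.
move=> e0 M0 hx hy hf hg hf' hg' df dg; rewrite /Pfn !fctE /cst.
rewrite (_ : _ - _ = (1 + x * x + y * y) * (1 + x * x + y * y) *
  ((f' - f) * (f' + f) + (g' - g) * (g' + g)) + 8 * (x * (f' - f) + y * (g' - g))); last by ring.
have s0 : 0 <= 1 + x * x + y * y by rewrite !addr_ge0// -expr2 sqr_ge0.
have xx : x * x <= M * M by rewrite -(ger0_norm (sqr_ge0 x : 0 <= x * x)) normrM ler_pM.
have yy : y * y <= M * M by rewrite -(ger0_norm (sqr_ge0 y : 0 <= y * y)) normrM ler_pM.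
have sM : 1 + x * x + y * y <= 1 + M * M + M * M by rewrite !lerD.
rewrite [leRHS](_ : _ = (1 + M * M + M * M) * (1 + M * M + M * M) * (e * M * (M + M) + e * M * (M + M))
  + 8 * (M * (e * M) + M * (e * M))); last by ring.
apply: (le_trans (ler_normD _ _)); apply: lerD.
  rewrite normrM ler_pM//.
    by rewrite ger0_norm ?mulr_ge0// ler_pM.
  apply: (le_trans (ler_normD _ _)); rewrite !normrM.
  by apply: lerD; rewrite ler_pM//; apply: (le_trans (ler_normD _ _)); rewrite lerD.
rewrite normrM ger0_norm// ler_pM//.
by apply: (le_trans (ler_normD _ _)); rewrite !normrM lerD// ler_pM.
Qed.

(* The second derivatives of [Pfn X Y (partial 0 h) (partial 1 h) h] involve third
   derivatives of [h], which is only C^2. So the partial derivatives are replaced by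
   difference quotients: these are C^2 and harmonic, and the penalty [d] makes the strict
   inequality survive the perturbation. *)
Lemma Pfn_no_local_max (x0 : 'rV[R]_2) (d : R) : W x0 -> 0 < d ->
  ~ (\forall y \near x0, Pfn X Y (partial 0 h) (partial 1 h) h y + d * (X y * X y + Y y * Y y)
       <= Pfn X Y (partial 0 h) (partial 1 h) h x0 + d * (X x0 * X x0 + Y x0 * Y x0)).
Proof.
move=> Wx0 d0 locmax.
pose H i j := partial i (partial j h).
(* The gradient of [h] occurs twice because [Pfn_lap] keeps [(f, g)] and [(f', g')] apart: after the
   perturbation the first pair becomes difference quotients while the second stays the true
   gradient. *)
pose phis := [:: X; Y; partial 0 h; partial 1 h; partial 0 h; partial 1 h;
                 H 0 0; H 1 0; H 0 1; H 1 1].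
pose phi (k : nat) : 'rV[R]_2 -> R := nth 0 phis k.
have [eta eta0 etaP] := Pfn_lap_continuous (fun k => phi k x0) d0.
have base0 : 0 <= Pfn_lap (phi 0%N x0) (phi 1%N x0) (phi 2%N x0) (phi 3%N x0) (phi 4%N x0)
   (phi 5%N x0) (phi 6%N x0) (phi 7%N x0) (phi 8%N x0) (phi 9%N x0).
  have -> : phi 8%N x0 = phi 7%N x0 by rewrite /phi /= /H (partialC oW hW Wx0).
  have -> : phi 9%N x0 = - phi 6%N x0.
    by apply/eqP; rewrite -addr_eq0 addrC; apply/eqP; exact: harm.
  exact: Pfn_lap_ge0.
have phiC (k : 'I_10) : {for x0, continuous (phi k)}.
  case: k => -[?|[?|[?|[?|[?|[?|[?|[?|[?|[?|k Hk]]]]]]]]]].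
  - exact: coord_continuous.
  - exact: coord_continuous.
  - exact: (@C1 x0 0 Wx0).
  - exact: (@C1 x0 1 Wx0).
  - exact: (@C1 x0 0 Wx0).
  - exact: (@C1 x0 1 Wx0).
  - exact: (@C2 x0 0 0 Wx0).
  - exact: (@C2 x0 1 0 Wx0).
  - exact: (@C2 x0 0 1 Wx0).
  - exact: (@C2 x0 1 1 Wx0).
  - by exfalso; move: Hk; rewrite !ltnS ltn0.
have m1 : 0 < Num.min eta 1 by rewrite lt_min eta0 ltr01.
have nphi : \forall y \near x0, forall k : 'I_10, `|phi k x0 - phi k y| < Num.min eta 1.
  have K (k : 'I_10) : \forall y \near x0, `|phi k x0 - phi k y| < Num.min eta 1.
    by have /cvgr_dist_lt/(_ _ m1) := phiC k.
  exact: (filter_forall _ K).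
have nW : \forall y \near x0, W y by exact: open_nbhs_nbhs.
have : \forall y \near x0, W y /\
    (Pfn X Y (partial 0 h) (partial 1 h) h y + d * (X y * X y + Y y * Y y)
       <= Pfn X Y (partial 0 h) (partial 1 h) h x0 + d * (X x0 * X x0 + Y x0 * Y x0) /\
     forall k : 'I_10, `|phi k x0 - phi k y| < Num.min eta 1).
  by apply: filterI; [exact: nW|apply: filterI; [exact: locmax|exact: nphi]].
move=> /nbhs_normP[r /= r0 rP].
have {}rP y : `|x0 - y| < r -> [/\ W y,
    Pfn X Y (partial 0 h) (partial 1 h) h y + d * (X y * X y + Y y * Y y)
       <= Pfn X Y (partial 0 h) (partial 1 h) h x0 + d * (X x0 * X x0 + Y x0 * Y x0),
    forall k : nat, (k < 10)%N -> `|phi k x0 - phi k y| < eta &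
    forall k : nat, (k < 10)%N -> `|phi k y| <= 1 + \sum_(j < 10) `|phi j x0|].
  move=> /rP[Wy [My py]]; split => // k k10; have := py (Ordinal k10) => /=; rewrite lt_min => /andP[]//.
  move=> _ k1; rewrite (_ : phi k y = phi k x0 - (phi k x0 - phi k y)); last by ring.
  rewrite addrC; apply: (le_trans (ler_normD _ _)); rewrite normrN lerD//; first exact: ltW.
  rewrite (bigD1 (Ordinal k10))//= lerDl; exact: sumr_ge0.
set M := 1 + _ in rP.
have M1 : 1 <= M by rewrite lerDl; exact: sumr_ge0.
have M0 : 0 <= M by exact: le_trans M1.
(* Shifting a point of the closed ball of radius [rho] by at most [e <= rho] keeps it within
   [2 * rho < r] of [x0], where all bounds hold. *)
pose rho := r / 3.
have rho0 : 0 < rho by rewrite divr_gt0.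
have rho2 : rho + rho < r by rewrite -mulrDl ltr_pdivrMr// (_ : r * 3 = r + r + r) ?ltrDl//; ring.
pose K := (1 + M * M + M * M) * (1 + M * M + M * M) * (M * (M + M) + M * (M + M)) + 8 * (M * M + M * M).
have MM : 0 <= M * M by rewrite mulr_ge0.
have K0 : 0 < K.
  rewrite /K ltr_wpDl//; first by rewrite !mulr_ge0// ?addr_ge0// mulr_ge0// addr_ge0.
  by rewrite mulr_gt0// addr_gt0// mulr_gt0// (lt_le_trans ltr01).
pose kap := d * (rho * rho) / 8.
have kap0 : 0 < kap by rewrite divr_gt0// !mulr_gt0.
pose e := Num.min rho (kap / K).
have e0 : 0 < e by rewrite lt_min rho0 divr_gt0.
have erho : e <= rho by rewrite ge_min lexx.
have eK : e * K <= kap by rewrite -ler_pdivlMr// ge_min lexx orbT.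
have normE i : `|E i| <= 1.
  by rewrite rV2_norm_le !mxE; move: i; apply: ord2_ind; rewrite /= ?normr0 ?normr1 ?ler01 ?lexx.
have inball y t i : `|x0 - y| <= rho -> `|t| <= e -> `|x0 - (y + t *: E i)| < r.
  move=> yr te; apply: le_lt_trans rho2; rewrite opprD addrA.
  apply: (le_trans (ler_normB _ _)); rewrite lerD// normrZ.
  by rewrite (le_trans _ erho)// (le_trans _ te)// ler_piMr.
have inball0 y : `|x0 - y| <= rho -> `|x0 - y| < r.
  by move=> yr; apply: le_lt_trans rho2; rewrite (le_trans yr)// lerDl ltW.
have ee : `|e| <= e by rewrite gtr0_norm.
have bnd1 y i : `|x0 - y| < r -> `|partial i h y| <= M.
  move=> /rP[_ _ _ b]; move: i; apply: ord2_ind; [exact: (b 2%N isT)|exact: (b 3%N isT)].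
have bnd2 y i : `|x0 - y| < r -> `|partial i (partial i h) y| <= M.
  move=> /rP[_ _ _ b]; move: i; apply: ord2_ind; [exact: (b 6%N isT)|exact: (b 9%N isT)].
pose F i := diffquot e (E i) h.
pose Qe := Pfn X Y (F 0) (F 1) h.
have QeQ y : `|x0 - y| <= rho -> `|Qe y - Pfn X Y (partial 0 h) (partial 1 h) h y| <= kap.
  move=> yr; apply: le_trans eK.
  have FM i : `|F i y| <= M /\ `|F i y - partial i h y| <= e * M.
    split.
      have [t te ->] : exists2 t : R, `|t| <= e & F i y = partial i h (y + t *: E i).
        apply: diffquot_mvt => // t te; have [Wt _ _ _] := rP _ (inball y t i yr te).
        exact: (hW.1 _ Wt i).1.
      exact: bnd1 (inball y t i yr te).
    apply: harmonic_diffquot_dist => // t te.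
    have [Wt _ _ _] := rP _ (inball y t i yr te); split=> //.
    exact: bnd2 (inball y t i yr te).
  have [_ _ _ b] := rP _ (inball0 y yr).
  exact: (@Pfn_perturb (X y) (Y y) (partial 0 h y) (partial 1 h y) (F 0 y) (F 1 y) (h y) M e
    (ltW e0) M0 (b 0%N isT) (b 1%N isT) (b 2%N isT) (b 3%N isT) (FM 0).1 (FM 1).1 (FM 0).2 (FM 1).2).
pose a := X x0; pose b := Y x0.
(* The subtracted term keeps the maximum over [A] away from the boundary of [A]. The quadratic terms
   have Laplacian [4 * d - 2 * d]; [Pfn_lap_continuous] gives away one [d], and the other makes the
   total positive at the maximum, a contradiction. *)
pose g := Qe + cst d * (X * X + Y * Y) -
          cst (d / 2) * ((X - cst a) * (X - cst a) + (Y - cst b) * (Y - cst b)).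
pose A := closed_ball_ Num.Def.normr x0 rho.
have cA : compact A.
  apply: bounded_closed_compact; last exact: closed_closed_ball_.
  exists (`|x0| + rho); split; first exact: num_real.
  move=> m mr y /= yr; apply: le_trans (ltW mr).
  rewrite (_ : y = x0 - (x0 - y)); last by rewrite opprB addrC subrK.
  by apply: (le_trans (ler_normB _ _)); rewrite lerD2l.
have cF y i : `|x0 - y| <= rho -> {for y, continuous (F i)}.
  move=> yr; have [Wy _ _ _] := rP _ (inball0 y yr).
  have [We _ _ _] := rP _ (inball y e i yr ee).
  rewrite (_ : F i = cst e^-1 * (h \o (fun z => z + e *: E i) - h)); last by apply/funext.
  apply: continuousM; first exact: cst_continuous.
  apply: continuousB; last exact: C0.
  apply: continuous_comp; last exact: C0.
  by apply: (@continuousD _ _ _ id (cst _)); [exact: cvg_id|exact: cst_continuous].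
have cX y : {for y, continuous X} by exact: coord_continuous.
have cY y : {for y, continuous Y} by exact: coord_continuous.
have cg : {within A, continuous g}.
  apply: continuous_in_subspaceT => y; rewrite inE /A /closed_ball_ /= => yr.
  have [Wy _ _ _] := rP _ (inball0 y yr).
  have cQ : {for y, continuous Qe}.
    exact: (Pfn_continuous (cX y) (cY y) (cF y 0 yr) (cF y 1 yr) (C0 Wy)).
  have cXy := cX y; have cYy := cY y.
  apply: continuousB; first by continuous_tac.
  apply: continuousM; first exact: cst_continuous.
  apply: continuousD; first by continuous_tac.
  by apply: continuousM; apply: continuousB; [exact: cYy|continuous_tac|exact: cYy|continuous_tac].
have Ax0 : A x0 by rewrite /A /closed_ball_ /= subrr normr0 ltW.
have [y yA ymax] := compact_EVT_max (ex_intro _ x0 Ax0) cA cg.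
have yr : `|x0 - y| <= rho by move: yA; rewrite inE.
have {}ymax z : `|x0 - z| <= rho -> g z <= g y by move=> zr; apply: ymax; rewrite inE.
have gE z : g z = Qe z + d * (X z * X z + Y z * Y z)
    - d / 2 * ((X z - a) * (X z - a) + (Y z - b) * (Y z - b)) by [].
have ylt : `|x0 - y| < rho.
  rewrite lt_neqAle yr andbT; apply/negP => /eqP yrho.
  have far : rho * rho <= (X y - a) * (X y - a) + (Y y - b) * (Y y - b).
    by apply: rV2_sqr_dist; [exact: ltW|rewrite yrho].
  have [_ My _ _] := rP _ (inball0 y yr).
  have mx0 : Qe x0 + d * (X x0 * X x0 + Y x0 * Y x0) <= Qe y + d * (X y * X y + Y y * Y y)
     - d / 2 * ((X y - a) * (X y - a) + (Y y - b) * (Y y - b)).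
    have := ymax x0; rewrite subrr normr0 => /(_ (ltW rho0)).
    by rewrite !gE [X x0 - a]subrr [Y x0 - b]subrr !mulr0 addr0 mulr0 subr0.
  have q0 : `|Qe x0 - Pfn X Y (partial 0 h) (partial 1 h) h x0| <= kap.
    by apply: QeQ; rewrite subrr normr0 ltW.
  apply: (penalty_absurd (QeQ y yr) q0 My mx0 _ (erefl _)); last by rewrite !mulr_gt0.
  by rewrite mulrAC ler_wpM2l// ltW// divr_gt0.
have near_y : \forall z \near y, `|x0 - z| < rho.
  have : \forall z \near y, `|y - z| < rho - `|x0 - y|.
    by apply/nbhs_normP; exists (rho - `|x0 - y|) => //=; rewrite subr_gt0.
  apply: filterS => z; rewrite ltrBrDl; apply: le_lt_trans.
  by rewrite (_ : x0 - z = (x0 - y) + (y - z)) ?ler_normD// subrKA.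
have gmax : \forall z \near y, g z <= g y.
  by apply: filterS near_y => z zr; apply: ymax; exact: ltW.
pose g1 i : 'rV[R]_2 -> R := Pfn1 (E i 0 0) (E i 0 1) X Y (F 0) (F 1) h
   (diffquot e (E 0) (partial i h)) (diffquot e (E 1) (partial i h)) (partial i h)
   + cst (2 * d) * (cst (E i 0 0) * X + cst (E i 0 1) * Y)
   - cst d * (cst (E i 0 0) * (X - cst a) + cst (E i 0 1) * (Y - cst b)).
have dX z i : is_derive z (E i) X (E i 0 0) by exact: rV2_coord_derive.
have dY z i : is_derive z (E i) Y (E i 0 1) by exact: rV2_coord_derive.
have inW z : `|x0 - z| <= rho -> W z by move=> zr; have [] := rP _ (inball0 z zr).
have inWe z i : `|x0 - z| <= rho -> W (z + e *: E i).
  by move=> zr; have [] := rP _ (inball z e i zr ee).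
have dF z i j : `|x0 - z| <= rho ->
    is_derive z (E i) (F j) (diffquot e (E j) (partial i h) z).
  by move=> zr; apply: is_derive_diffquot; apply: D1; [exact: inW|exact: inWe].
have dF2 z i j : `|x0 - z| <= rho -> is_derive z (E i) (diffquot e (E j) (partial i h))
    (diffquot e (E j) (partial i (partial i h)) z).
  by move=> zr; apply: is_derive_diffquot; apply: D2; [exact: inW|exact: inWe].
have D1z i z : W z -> is_derive z (E i) h (partial i h z) by exact: D1.
have dg i z : `|x0 - z| <= rho -> is_derive z (E i) g (g1 i z).
  move=> zr.
  have dQ : is_derive z (E i) Qe (Pfn1 (E i 0 0) (E i 0 1) X Y (F 0) (F 1) h
   (diffquot e (E 0) (partial i h)) (diffquot e (E 1) (partial i h)) (partial i h) z).
    exact: (@is_derive_Pfn _ _ X Y (F 0) (F 1) h z (E i) _ _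
      (diffquot e (E 0) (partial i h)) (diffquot e (E 1) (partial i h)) (partial i h)
      (dX z i) (dY z i) (dF z i 0 zr) (dF z i 1 zr) (D1z i z (inW z zr))).
  have dXz := dX z i; have dYz := dY z i.
  rewrite /g; is_derive_eq_tac.
  rewrite /g1 !fctE /cst; move: (Pfn1 _ _ _ _ _ _ _ _ _ _ z) => *.
  by field.
pose dd i : R :=
  ((8 * (X y * E i 0 0 + Y y * E i 0 1)^+2
     + 4 * (1 + X y^+2+Y y^+2) * (E i 0 0^+2 + E i 0 1^+2)) * (F 0 y^+2 + F 1 y^+2)
   + 16 * (1 + X y^+2+Y y^+2) * (X y * E i 0 0 + Y y * E i 0 1) *
     (F 0 y * diffquot e (E 0) (partial i h) y + F 1 y * diffquot e (E 1) (partial i h) y)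
   + 2 * (1 + X y^+2+Y y^+2)^+2 *
     (diffquot e (E 0) (partial i h) y^+2 + diffquot e (E 1) (partial i h) y^+2
      + F 0 y * diffquot e (E 0) (partial i (partial i h)) y
      + F 1 y * diffquot e (E 1) (partial i (partial i h)) y)
   + 8 * (2 * E i 0 0 * diffquot e (E 0) (partial i h) y
      + X y * diffquot e (E 0) (partial i (partial i h)) y
      + 2 * E i 0 1 * diffquot e (E 1) (partial i h) y
      + Y y * diffquot e (E 1) (partial i (partial i h)) y)
   - 8 * partial i h y ^+2 - 8 * h y * partial i (partial i h) y
   + d * (E i 0 0 ^+ 2 + E i 0 1 ^+ 2)).
have dg2 i : is_derive y (E i) (g1 i) (dd i).
  rewrite /dd.
  have dQ := @is_derive_Pfn1 _ _ X Y (F 0) (F 1) h y (E i) _ _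
      (diffquot e (E 0) (partial i h)) (diffquot e (E 1) (partial i h)) (partial i h) _ _ _
      (dX y i) (dY y i) (dF y i 0 yr) (dF y i 1 yr) (D1z i y (inW y yr))
      (dF2 y i 0 yr) (dF2 y i 1 yr) (D2 i i (inW y yr)).
  have dXz := dX y i; have dYz := dY y i.
  rewrite /g1; is_derive_eq_tac.
  move: (diffquot _ _ _ y) (diffquot _ _ _ y) (diffquot _ _ _ y) (diffquot _ _ _ y) => *.
  ring.
have dqsum j : diffquot e (E j) (partial 0 (partial 0 h)) y +
    diffquot e (E j) (partial 1 (partial 1 h)) y = 0.
  have h1 := harm (inW y yr); have h2 := harm (inWe y j yr).
  by rewrite /diffquot -scalerDr addrACA -opprD [X in X - _]h2 [X in _ - X]h1 subrr scaler0.
have le0 i : dd i <= 0.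
  apply: (second_is_derive_at_max _ (dg2 i) gmax).
  by apply: filterS near_y => z zr; apply: dg; exact: ltW.
have E00 : E 0 0 0 = 1 by rewrite mxE.
have E01 : E 0 0 1 = 0 by rewrite mxE.
have E10 : E 1 0 0 = 0 by rewrite mxE.
have E11 : E 1 0 1 = 1 by rewrite mxE.
have := lerD (le0 0) (le0 1).
rewrite /dd E00 E01 E10 E11 (Pfn_lap_sum _ _ _ _ _ _ _ _ _ _ _ _ (dqsum 0) (dqsum 1) (harm (inW y yr))).
pose al := [:: X y; Y y; F 0 y; F 1 y; partial 0 h y; partial 1 h y;
  diffquot e (E 0) (partial 0 h) y; diffquot e (E 1) (partial 0 h) y;
  diffquot e (E 0) (partial 1 h) y; diffquot e (E 1) (partial 1 h) y].
have dqe (f : 'rV[R]_2 -> R) (k : nat) i : (k < 10)%N -> phi k = partial i f ->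
    (forall z, W z -> derivable f z (E i)) -> `|phi k x0 - diffquot e (E i) f y| < eta.
  move=> k10 kf fd.
  have [t te ->] : exists2 t : R, `|t| <= e & diffquot e (E i) f y = partial i f (y + t *: E i).
    by apply: diffquot_mvt => // t te; apply: fd; have [] := rP _ (inball y t i yr te).
  by have [_ _ /(_ k k10) + _] := rP _ (inball y t i yr te); rewrite kf.
have [_ _ near0 _] := rP _ (inball0 y yr).
have dh i z : W z -> derivable h z (E i) by move=> Wz; exact: (hW.1 _ Wz i).1.
have dph i j z : W z -> derivable (partial j h) z (E i) by move=> Wz; exact: (hW.2 j _ Wz i).1.
have := etaP (fun k => nth 0 al k); rewrite ltrBlDr => H1 H2.
have : 0 < Pfn_lap (X y) (Y y) (F 0 y) (F 1 y) (partial 0 h y) (partial 1 h y)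
  (diffquot e (E 0) (partial 0 h) y) (diffquot e (E 1) (partial 0 h) y)
  (diffquot e (E 0) (partial 1 h) y) (diffquot e (E 1) (partial 1 h) y) + 2 * d.
  rewrite mulr_natl mulr2n addrA ltr_pwDr//; apply: (le_trans base0); apply: ltW; apply: H1.
  case=> [|[|[|[|[|[|[|[|[|[|//]]]]]]]]]] k10.
  - exact: near0.
  - exact: near0.
  - exact: (dqe h 2%N 0 isT erefl (dh 0)).
  - exact: (dqe h 3%N 1 isT erefl (dh 1)).
  - exact: near0.
  - exact: near0.
  - exact: (dqe (partial 0 h) 6%N 0 isT erefl (dph 0 0)).
  - exact: (dqe (partial 0 h) 7%N 1 isT erefl (dph 1 0)).
  - exact: (dqe (partial 1 h) 8%N 0 isT erefl (dph 0 1)).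
  - exact: (dqe (partial 1 h) 9%N 1 isT erefl (dph 1 1)).
by rewrite ltNge; apply/negP; rewrite negbK -[leRHS](addr0 0).
Qed.

End no_local_max.

(** * The stereographic chart *)

Lemma C1_on_intro (R : realType) (W : set 'rV[R]_2) (f : 'rV[R]_2 -> R)
    (df : 'I_2 -> 'rV[R]_2 -> R) : open W ->
  (forall x i, W x -> is_derive x (delta_mx 0 i : 'rV[R]_2) f (df i x)) ->
  (forall x i, W x -> {for x, continuous (df i)}) -> C1_on W f.
Proof.
move=> oW dfP cdf x Wx i; split; first by have [] := dfP x i Wx.
have E y : W y -> partial i f y = df i y by move=> Wy; have [_] := dfP y i Wy.
have nE : \forall y \near x, df i y = partial i f y.
  by apply: filterS (open_nbhs_nbhs (conj oW Wx)) => y /E ->.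
have c : df i @ nbhs x --> df i x := cdf x i Wx.
suff : partial i f @ nbhs x --> partial i f x by [].
by rewrite E//; apply: cvg_trans c; exact: near_eq_cvg.
Qed.

Section C1_algebra.
Variables (R : realType) (W : set 'rV[R]_2).
Hypothesis oW : open W.
Implicit Types f g : 'rV[R]_2 -> R.

Let dP f x i : C1_on W f -> W x -> is_derive x (delta_mx 0 i : 'rV[R]_2) f (partial i f x).
Proof. by move=> fW Wx; apply: derivableP; have [] := fW x Wx i. Qed.

Let cP f x : C1_on W f -> W x -> {for x, continuous f}.
Proof. by move=> fW Wx; exact: C1_on_continuous oW fW Wx. Qed.

Let cdP f x i : C1_on W f -> W x -> {for x, continuous (partial i f)}.
Proof. by move=> fW Wx; have [] := fW x Wx i. Qed.

Lemma C1_on_cst (a : R) : C1_on W (cst a).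
Proof.
apply: (@C1_on_intro _ _ _ (fun _ => cst 0) oW) => x i _.
exact: cst_continuous.
Qed.

Lemma C1_on_coord (j : 'I_2) : C1_on W (fun x : 'rV[R]_2 => x 0 j).
Proof.
apply: (@C1_on_intro _ _ _ (fun i => cst ((delta_mx 0 i : 'rV[R]_2) 0 j)) oW) => x i _.
  exact: rV2_coord_derive.
exact: cst_continuous.
Qed.

Lemma C1_onD f g : C1_on W f -> C1_on W g -> C1_on W (f + g).
Proof.
move=> fW gW.
apply: (@C1_on_intro _ _ _ (fun i => (partial i f : 'rV[R]_2 -> R) + partial i g) oW) => x i Wx.
  exact: is_deriveD (dP i fW Wx) (dP i gW Wx).
apply: continuousD; exact: cdP.
Qed.

Lemma C1_onM f g : C1_on W f -> C1_on W g -> C1_on W (f * g).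
Proof.
move=> fW gW.
apply: (@C1_on_intro _ _ _ (fun i => f * (partial i g : 'rV[R]_2 -> R) + g * (partial i f : 'rV[R]_2 -> R)) oW) => x i Wx.
  exact: is_deriveM (dP i fW Wx) (dP i gW Wx).
by apply: continuousD; apply: continuousM; first [exact: cdP|exact: cP].
Qed.

Lemma C1_onN f : C1_on W f -> C1_on W (- f).
Proof.
move=> fW; have -> : - f = cst (-1) * f by apply/funext => x; rewrite !fctE mulN1r.
exact: C1_onM (C1_on_cst (-1)) fW.
Qed.

Lemma C1_onB f g : C1_on W f -> C1_on W g -> C1_on W (f - g).
Proof. move=> fW gW; exact: C1_onD fW (C1_onN gW). Qed.

End C1_algebra.

Ltac C1_tac :=
  lazymatch goal with
  | |- C1_on _ (cst _) => apply: C1_on_cst; assumption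
  | |- C1_on _ (_ - _) => apply: C1_onB; [assumption|C1_tac|C1_tac]
  | |- C1_on _ (_ + _) => apply: C1_onD; [assumption|C1_tac|C1_tac]
  | |- C1_on _ (_ * _) => apply: C1_onM; [assumption|C1_tac|C1_tac]
  | |- _ => first [assumption | by auto]
  end.

(* The conformal factor of [chart] is [2 * sinv]. *)
Definition sinv (R : realType) (x : 'rV[R]_2) : R := (1 + x 0 0 * x 0 0 + x 0 1 * x 0 1)^-1.

Lemma s_gt0 (R : realType) (x : 'rV[R]_2) : 0 < 1 + x 0 0 * x 0 0 + x 0 1 * x 0 1.
Proof. by rewrite -addrA ltr_pwDl// addr_ge0// -expr2 sqr_ge0. Qed.

Lemma sinv_gt0 (R : realType) (x : 'rV[R]_2) : 0 < sinv x.
Proof. by rewrite invr_gt0 s_gt0. Qed.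

Lemma is_derive_sinv (R : realType) (x v : 'rV[R]_2) :
  is_derive x v (@sinv R) (- (2 * (x 0 0 * v 0 0 + x 0 1 * v 0 1)) * sinv x ^+ 2).
Proof.
pose X (y : 'rV[R]_2) : R := y 0 0; pose Y (y : 'rV[R]_2) : R := y 0 1.
have dX : is_derive x v X (v 0 0) by exact: rV2_coord_derive.
have dY : is_derive x v Y (v 0 1) by exact: rV2_coord_derive.
have ds : is_derive x v (cst 1 + X * X + Y * Y) (2 * (x 0 0 * v 0 0 + x 0 1 * v 0 1)).
  by is_derive_eq_tac; rewrite /X /Y; ring.
have s0 : (cst 1 + X * X + Y * Y) x != 0 by rewrite gt_eqF// s_gt0.
split; first by apply: derivableV => //; have [] := ds.
rewrite (deriveV s0); last by have [] := ds.
by have [_ ->] := ds; rewrite -[_ *: _]/(_ * _) /sinv exprVn mulrC mulNr mulrN.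
Qed.

Lemma sinv_continuous (R : realType) (x : 'rV[R]_2) : {for x, continuous (@sinv R)}.
Proof.
apply: continuousV; first by rewrite gt_eqF// s_gt0.
pose X (y : 'rV[R]_2) : R := y 0 0; pose Y (y : 'rV[R]_2) : R := y 0 1.
have cX : {for x, continuous X} by exact: coord_continuous.
have cY : {for x, continuous Y} by exact: coord_continuous.
by apply: (@continuousD _ _ _ (cst 1 + X * X) (Y * Y)); continuous_tac.
Qed.

Lemma C1_on_sinv (R : realType) (W : set 'rV[R]_2) : open W -> C1_on W (@sinv R).
Proof.
move=> oW.
pose X (y : 'rV[R]_2) : R := y 0 0; pose Y (y : 'rV[R]_2) : R := y 0 1.
have cX x : {for x, continuous X} by exact: coord_continuous.
have cY x : {for x, continuous Y} by exact: coord_continuous.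
pose E i : 'rV[R]_2 := delta_mx 0 i.
apply: (@C1_on_intro _ _ _ (fun i => cst (-2) * (X * cst (E i 0 0) + Y * cst (E i 0 1)) * ((@sinv R) * (@sinv R))) oW) => x i _.
  have := is_derive_sinv x (E i); congr (is_derive _ _ _ _).
  by rewrite !fctE /cst /X /Y expr2; ring.
have cXx := cX x; have cYx := cY x; have cs := @sinv_continuous R x.
continuous_tac.
Qed.

Lemma ord3_ind (P : 'I_3 -> Prop) : P 0 -> P 1 -> P ord_max -> forall i, P i.
Proof.
move=> P0 P1 P2 i.
case: i => -[|[|[|//]]] Hi; [move: P0|move: P1|move: P2]; by congr P; apply: val_inj.
Qed.

Lemma sum_ord3 (V : nmodType) (F : 'I_3 -> V) : \sum_(i < 3) F i = F 0 + F 1 + F ord_max.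
Proof.
rewrite !big_ord_recl big_ord0 addr0 addrA.
by congr (F _ + F _ + F _); apply: val_inj.
Qed.

Lemma dot3E (R : realType) (p q : 'rV[R]_3) :
  dot p q = p 0 0 * q 0 0 + p 0 1 * q 0 1 + p 0 ord_max * q 0 ord_max.
Proof. exact: sum_ord3. Qed.

Lemma dot2E (R : realType) (p q : 'rV[R]_2) : dot p q = p 0 0 * q 0 0 + p 0 1 * q 0 1.
Proof. exact: sum_ord2. Qed.

Lemma chartE (R : realType) (x : 'rV[R]_2) :
  [/\ chart x 0 0 = 2 * x 0 0 * sinv x, chart x 0 1 = 2 * x 0 1 * sinv x
    & chart x 0 ord_max = 2 * sinv x - 1].
Proof.
have s0 := s_gt0 x.
have sE : 1 + dot x x = 1 + x 0 0 * x 0 0 + x 0 1 * x 0 1 by rewrite dot2E addrA.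
have l0 : (0 : 'I_3) = lshift 1 (0 : 'I_2) by apply: val_inj.
have l1 : (1 : 'I_3) = lshift 1 (1 : 'I_2) by apply: val_inj.
have l2 : (ord_max : 'I_3) = rshift 2 (0 : 'I_1) by apply: val_inj.
rewrite /chart sE l0 l1 l2; split.
- by rewrite [LHS]mxE (row_mxEl (2 *: x : 'rV_2)) mxE mulrC.
- by rewrite [LHS]mxE (row_mxEl (2 *: x : 'rV_2)) mxE mulrC.
- rewrite [LHS]mxE (row_mxEr (2 *: x : 'rV_2)) mxE eqxx mulr1n /sinv dot2E.
  by field; rewrite gt_eqF.
Qed.

Lemma sphere_chart (R : realType) (x : 'rV[R]_2) : sphere (chart x).
Proof.
have [c0 c1 c2] := chartE x; have s0 := s_gt0 x.
by rewrite /sphere /= dot3E c0 c1 c2 /sinv; field; rewrite gt_eqF.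
Qed.

Lemma stereoE (R : realType) (p : 'rV[R]_3) :
  stereo p 0 0 = (1 + p 0 ord_max)^-1 * p 0 0 /\ stereo p 0 1 = (1 + p 0 ord_max)^-1 * p 0 1.
Proof.
have l0 : (0 : 'I_3) = lshift 1 (0 : 'I_2) by apply: val_inj.
have l1 : (1 : 'I_3) = lshift 1 (1 : 'I_2) by apply: val_inj.
by rewrite l0 l1 /stereo !mxE.
Qed.

Lemma stereoK (R : realType) (p : 'rV[R]_3) : sphere p -> p 0 ord_max != -1 ->
  chart (stereo p) = p.
Proof.
rewrite /sphere /= dot3E => sp pN.
have [c0 c1 c2] := chartE (stereo p); have [s0 s1] := stereoE p.
have p1 : 1 + p 0 ord_max != 0 by rewrite addrC addr_eq0.
have sE : sinv (stereo p) = (1 + p 0 ord_max) / 2.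
  rewrite /sinv s0 s1; set a := p 0 0 in sp *; set b := p 0 1 in sp *; set c := p 0 ord_max in sp p1 *.
  have -> : 1 + (1 + c)^-1 * a * ((1 + c)^-1 * a) + (1 + c)^-1 * b * ((1 + c)^-1 * b) = 2 / (1 + c).
    have -> : 1 + (1 + c)^-1 * a * ((1 + c)^-1 * a) + (1 + c)^-1 * b * ((1 + c)^-1 * b) =
      (1 + 2 * c + (a * a + b * b + c * c)) / (1 + c) ^+ 2 by field.
    by rewrite sp; field.
  by rewrite invf_div.
apply/rowP; apply: ord3_ind.
- by rewrite c0 s0 sE; field.
- by rewrite c1 s1 sE; field.
- by rewrite c2 sE; field.
Qed.

Lemma chartK (R : realType) (x : 'rV[R]_2) : stereo (chart x) = x.
Proof.
have [c0 c1 c2] := chartE x; have [s0 s1] := stereoE (chart x).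
have sg := sinv_gt0 x.
have sn : sinv x != 0 by rewrite gt_eqF.
apply/rowP; apply: ord2_ind; [rewrite s0 c0|rewrite s1 c1]; rewrite c2 (addrC 1) subrK.
  by field.
by field.
Qed.

Lemma chart_continuous (R : realType) : continuous (@chart R).
Proof.
move=> x.
suff c k : {for x, continuous (fun y : 'rV[R]_2 => chart y 0 k)}.
  suff : @chart R @ nbhs x --> chart x by [].
  apply/cvgrPdist_lt => e e0.
  have K k : \forall y \near x, `|chart x 0 k - chart y 0 k| < e.
    by have /cvgr_dist_lt/(_ _ e0) := c k.
  have Kall : \forall y \near x, forall k, `|chart x 0 k - chart y 0 k| < e by exact: (filter_forall _ K).
  apply: filterS Kall => y yk.
  rewrite [ltLHS]mx_normrE; apply/bigmax_ltP; split => // -[i j] _ /=.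
  by rewrite (ord1 i) mxE [X in _ + X]mxE; exact: yk.
pose X (y : 'rV[R]_2) : R := y 0 0; pose Y (y : 'rV[R]_2) : R := y 0 1.
have cX : {for x, continuous X} by exact: coord_continuous.
have cY : {for x, continuous Y} by exact: coord_continuous.
have cs := @sinv_continuous R x.
move: k; apply: ord3_ind.
- rewrite (_ : (fun y => _) = cst 2 * X * (@sinv R)); last by apply/funext => y; have [] := chartE y.
  by continuous_tac.
- rewrite (_ : (fun y => _) = cst 2 * Y * (@sinv R)); last by apply/funext => y; have [] := chartE y.
  by continuous_tac.
- rewrite (_ : (fun y => _) = cst 2 * (@sinv R) - cst 1); last by apply/funext => y; have [] := chartE y.
  by continuous_tac.
Qed.

Lemma is_derive_chart (R : realType) (x v : 'rV[R]_2) :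
  let w := x 0 0 * v 0 0 + x 0 1 * v 0 1 in
  derivable (@chart R) x v /\
  [/\ ('D_v (@chart R) x) 0 0 = 2 * v 0 0 * sinv x - 4 * w * x 0 0 * sinv x ^+ 2,
      ('D_v (@chart R) x) 0 1 = 2 * v 0 1 * sinv x - 4 * w * x 0 1 * sinv x ^+ 2
    & ('D_v (@chart R) x) 0 ord_max = - 4 * w * sinv x ^+ 2].
Proof.
move=> w.
pose X (y : 'rV[R]_2) : R := y 0 0; pose Y (y : 'rV[R]_2) : R := y 0 1.
have dX : is_derive x v X (v 0 0) by exact: rV2_coord_derive.
have dY : is_derive x v Y (v 0 1) by exact: rV2_coord_derive.
have ds := is_derive_sinv x v.
have d0 : is_derive x v (fun y : 'rV[R]_2 => chart y 0 0) (2 * v 0 0 * sinv x - 4 * w * x 0 0 * sinv x ^+ 2).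
  rewrite (_ : (fun y => _) = cst 2 * X * (@sinv R)); last by apply/funext => y; have [] := chartE y.
  by is_derive_eq_tac; rewrite /X /w; ring.
have d1 : is_derive x v (fun y : 'rV[R]_2 => chart y 0 1) (2 * v 0 1 * sinv x - 4 * w * x 0 1 * sinv x ^+ 2).
  rewrite (_ : (fun y => _) = cst 2 * Y * (@sinv R)); last by apply/funext => y; have [] := chartE y.
  by is_derive_eq_tac; rewrite /Y /w; ring.
have d2 : is_derive x v (fun y : 'rV[R]_2 => chart y 0 ord_max) (- 4 * w * sinv x ^+ 2).
  rewrite (_ : (fun y => _) = cst 2 * (@sinv R) - cst 1); last by apply/funext => y; have [] := chartE y.
  by is_derive_eq_tac; rewrite /w; ring.
have D : derivable (@chart R) x v.
  apply/derivable_mxP => i k; rewrite (ord1 i); move: k.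
  by apply: ord3_ind; [have [] := d0|have [] := d1|have [] := d2].
split=> //; rewrite (derive_mx D) !mxE.
by split; [have [] := d0|have [] := d1|have [] := d2].
Qed.

Lemma partial_chart (R : realType) (x : 'rV[R]_2) (i : 'I_2) :
  [/\ (partial i (@chart R) x) 0 0 = 2 * (i == 0)%:R * sinv x - 4 * x 0 i * x 0 0 * sinv x ^+ 2,
      (partial i (@chart R) x) 0 1 = 2 * (i == 1)%:R * sinv x - 4 * x 0 i * x 0 1 * sinv x ^+ 2
    & (partial i (@chart R) x) 0 ord_max = - 4 * x 0 i * sinv x ^+ 2].
Proof.
have [_ [d0 d1 d2]] := is_derive_chart x (delta_mx 0 i).
rewrite /partial d0 d1 d2 !mxE; move: i {d0 d1 d2}; apply: ord2_ind => /=; split; ring.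
Qed.

Lemma round_metricE (R : realType) (x : 'rV[R]_2) :
  round_metric x = (4 * sinv x ^+ 2)%:M.
Proof.
have s0 := s_gt0 x.
apply/matrixP => i j; rewrite mxE [RHS]mxE dot3E.
have := partial_chart x i; have := partial_chart x j.
move: (partial i _ x) (partial j _ x) => P Q [-> -> ->] [-> -> ->].
have : sinv x * (1 + x 0 0 * x 0 0 + x 0 1 * x 0 1) = 1 by rewrite mulVf// gt_eqF.
set s := 1 + _ + _; move: (sinv x) => k ks.
(* Here and in several lemmas below, the relation [k * s = 1] enters by exhibiting the difference of
   the two sides as an explicit multiple of [k * s - 1]. *)
apply: (@etrans _ _ (4 * k ^+ 2 *+ (i == j) + 16 * x 0 i * x 0 j * k ^+ 3 * (k * s - 1))).
  rewrite /s; move: i j; apply: ord2_ind; apply: ord2_ind; rewrite /= ?mulr1n ?mulr0n;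
    move: (x 0 0) (x 0 1) => a b; clear; ring.
by rewrite ks subrr mulr0 addr0.
Qed.

Lemma vol_round (R : realType) (x : 'rV[R]_2) : vol (@round_metric R) x = 4 * sinv x ^+ 2.
Proof.
rewrite /vol round_metricE det_scalar sqrtr_sqr ger0_norm// mulr_ge0// sqr_ge0//.
Qed.

Lemma tcoordE (R : realType) (x : 'rV[R]_2) (w : 'rV[R]_3) (i : 'I_2) :
  tcoord x w 0 i = dot w (partial i (@chart R) x) / (4 * sinv x ^+ 2).
Proof. by rewrite /tcoord round_metricE invmx_scalar mul_mx_scalar !mxE mulrC. Qed.

(** * Distance to the north pole *)

Lemma coord_derive (R : realType) (n : nat) (f : R -> 'rV[R]_n) (t : R) (k : 'I_n) :
  derivable f t 1 -> is_derive t (1 : R) (fun s : R => f s 0 k) (derive1 f t 0 k).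
Proof.
move=> df; split; first by move/derivable_mxP : (df) => /(_ 0 k).
by rewrite derive1E (derive_mx df) mxE.
Qed.

Lemma dot_ge0 (R : realType) (n : nat) (v : 'rV[R]_n) : 0 <= dot v v.
Proof. by apply: sumr_ge0 => i _; rewrite -expr2 sqr_ge0. Qed.

Lemma sqr_enorm (R : realType) (n : nat) (v : 'rV[R]_n) : enorm v ^+ 2 = dot v v.
Proof. by rewrite sqr_sqrtr// dot_ge0. Qed.

(** For tangent [w], the last coordinate is the product of [w] with the tangential part of the
    vertical axis, whose squared norm is [1 - p_3^2]. The Cauchy-Schwarz inequality appears as an
    explicit square plus terms that the two constraints remove. *)
Lemma tangent_height (R : realType) (p w : 'rV[R]_3) : sphere p -> dot p w = 0 ->
  w 0 ord_max ^+ 2 <= dot w w * (1 - p 0 ord_max ^+ 2).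
Proof.
rewrite /sphere /= !dot3E.
set a := p 0 0; set b := p 0 1; set c := p 0 ord_max.
set x := w 0 0; set y := w 0 1; set z := w 0 ord_max => s t.
rewrite -subr_ge0.
have -> : (x * x + y * y + z * z) * (1 - c ^+ 2) - z ^+ 2 =
  (a * y - b * x) ^+ 2 + (1 - (a * a + b * b + c * c)) * (x * x + y * y)
  + (a * x + b * y + c * z) * (a * x + b * y - c * z) by ring.
by rewrite s t subrr !mul0r !addr0 sqr_ge0.
Qed.

Lemma sphere_height (R : realType) (p : 'rV[R]_3) : sphere p -> -1 <= p 0 ord_max <= 1.
Proof.
rewrite /sphere /= dot3E -ler_norml -(@expr_le1 _ 2)// real_normK ?num_real// => <-.
by rewrite expr2 lerDr addr_ge0// -expr2 sqr_ge0.
Qed.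

Lemma north_height (R : realType) : north R 0 ord_max = 1.
Proof. by rewrite mxE. Qed.

Section length_lower_bound.
Variables (R : realType) (p : 'rV[R]_3) (gam : R -> 'rV[R]_3).
Hypothesis curve : sphere_curve (north R) p gam.

Let dgam t : derivable gam t 1. Proof. by have [] := curve. Qed.
Let v (t : R) : R := enorm (derive1 gam t).
Let f (t : R) : R := gam t 0 ord_max.

Let df (t : R) : is_derive t (1 : R) f (derive1 gam t 0 ord_max).
Proof. exact: coord_derive. Qed.

Lemma speed_continuous : continuous v.
Proof.
move=> t.
pose g k : R -> R := fun s => derive1 gam s 0 k.
have cg k : {for t, continuous (g k)}.
  have [_ /(_ t) c _ _ _] := curve.
  apply: (@continuous_comp _ _ _ (derive1 gam) (fun m : 'rV[R]_3 => m 0 k)) => //.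
  exact: coord_continuous.
rewrite (_ : v = Num.sqrt \o (g 0 * g 0 + g 1 * g 1 + g ord_max * g ord_max)); last first.
  by apply/funext => s; rewrite /v /enorm dot3E.
by apply: continuous_comp; [continuous_tac|exact: sqrt_continuous].
Qed.

(** Differentiates [|gam|^2 = 1]. The endpoints are excluded because [gam] may leave the sphere
    outside [[0, 1]]. *)
Lemma curve_orthogonal (t : R) : 0 < t < 1 -> dot (gam t) (derive1 gam t) = 0.
Proof.
move=> /andP[t0 t1].
pose g k : R -> R := fun s => gam s 0 k.
have d0 : is_derive t (1 : R) (g 0) (derive1 gam t 0 0) by exact: coord_derive.
have d1 : is_derive t (1 : R) (g 1) (derive1 gam t 0 1) by exact: coord_derive.
have d2 : is_derive t (1 : R) (g ord_max) (derive1 gam t 0 ord_max) by exact: coord_derive.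
have D : is_derive t (1 : R) (g 0 * g 0 + g 1 * g 1 + g ord_max * g ord_max)
    (2 * dot (gam t) (derive1 gam t)).
  by is_derive_eq_tac; rewrite dot3E /g; ring.
have nE : \forall s \near t, (g 0 * g 0 + g 1 * g 1 + g ord_max * g ord_max) s = cst 1 s.
  have : \forall s \near t, s \in `]0, 1[ by apply: near_in_itvoo; rewrite in_itv/= t0 t1.
  apply: filterS => s; rewrite in_itv/= => /andP[s0 s1].
  have [_ _ /(_ s) sp _ _] := curve.
  by move: sp; rewrite /sphere /= dot3E; apply; rewrite !ltW.
have := near_eq_is_derive nE D => -[_]; rewrite derive_cst => /esym/eqP.
by rewrite mulf_eq0 pnatr_eq0 /= => /eqP.
Qed.

(* The factor [k < 1] keeps the argument of [acos] away from [1] and [-1], where it is not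
   differentiable. *)
Lemma length_ge_acos_scaled (k : R) : 0 < k < 1 ->
  acos (k * p 0 ord_max) <= curve_length gam + acos k.
Proof.
move=> /andP[k0 k1].
pose mu := @lebesgue_measure R.
pose G (x : R) : R := (\int[mu]_(t in `[0, x]) v t)%R.
pose F (t : R) : R := acos (k * f t).
have f_bnd (t : R) : 0 <= t <= 1 -> -1 < k * f t < 1.
  move=> t01; have [_ _ /(_ t t01) /sphere_height sp _ _] := curve.
  rewrite -ltr_norml normrM (gtr0_norm k0); apply: le_lt_trans k1.
  by rewrite ler_piMr ?(ltW k0)// ler_norml.
have vint : mu.-integrable `[0, 1] (EFin \o v).
  apply: continuous_compact_integrable; first exact: segment_compact.
  by apply: continuous_subspaceT; exact: speed_continuous.
have dG (t : R) : 0 < t < 1 -> is_derive t (1 : R) G (v t).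
  move=> /andP[t0 t1].
  have [dG EG] := continuous_FTC1_closed t1 vint t0 (@speed_continuous t).
  by split; [exact: dG|rewrite -derive1E; exact: EG].
have cG : {within `[0, 1], continuous G}.
  exact: (parameterized_integral_continuous ler01 vint).
have dF (t : R) : 0 <= t <= 1 -> is_derive t (1 : R) F
    (- (Num.sqrt (1 - (k * f t) ^+ 2))^-1 * (k * derive1 gam t 0 ord_max)).
  move=> t01; apply: (@is_derive1_comp _ (@acos R) (fun s => k * f s)).
    exact: is_derive1_acos (f_bnd t t01).
  by have := df t => d; apply: (@is_deriveZ _ _ _ f).
have cF : {within `[0, 1], continuous F}.
  by apply: derivable_within_continuous => t; rewrite in_itv/= => /dF[].
have [|||c cI] := @MVT R (F - G)
  (fun t => - (Num.sqrt (1 - (k * f t) ^+ 2))^-1 * (k * derive1 gam t 0 ord_max) - v t) 0 1.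
- exact: ltr01.
- move=> t; rewrite in_itv/= => t01; apply: is_deriveB; last exact: dG.
  by apply: dF; case/andP: t01 => a b; rewrite !ltW.
- exact: within_continuousB.
move: cI; rewrite in_itv/= => c01; rewrite subr0 mulr1.
have c01' : 0 <= c <= 1 by case/andP: c01 => a b; rewrite !ltW.
have [_ _ /(_ c c01') sc g0 g1] := curve.
have th := tangent_height sc (curve_orthogonal c01).
have fb := f_bnd c c01'.
have q0 : 0 < 1 - (k * f c) ^+ 2.
  by rewrite subr_gt0 -real_normK ?num_real// expr_lt1// ltr_norml.
(* Combines [f'^2 <= v^2 (1 - f^2)] with [k^2 (1 - f^2) <= 1 - (k f)^2]. Hence [F - G] does not
   increase, and its value at [0] is [acos k], since the curve starts at height [1]. *)
have H : - (Num.sqrt (1 - (k * f c) ^+ 2))^-1 * (k * derive1 gam c 0 ord_max) <= v c.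
  set q := 1 - _ in q0 *.
  have sq0 : 0 < Num.sqrt q by rewrite sqrtr_gt0.
  rewrite mulNr -mulrN mulrC ler_pdivrMr//.
  apply: (le_trans (ler_norm _)); rewrite -(@ler_pXn2r _ 2)// ?nnegrE ?mulr_ge0 ?sqrtr_ge0//.
  rewrite normrN real_normK ?num_real// exprMn [leRHS]exprMn (sqr_sqrtr (ltW q0)) /v sqr_enorm.
  apply: (@le_trans _ _ (k ^+ 2 * (dot (derive1 gam c) (derive1 gam c) * (1 - f c ^+ 2)))).
    by rewrite ler_wpM2l// sqr_ge0.
  rewrite mulrCA ler_wpM2l ?dot_ge0// /q mulrBr mulr1 exprMn lerD2r.
  by rewrite expr_le1 ?ltW.
rewrite fctE; set d := _ - v c; move=> E.
have d0 : d <= 0 by rewrite subr_le0.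
have G0 : G 0 = 0 by rewrite /G set_itv1 Rintegral_set1.
have FE : F 1 - G 1 - (F 0 - G 0) = d by rewrite -E.
move: FE; rewrite G0 subr0 /F /f g0 g1 north_height mulr1.
have -> : G 1 = curve_length gam by [].
by move=> FE; move: d0; rewrite -FE subr_le0 lerBlDl addrC.
Qed.

(** The scaled bound with [k = cos t] reads [acos (cos t * p_3) <= L + t], that is,
    [cos (L + t) <= cos t * p_3]. If [L] were smaller than [acos p_3], this would fail at [t = 0],
    hence by continuity also for small [t > 0]. *)
Lemma length_ge_acos : acos (p 0 ord_max) <= curve_length gam.
Proof.
have L0 : 0 <= curve_length gam.
  by apply: Rintegral_ge0 => t _; exact: sqrtr_ge0.
have sp : sphere p by have [_ _ /(_ 1) + _ <-] := curve; apply; rewrite ler01 lexx.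
have pb := sphere_height sp.
have [Lpi|piL] := ltP (curve_length gam) pi; last by rewrite (le_trans (acos_lepi pb)).
rewrite leNgt; apply/negP => La.
set L := curve_length gam in L0 Lpi La *.
have ap : p 0 ord_max < cos L.
  rewrite -[X in X < _]acosK ?in_itv//= ltr_cos// in_itv/= ?acos_ge0 ?acos_lepi//.
  by rewrite L0 ltW.
pose phi (t : R) : R := cos (L + t) - cos t * p 0 ord_max.
have cphi : {for 0, continuous phi}.
  have c1 : {for 0, continuous (fun t : R => cos (L + t))}.
    apply: (@continuous_comp _ _ _ (fun t : R => L + t) (@cos R)); last exact: continuous_cos.
    by apply: (@continuousD _ _ _ (cst L) id); [exact: cst_continuous|exact: cvg_id].
  apply: (@continuousB _ _ _ (fun t : R => cos (L + t)) (@cos R * cst (p 0 ord_max))) => //.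
  by apply: continuousM; [exact: continuous_cos|exact: cst_continuous].
have : \forall t \near (0 : R), 0 < phi t.
  by apply: cvgr_gt cphi _ _; rewrite /phi addr0 cos0 mul1r subr_gt0.
move=> /nbhs_normP[d /= d0 dP].
(* [d / 2] keeps [phi] positive, [pi - L] keeps [L + t] in the interval where [cos] decreases, and
   [pi / 4] keeps [cos t] positive. *)
pose t := Num.min (d / 2) (Num.min (pi - L) (pi / 4)).
have t0 : 0 < t by rewrite !lt_min !divr_gt0 ?pi_gt0// subr_gt0 Lpi.
have td : t < d.
  by apply: (@le_lt_trans _ _ (d / 2)); rewrite ?ge_min ?lexx// ltr_pdivrMr// mulr_natr mulr2n ltrDl.
have tL : L + t <= pi.
  by rewrite -lerBrDl /t !ge_min lexx ?orbT.
have tpi : t < pi / 2.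
  apply: (@le_lt_trans _ _ (pi / 4)); first by rewrite /t !ge_min lexx ?orbT.
  by rewrite ltr_pM2l ?pi_gt0// ltf_pV2 ?posrE// ltr_nat.
have ct0 : 0 < cos t by apply: cos_gt0_pihalf; rewrite tpi (lt_trans _ t0)// oppr_lt0 divr_gt0// pi_gt0.
have tpi2 : t \in `[0, pi].
  by rewrite in_itv/= (ltW t0) (le_trans _ tL)// lerDr.
have ct1 : cos t < 1.
  by rewrite -cos0 ltr_cos// in_itv/= lexx pi_ge0.
have := length_ge_acos_scaled (k := cos t); rewrite ct0 ct1 => /(_ isT).
rewrite cosK// -/L => H.
have : 0 < phi t by apply: dP; rewrite /= sub0r normrN gtr0_norm.
rewrite /phi subr_gt0 ltNge => /negP; apply.
have cb : -1 <= cos t * p 0 ord_max <= 1.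
  rewrite -ler_norml normrM (gtr0_norm ct0); apply: mulr_ile1 => //; rewrite ?(ltW ct0) ?(ltW ct1)//.
  by rewrite ler_norml.
rewrite -[X in _ <= X]acosK ?in_itv//=.
have m1 : acos (cos t * p 0 ord_max) \in `[0, pi] by rewrite in_itv/= acos_ge0// acos_lepi.
have m2 : L + t \in `[0, pi] by rewrite in_itv/= tL andbT addr_ge0// ltW.
by rewrite leNgt (ltr_cos m2 m1) -leNgt.
Qed.

End length_lower_bound.

Lemma row_continuous (T : topologicalType) (R : realType) (n : nat) (f : T -> 'rV[R]_n.+1) (x : T) :
  (forall k, {for x, continuous (fun y => f y 0 k)}) -> {for x, continuous f}.
Proof.
move=> c; suff : f @ nbhs x --> f x by [].
apply/cvgrPdist_lt => e e0.
have K k : \forall y \near x, `|f x 0 k - f y 0 k| < e.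
  by have /cvgr_dist_lt/(_ _ e0) := c k.
have Kall : \forall y \near x, forall k, `|f x 0 k - f y 0 k| < e by exact: (filter_forall _ K).
apply: filterS Kall => y yk.
rewrite [ltLHS]mx_normrE; apply/bigmax_ltP; split => // -[i j] _ /=.
by rewrite (ord1 i) mxE [X in _ + X]mxE; exact: yk.
Qed.

Lemma is_derive_cosM (R : realType) (a t : R) :
  is_derive t (1 : R) (fun s => cos (a * s)) (- a * sin (a * t)).
Proof.
have d : is_derive t (1 : R) (fun s : R => a * s) a.
  by rewrite -[X in is_derive _ _ _ X]mulr1; apply: (@is_deriveZ _ _ _ id).
have := @is_derive1_comp _ (@cos R) (fun s => a * s) t _ _ (is_derive_cos _) d.
by rewrite mulNr mulrC -mulNr.
Qed.

Lemma is_derive_sinM (R : realType) (a t : R) :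
  is_derive t (1 : R) (fun s => sin (a * s)) (a * cos (a * t)).
Proof.
have d : is_derive t (1 : R) (fun s : R => a * s) a.
  by rewrite -[X in is_derive _ _ _ X]mulr1; apply: (@is_deriveZ _ _ _ id).
have := @is_derive1_comp _ (@sin R) (fun s => a * s) t _ _ (is_derive_sin _) d.
by rewrite mulrC.
Qed.

Section great_circle.
Variables (R : realType) (a e0 e1 : R).
Hypothesis unit_e : e0 * e0 + e1 * e1 = 1.

Definition vec3 (x y z : R) : 'rV[R]_3 :=
  \row_k (if k == 0 then x else if k == 1 then y else z).

Definition great_circle (t : R) : 'rV[R]_3 :=
  vec3 (sin (a * t) * e0) (sin (a * t) * e1) (cos (a * t)).

Definition great_circle_velocity (t : R) : 'rV[R]_3 :=
  vec3 (a * cos (a * t) * e0) (a * cos (a * t) * e1) (- a * sin (a * t)).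

Lemma derive_great_circle t :
  derivable great_circle t 1 /\ derive1 great_circle t = great_circle_velocity t.
Proof.
have dk k : is_derive t (1 : R) (fun s => great_circle s 0 k) (great_circle_velocity t 0 k).
  rewrite /great_circle /great_circle_velocity !mxE.
  rewrite (_ : (fun s => _) = (fun s => if k == 0 then sin (a * s) * e0 else
    if k == 1 then sin (a * s) * e1 else cos (a * s))); last by apply/funext => s; rewrite mxE.
  have ds := is_derive_sinM a t.
  case: (k == 0); last case: (k == 1); last exact: is_derive_cosM.
  - have := is_deriveM ds (is_derive_cst e0 t 1); congr (is_derive _ _ _ _).
    by rewrite scaler0 add0r -[_ *: _]/(_ * _) mulrC.
  - have := is_deriveM ds (is_derive_cst e1 t 1); congr (is_derive _ _ _ _).
    by rewrite scaler0 add0r -[_ *: _]/(_ * _) mulrC.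
have D : derivable great_circle t 1.
  by apply/derivable_mxP => i k; rewrite (ord1 i); have [] := dk k.
split=> //; rewrite derive1E (derive_mx D); apply/rowP => k; rewrite mxE.
by have [_ ->] := dk k.
Qed.

Lemma great_circle_curve :
  sphere_curve (north R) (vec3 (sin a * e0) (sin a * e1) (cos a)) great_circle.
Proof.
have cM (t : R) : {for t, continuous (fun s : R => a * s)}.
  by apply: (@continuousM _ _ (cst a) id); [exact: cst_continuous|exact: cvg_id].
have cc (t : R) : {for t, continuous (fun s : R => cos (a * s))}.
  by apply: (@continuous_comp _ _ _ (fun s : R => a * s) (@cos R)); [exact: cM|exact: continuous_cos].
have cs (t : R) : {for t, continuous (fun s : R => sin (a * s))}.
  by apply: (@continuous_comp _ _ _ (fun s : R => a * s) (@sin R)); [exact: cM|exact: continuous_sin].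
split.
- by move=> t; have [] := derive_great_circle t.
- rewrite (_ : derive1 _ = great_circle_velocity); last by apply/funext => t; have [] := derive_great_circle t.
  move=> t; apply: row_continuous => k.
  rewrite (_ : (fun s => _) = (fun s => if k == 0 then a * cos (a * s) * e0 else
    if k == 1 then a * cos (a * s) * e1 else - a * sin (a * s))); last by apply/funext => s; rewrite mxE.
  have cct := cc t; have snt := cs t.
  case: (k == 0); last case: (k == 1).
  + by apply: (@continuousM _ _ (cst a * (fun s => cos (a * s))) (cst e0)); continuous_tac.
  + by apply: (@continuousM _ _ (cst a * (fun s => cos (a * s))) (cst e1)); continuous_tac.
  + by apply: (@continuousM _ _ (cst (- a)) (fun s => sin (a * s))); continuous_tac.
- move=> t _; rewrite /sphere /= dot3E !mxE /=.
  rewrite (_ : _ + _ = sin (a * t) ^+ 2 * (e0 * e0 + e1 * e1) + cos (a * t) ^+ 2); last by ring.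
  by rewrite unit_e mulr1 addrC cos2Dsin2.
- rewrite /great_circle mulr0 sin0 cos0 !mul0r; apply/rowP; apply: ord3_ind; by rewrite !mxE.
- by rewrite /great_circle mulr1.
Qed.

Lemma great_circle_length : 0 <= a -> curve_length great_circle = a.
Proof.
move=> a0; rewrite /curve_length (@eq_Rintegral _ _ _ _ _ (cst a)).
  rewrite Rintegral_cst; last exact: measurable_itv.
  have := @lebesgue_measure_itv R `[0%R, 1%R].
  rewrite /= lte_fin ltr01 oppr0 adde0 => E.
  by rewrite [X in fine X]E mulr1.
move=> t _; have [_ ->] := derive_great_circle t.
rewrite /enorm dot3E !mxE /=.
rewrite (_ : _ + _ = a ^+ 2 * (cos (a * t) ^+ 2 * (e0 * e0 + e1 * e1) + sin (a * t) ^+ 2)); last by ring.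
by rewrite unit_e mulr1 cos2Dsin2 mulr1 sqrtr_sqr ger0_norm.
Qed.

End great_circle.

Theorem geodist_north (R : realType) (p : 'rV[R]_3) : sphere p ->
  geodist (north R) p = acos (p 0 ord_max).
Proof.
move=> sp; have pb := sphere_height sp.
have lb : lbound [set curve_length gam | gam in sphere_curve (north R) p] (acos (p 0 ord_max)).
  by move=> _ [gam c <-]; exact: length_ge_acos.
suff S : [set curve_length gam | gam in sphere_curve (north R) p] (acos (p 0 ord_max)).
  apply/eqP; rewrite eq_le; apply/andP; split.
    by apply: ge_inf => //; exists (acos (p 0 ord_max)).
  by apply: lb_le_inf => //; eexists; exact: S.
have a0 := acos_ge0 pb.
set a := acos (p 0 ord_max) in a0 *.
have ca : cos a = p 0 ord_max by rewrite acosK ?in_itv.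
have sa : sin a ^+ 2 = p 0 0 * p 0 0 + p 0 1 * p 0 1.
  have := cos2Dsin2 a; rewrite ca => E.
  have := sp; rewrite /sphere /= dot3E => E2.
  have -> : sin a ^+ 2 = p 0 ord_max ^+ 2 + sin a ^+ 2 - p 0 ord_max ^+ 2 by ring.
  by rewrite E -E2; ring.
have [[e0 e1] /= ue [p0 p1]] : exists2 e : R * R, e.1 * e.1 + e.2 * e.2 = 1 &
    sin a * e.1 = p 0 0 /\ sin a * e.2 = p 0 1.
  (* At a pole the meridian is not unique, and any horizontal unit direction serves. *)
  have [s0|s0] := eqVneq (sin a) 0.
    exists (1, 0) => /=; first by ring.
    move: sa; rewrite s0 expr0n /= => /esym/eqP.
    rewrite -!expr2 paddr_eq0 ?sqr_ge0// !sqrf_eq0 => /andP[/eqP-> /eqP->].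
    by split; rewrite ?s0; ring.
  exists (p 0 0 / sin a, p 0 1 / sin a) => /=.
    rewrite (_ : _ + _ = (p 0 0 * p 0 0 + p 0 1 * p 0 1) / sin a ^+ 2); last by field.
    by rewrite -sa divff// expf_neq0.
  by split; field.
exists (great_circle a e0 e1); last exact: great_circle_length.
suff -> : p = vec3 (sin a * e0) (sin a * e1) (cos a) by exact: great_circle_curve.
by apply/rowP; apply: ord3_ind; rewrite !mxE.
Qed.

(** * Vanishing integrals *)

Lemma pt2E (R : realType) (z : R * R) : pt2 z 0 0 = z.1 /\ pt2 z 0 1 = z.2.
Proof.
have l0 : (0 : 'I_2) = lshift 1 (0 : 'I_1) by apply: val_inj.
have l1 : (1 : 'I_2) = rshift 1 (0 : 'I_1) by apply: val_inj.
by rewrite /pt2 l0 l1 (row_mxEl (z.1)%:M) (row_mxEr (z.1)%:M) !mxE eqxx !mulr1n.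
Qed.

Lemma near_square (R : realType) (O : set 'rV[R]_2) (x : 'rV[R]_2) : nbhs x O ->
  exists2 r : R, 0 < r &
    forall z : R * R, `|x 0 0 - z.1| < r -> `|x 0 1 - z.2| < r -> O (pt2 z).
Proof.
move=> /nbhs_normP[r /= r0 rO]; exists r => // z h0 h1; apply: rO.
have [e0 e1] := pt2E z.
rewrite /ball_/= rV2_norm_lt mxE [X in _ + X]mxE e0 h0 /=.
by rewrite mxE [X in _ + X]mxE e1.
Qed.

(** Measurability refers to the product sigma-algebra, so the open set is exhibited as the countable
    union of the squares with rational centre and radius that it contains. *)
Lemma measurable_pt2_open (R : realType) (O : set 'rV[R]_2) : open O ->
  measurable [set z : measurableTypeR R * measurableTypeR R | O (pt2 z)].
Proof.
move=> oO.
pose sq (a b r : R) : set (measurableTypeR R * measurableTypeR R) := ball a r `*` ball b r.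
rewrite (_ : [set z | _] = \bigcup_(a : rat) \bigcup_(b : rat) \bigcup_(r : rat)
  (if pselect (sq (ratr a) (ratr b) (ratr r) `<=` [set z | O (pt2 z)])
   then sq (ratr a) (ratr b) (ratr r) else set0)).
  apply: bigcupT_measurable_rat => a; apply: bigcupT_measurable_rat => b.
  apply: bigcupT_measurable_rat => r; case: pselect => ? /=; last exact: measurable0.
  by apply: measurableX; exact: measurable_ball.
apply/seteqP; split=> z; last first.
  by move=> [a _ [b _ [r _]]]; case: pselect => //= H /H.
move=> /= Oz.
have [d d0 dO] := near_square (open_nbhs_nbhs (conj oO Oz)).
have [e0 e1] := pt2E z; rewrite e0 e1 in dO.
(* The centre will lie within [ratr r] of [z], so the square stays within [2 * ratr r < d] of [z].
   The lower bound [d / 4] makes the radius positive. *)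
have [|r] := @rat_in_itvoo R (d / 4) (d / 2).
  by rewrite ltr_pM2l// ltf_pV2 ?posrE// ltr_nat.
rewrite in_itv/= => /andP[r1 r2].
have r0 : 0 < ratr r :> R by apply: lt_trans r1; rewrite divr_gt0.
have close (c : R) : exists q : rat, `|ratr q - c| < ratr r.
  have [|q] := @rat_in_itvoo R (c - ratr r) (c + ratr r).
    by rewrite ltrD2l (@lt_trans _ _ 0)// oppr_lt0.
  rewrite in_itv/= => /andP[q1 q2]; exists q; rewrite ltr_norml; apply/andP; split; lra.
have [a az] := close z.1; have [b bz] := close z.2.
exists a => //; exists b => //; exists r => //; case: pselect => //= -[]; last first.
  move=> w [wa wb]; apply: dO.
    rewrite (_ : z.1 - w.1 = - (ratr a - z.1) + (ratr a - w.1)); last by ring.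
    by apply: (le_lt_trans (ler_normD _ _)); rewrite normrN; move: wa; rewrite /ball/=; lra.
  rewrite (_ : z.2 - w.2 = - (ratr b - z.2) + (ratr b - w.2)); last by ring.
  by apply: (le_lt_trans (ler_normD _ _)); rewrite normrN; move: wb; rewrite /ball/=; lra.
Qed.

Section continuous_integral_eq0.
Variables (R : realType) (O : set 'rV[R]_2) (g : 'rV[R]_2 -> R) (M : R).
Hypotheses (oO : open O) (O1 : forall x, O x -> `|x| < 1)
  (cg : forall x, O x -> {for x, continuous g})
  (g0 : forall x, O x -> 0 <= g x) (gM : forall x, O x -> g x <= M).

Let D : set (measurableTypeR R * measurableTypeR R) := [set z | O (pt2 z)].
Let mu := (@lebesgue_measure R \x @lebesgue_measure R)%E.
Let G (z : measurableTypeR R * measurableTypeR R) : R := g (pt2 z).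

Let mD : measurable D. Proof. exact: measurable_pt2_open. Qed.

Let mG : measurable_fun D (EFin \o G).
Proof.
apply/measurable_EFinP => _.
apply: (measurability _ (RGenOInfty.measurableE R)) => //.
move=> /= _ [_ [a ->] <-]; rewrite preimage_itvoy.
rewrite (_ : _ `&` _ = [set z | (O `&` [set x | a < g x]) (pt2 z)])//.
apply: measurable_pt2_open; rewrite openE => x [Ox ax].
apply: filterI; first exact: open_nbhs_nbhs.
exact: cvgr_gt (cg Ox) _ ax.
Qed.

Let mu_square (a b r : R) : 0 < r -> mu (ball a r `*` ball b r) = ((r *+ 2) * (r *+ 2))%:E.
Proof.
move=> r0; have mb c : lebesgue_measure (ball c r) = (r *+ 2)%:E.
  exact: (lebesgue_measure_ball c (ltW r0)).
rewrite /mu product_measure1E; try exact: measurable_ball.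
by rewrite EFinM; congr (_ * _)%E; exact: mb.
Qed.

(** Where [g x > 0], continuity gives [g > g x / 2] on a square of positive area, which contradicts
    the vanishing of the integral of a nonnegative function. *)
Lemma continuous_Rintegral_eq0 :
  (\int[mu]_(z in D) G z)%R = 0 -> forall x, O x -> g x = 0.
Proof.
move=> I0 x Ox; apply/eqP; rewrite eq_le g0// andbT leNgt; apply/negP => gx.
have M0 : 0 <= M by apply: le_trans (gM Ox); exact: g0.
have Dsq : D `<=` ball (0 : R) 1 `*` ball (0 : R) 1.
  move=> z /O1; have [e0 e1] := pt2E z; rewrite rV2_norm_lt e0 e1 => /andP[h0 h1].
  by split; rewrite /ball/= sub0r normrN.
have muD : (mu D < +oo)%E.
  apply: (@le_lt_trans _ _ (mu (ball (0 : R) 1 `*` ball (0 : R) 1))).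
    apply: le_measure => //; rewrite inE//.
    by apply: measurableX; exact: measurable_ball.
  by rewrite mu_square// ltry.
have Gge0 z : D z -> (0 <= (EFin \o G) z)%E by move=> Dz; rewrite lee_fin; exact: g0.
have Ifin : (\int[mu]_(z in D) (EFin \o G) z < +oo)%E.
  apply: (@le_lt_trans _ _ (\int[mu]_(z in D) (cst M%:E) z)%E).
    by apply: ge0_le_integral => // z Dz; rewrite lee_fin; exact: gM.
  by rewrite integral_cst//; apply: lte_mul_pinfty.
(* A real integral is also [0] when the extended one is infinite, since [fine] sends [+oo] to [0];
   the bounds on [O] and [g] rule this out. *)
have I0' : (\int[mu]_(z in D) (EFin \o G) z = 0)%E.
  rewrite -[LHS]fineK; first by rewrite [X in X%:E]I0.
  by rewrite ge0_fin_numE//; exact: integral_ge0.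
have nx : nbhs x (O `&` [set y | g x / 2 < g y]).
  apply: filterI; first exact: open_nbhs_nbhs.
  by apply: cvgr_gt (cg Ox) _ _; rewrite ltr_pdivrMr// mulr_natr mulr2n ltrDl.
have [r r0 rO] := near_square nx.
pose S : set (measurableTypeR R * measurableTypeR R) := ball (x 0 0) r `*` ball (x 0 1) r.
have SD : S `<=` D by move=> z [h0 h1]; have [] := rO z h0 h1.
have mS : measurable S by apply: measurableX; exact: measurable_ball.
have : (\int[mu]_(z in S) (cst (g x / 2)%:E) z <= \int[mu]_(z in D) (EFin \o G) z)%E.
  apply: (@le_trans _ _ (\int[mu]_(z in S) (EFin \o G) z)%E); last exact: ge0_subset_integral.
  apply: ge0_le_integral => //.
  - by move=> z _; rewrite lee_fin divr_ge0// ltW.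
  - exact: measurable_funS mG.
  - by move=> z [h0 h1]; rewrite lee_fin; have [_ /ltW] := rO z h0 h1.
rewrite I0' integral_cst// [X in (_ * X)%E](mu_square (x 0 0) (x 0 1) r0) -EFinM lee_fin leNgt => /negP; apply.
by rewrite mulr_gt0 ?divr_gt0// mulr_gt0// pmulrn_lgt0.
Qed.

End continuous_integral_eq0.

(** * The conformal Laplacian and the boundary gradient *)

Definition height (R : realType) (x : 'rV[R]_2) : R := 2 * sinv x - 1.

Lemma chart_height (R : realType) (x : 'rV[R]_2) : chart x 0 ord_max = height x.
Proof. by have [] := chartE x. Qed.

Lemma height_continuous (R : realType) (x : 'rV[R]_2) : {for x, continuous (@height R)}.
Proof.
have cs := @sinv_continuous R x.
by rewrite (_ : @height R = cst 2 * @sinv R - cst 1) //; continuous_tac.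
Qed.

Lemma height_bound (R : realType) (x : 'rV[R]_2) : -1 <= height x <= 1.
Proof. by have := sphere_height (sphere_chart x); rewrite chart_height. Qed.

Lemma tilde_metricE (R : realType) (x : 'rV[R]_2) :
  tilde_metric x = (height x * (4 * sinv x ^+ 2))%:M.
Proof.
rewrite /tilde_metric (geodist_north (sphere_chart x)) acosK ?chart_height; last first.
  by rewrite in_itv/= height_bound.
by rewrite round_metricE scale_scalar_mx.
Qed.

(** In dimension two the area density times the inverse of a conformal metric is the identity
    matrix, so no derivative of the conformal factor appears. Positivity of [height] is needed near
    [x], because the density is the square root of a determinant. *)
Lemma laplacian_tilde (R : realType) (f : 'rV[R]_2 -> R) (x : 'rV[R]_2) : 0 < height x ->
  laplacian (@tilde_metric R) f x =
  (height x * (4 * sinv x ^+ 2))^-1 * (partial 0 (partial 0 f) x + partial 1 (partial 1 f) x).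
Proof.
move=> z0.
have k0 (y : 'rV[R]_2) : 0 < 4 * sinv y ^+ 2 by rewrite mulr_gt0// exprn_gt0// sinv_gt0.
have volE y : 0 < height y -> vol (@tilde_metric R) y = height y * (4 * sinv y ^+ 2).
  by move=> y0; rewrite /vol tilde_metricE det_scalar sqrtr_sqr gtr0_norm// mulr_gt0.
have nz : \forall y \near x, 0 < height y by apply: cvgr_gt (@height_continuous R x) _ z0.
have E i : partial i (fun y => vol (@tilde_metric R) y * gradient (@tilde_metric R) f y 0 i) x =
    partial i (partial i f) x.
  apply: near_eq_derive; apply: filterS nz => y y0.
  rewrite volE// /gradient tilde_metricE invmx_scalar mul_mx_scalar !mxE.
  by apply: mulVKf; rewrite gt_eqF// mulr_gt0.
by rewrite /laplacian /divergence sum_ord2 !E volE.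
Qed.

Lemma hemisphereE (R : realType) (p : 'rV[R]_3) :
  hemisphere p <-> sphere p /\ 0 < p 0 ord_max.
Proof.
have pi2 : (pi / 2 : R) \in `[0, pi].
  by rewrite in_itv/= divr_ge0 ?pi_ge0//= ler_pdivrMr// mulr_natr mulr2n lerDl pi_ge0.
split=> -[sp]; have pb := sphere_height sp.
  rewrite /= (geodist_north sp) => h.
  have ac : acos (p 0 ord_max) \in `[0, pi] by rewrite in_itv/= acos_ge0// acos_lepi.
  by split=> //; rewrite -[X in _ < X]acosK ?in_itv// -(cos_pihalf R) (ltr_cos ac pi2).
have ac : acos (p 0 ord_max) \in `[0, pi] by rewrite in_itv/= acos_ge0// acos_lepi.
by move=> p0; split=> //=; rewrite (geodist_north sp) -(ltr_cos ac pi2) acosK ?in_itv// cos_pihalf.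
Qed.

Lemma geoballE (R : realType) (r : R) (p : 'rV[R]_3) : 0 <= r <= pi ->
  geoball (north R) r p <-> sphere p /\ cos r < p 0 ord_max.
Proof.
move=> r0pi; have rI : r \in `[0, pi] by rewrite in_itv.
split=> -[sp]; rewrite /= => h; have pb := sphere_height sp;
  have ac : acos (p 0 ord_max) \in `[0, pi] by rewrite in_itv/= acos_ge0// acos_lepi.
  split=> //; rewrite -[X in _ < X]acosK ?in_itv// (ltr_cos ac rI).
  by move: h; rewrite (geodist_north sp).
by split=> //=; rewrite (geodist_north sp) -(ltr_cos ac rI) acosK ?in_itv.
Qed.

(* [partial 0 chart x] and [partial 1 chart x] form an orthogonal basis of the
   tangent plane, of squared norm [4 * sinv x ^+ 2]. *)
Lemma tangent_norm (R : realType) (x : 'rV[R]_2) (w : 'rV[R]_3) :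
  dot w (chart x) = 0 ->
  dot w (partial 0 (@chart R) x) ^+ 2 + dot w (partial 1 (@chart R) x) ^+ 2 =
  4 * sinv x ^+ 2 * dot w w.
Proof.
move=> w0.
suff E : dot w (partial 0 (@chart R) x) ^+ 2 + dot w (partial 1 (@chart R) x) ^+ 2 =
    4 * sinv x ^+ 2 * (dot w w - dot w (chart x) ^+ 2) by rewrite E w0 expr0n subr0.
have ks : sinv x * (1 + x 0 0 * x 0 0 + x 0 1 * x 0 1) = 1.
  by rewrite mulVf// gt_eqF// s_gt0.
have := chartE x; have := partial_chart x 0; have := partial_chart x 1.
move: (partial 0 _ x) (partial 1 _ x) (chart x) => P Q C.
rewrite !dot3E => -[-> -> ->] [-> -> ->] [-> -> ->] /=.
move: (sinv x) (x 0 0) (x 0 1) (w 0 0) (w 0 1) (w 0 ord_max) ks => k a b c d e ks.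
apply/eqP; rewrite -subr_eq0; apply/eqP.
rewrite (_ : _ - _ = 16 * k ^+ 3 * (a * c + b * d + e) ^+ 2 * (k * (1 + a * a + b * b) - 1)).
  by rewrite ks subrr mulr0.
clear ks; ring.
Qed.

(** A linear form that is nonpositive on an open half-plane is a nonnegative multiple of its outer
    normal. The tangential part is tested on both tangent directions, tilted inwards by a small [d],
    since the tangent itself is not in the open half-plane. *)
Lemma cone_gradient (R : realType) (g0 g1 n0 n1 : R) : 0 < n0 ^+ 2 + n1 ^+ 2 ->
  (forall v0 v1, v0 * n0 + v1 * n1 < 0 -> v0 * g0 + v1 * g1 <= 0) ->
  exists2 m : R, 0 <= m & g0 = m * n0 /\ g1 = m * n1.
Proof.
move=> n_gt0 H.
have gn : 0 <= g0 * n0 + g1 * n1.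
  have := H (- n0) (- n1); rewrite (_ : - n0 * n0 + - n1 * n1 = - (n0 ^+ 2 + n1 ^+ 2)); last by ring.
  by rewrite oppr_lt0 => /(_ n_gt0); lra.
have tau_le (s : R) : s ^+ 2 = 1 -> s * (g0 * n1 - g1 * n0) <= 0.
  move=> s1; apply/ler_addgt0Pr => e e0; rewrite add0r.
  pose d := e / (1 + (g0 * n0 + g1 * n1)).
  have k0 : 0 < 1 + (g0 * n0 + g1 * n1) by rewrite ltr_pwDl.
  have d0 : 0 < d by rewrite divr_gt0.
  have := H (s * n1 - d * n0) (- s * n0 - d * n1).
  rewrite (_ : _ + _ = - (d * (n0 ^+ 2 + n1 ^+ 2))); last by ring.
  rewrite oppr_lt0 mulr_gt0// => /(_ isT).
  rewrite (_ : _ + _ = s * (g0 * n1 - g1 * n0) - d * (g0 * n0 + g1 * n1)); last by ring.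
  rewrite subr_le0 => /le_trans; apply.
  by rewrite /d mulrAC ler_pdivrMr// ler_wpM2l ?(ltW e0)// lerDr.
have tau0 : g0 * n1 - g1 * n0 = 0.
  apply/eqP; rewrite eq_le; apply/andP; split.
    by have := tau_le 1; rewrite expr1n mul1r; exact.
  by have := tau_le (-1); rewrite sqrrN expr1n mulN1r oppr_le0; exact.
have nn0 : n0 ^+ 2 + n1 ^+ 2 != 0 by rewrite gt_eqF.
exists ((g0 * n0 + g1 * n1) / (n0 ^+ 2 + n1 ^+ 2)); first by rewrite divr_ge0// ltW.
split.
  rewrite (_ : _ * n0 = (g0 * (n0 ^+ 2 + n1 ^+ 2) - n1 * (g0 * n1 - g1 * n0)) / (n0 ^+ 2 + n1 ^+ 2)).
    by rewrite tau0 mulr0 subr0 mulfK.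
  by field.
rewrite (_ : _ * n1 = (g1 * (n0 ^+ 2 + n1 ^+ 2) + n0 * (g0 * n1 - g1 * n0)) / (n0 ^+ 2 + n1 ^+ 2)).
  by rewrite tau0 mulr0 addr0 mulfK.
by field.
Qed.

Lemma dot_continuous (R : realType) (w v : 'rV[R]_3) :
  {for w, continuous (fun q : 'rV[R]_3 => dot q v)}.
Proof.
pose c k : 'rV[R]_3 -> R := fun q => q 0 k.
have cc k : {for w, continuous (c k)} by exact: coord_continuous.
rewrite (_ : (fun q => _) = c 0 * cst (v 0 0) + c 1 * cst (v 0 1) + c ord_max * cst (v 0 ord_max)).
  by continuous_tac.
by apply/funext => q; rewrite dot3E.
Qed.

Lemma enorm_continuous (R : realType) (w : 'rV[R]_3) : {for w, continuous (@enorm R 3)}.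
Proof.
pose c k : 'rV[R]_3 -> R := fun q => q 0 k.
have cc k : {for w, continuous (c k)} by exact: coord_continuous.
rewrite (_ : @enorm R 3 = Num.sqrt \o (c 0 * c 0 + c 1 * c 1 + c ord_max * c ord_max)).
  by apply: continuous_comp; [continuous_tac|exact: sqrt_continuous].
by apply/funext => q; rewrite /enorm dot3E.
Qed.

Lemma enormZ (R : realType) (n : nat) (a : R) (v : 'rV[R]_n) : 0 <= a ->
  enorm (a *: v) = a * enorm v.
Proof.
move=> a0; rewrite /enorm.
have -> : dot (a *: v) (a *: v) = a ^+ 2 * dot v v.
  by rewrite /dot mulr_sumr; apply: eq_bigr => i _; rewrite !mxE; ring.
by rewrite sqrtrM ?sqr_ge0// sqrtr_sqr ger0_norm.
Qed.

Lemma dotZ (R : realType) (n : nat) (a : R) (v w : 'rV[R]_n) : dot (a *: v) w = a * dot v w.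
Proof. by rewrite /dot mulr_sumr; apply: eq_bigr => i _; rewrite !mxE mulrA. Qed.

Lemma inward_direction (R : realType) (Om : set 'rV[R]_3) (nu : 'rV[R]_3) (x v : 'rV[R]_2) :
  outward_normal_at Om nu (chart x) -> dot ('D_v (@chart R) x) nu < 0 ->
  exists2 d : R, 0 < d & forall h : R, 0 < h < d -> Om (chart (h *: v + x)).
Proof.
move=> [_ _ on]; have [dv _] := is_derive_chart x v.
set w := 'D_v (@chart R) x; set a := dot w nu => a0.
have w1 : 0 < enorm w + 1 by rewrite ltr_wpDl// sqrtr_ge0.
(* Near [0] the difference quotients have normal component below [a / 2] and norm below
   [enorm w + 1]; this [e] is the ratio that places them in the inner cone. *)
pose e := - a / (2 * (enorm w + 1)).
have e0 : 0 < e by rewrite divr_gt0 ?oppr_gt0// mulr_gt0.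
have [del del0 onP] := on e e0.
pose Dq (h : R) := h^-1 *: (chart (h *: v + x) - chart x).
have Dw : Dq @ 0^' --> w by exact: dv.
have n1 : \forall h \near (0 : R)^', dot (Dq h) nu < a / 2.
  have c : (fun h => dot (Dq h) nu) @ 0^' --> a.
    exact: (cvg_comp _ _ Dw (@dot_continuous _ w nu)).
  apply: (cvgr_lt _ c); rewrite /= ltr_pdivlMr//; lra.
have n2 : \forall h \near (0 : R)^', enorm (Dq h) < enorm w + 1.
  have c : (fun h => enorm (Dq h)) @ 0^' --> enorm w.
    exact: (cvg_comp _ _ Dw (@enorm_continuous _ w)).
  by apply: (cvgr_lt _ c); rewrite ltrDl.
have [d /= d0 dP] : \forall h \near (0 : R)^', dot (Dq h) nu < a / 2 /\ enorm (Dq h) < enorm w + 1.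
  exact: filterI n1 n2.
exists (Num.min d (del / (enorm w + 1))); first by rewrite lt_min d0 divr_gt0.
move=> h /andP[h0]; rewrite lt_min => /andP[hd hdel].
have [||A B] := dP h; first by rewrite /ball_/= sub0r normrN gtr0_norm.
  by rewrite gt_eqF.
have E : chart (h *: v + x) - chart x = h *: Dq h by rewrite scalerA mulfV ?scale1r// gt_eqF.
have [|in_ _] := onP (chart (h *: v + x)) (sphere_chart _).
  rewrite E enormZ ?ltW// (lt_trans (_ : _ < h * (enorm w + 1)))// ?ltr_pM2l//.
  by rewrite -ltr_pdivlMr.
apply: in_; rewrite E dotZ enormZ ?ltW// mulrCA ltr_pM2l//.
apply: (lt_trans A); rewrite mulNr ltrNr.
rewrite (_ : - (a / 2) = e * (enorm w + 1)); first by rewrite ltr_pM2l.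
by rewrite /e; field; rewrite gt_eqF.
Qed.

(** Along every inward direction [f] passes from [0] to nonpositive values, so its derivative there
    is nonpositive and [cone_gradient] applies. The factor [m] is then the normal derivative,
    nonnegative by construction. *)
Lemma boundary_gradient (R : realType) (Om : set 'rV[R]_3) (nu : 'rV[R]_3)
    (W : set 'rV[R]_2) (f : 'rV[R]_2 -> R) (x : 'rV[R]_2) :
  open W -> C1_on W f -> W x -> outward_normal_at Om nu (chart x) ->
  (forall y, Om (chart y) -> f y <= 0) -> f x = 0 ->
  let n i := dot nu (partial i (@chart R) x) in
  exists2 m : R, 0 <= m &
   [/\ partial 0 f x = m * n 0, partial 1 f x = m * n 1,
       n 0 ^+ 2 + n 1 ^+ 2 = 4 * sinv x ^+ 2 & 'D_(tcoord x nu) f x = m].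
Proof.
move=> oW fW Wx on f_le0 fx0 n.
have [nu_tan nu1 _] := on.
have nn : n 0 ^+ 2 + n 1 ^+ 2 = 4 * sinv x ^+ 2.
  by rewrite tangent_norm// nu1 mulr1.
have k0 : 0 < 4 * sinv x ^+ 2 by rewrite mulr_gt0// exprn_gt0// sinv_gt0.
have [||m m0 [E0 E1]] := @cone_gradient R (partial 0 f x) (partial 1 f x) (n 0) (n 1).
- by rewrite nn.
- move=> v0 v1 vn; rewrite leNgt; apply/negP => vg.
  pose v : 'rV[R]_2 := pt2 (v0, v1).
  have [vE0 vE1] : v 0 0 = v0 /\ v 0 1 = v1 by exact: pt2E (v0, v1).
  have wn : dot ('D_v (@chart R) x) nu = v0 * n 0 + v1 * n 1.
    rewrite /n; have [_] := is_derive_chart x v; rewrite vE0 vE1.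
    have := partial_chart x 0; have := partial_chart x 1.
    move: ('D_v _ x) (partial 0 _ x) (partial 1 _ x) => D P Q [q0 q1 q2] [p0 p1 p2] [e0 e1 e2].
    by rewrite !dot3E q0 q1 q2 p0 p1 p2 e0 e1 e2 /=; ring.
  have [|d d0 dP] := @inward_direction _ Om nu x v on; first by rewrite wn.
  have [df Ef] := C1_on_is_derive v oW fW Wx.
  have Dpos : 0 < 'D_v f x by rewrite Ef vE0 vE1.
  have [e /= e0 eP] : \forall h \near (0 : R)^', 0 < h^-1 *: ((f \o shift x) (h *: v) - f x).
    exact: (cvgr_gt _ df _ Dpos).
  pose h := Num.min d e / 2.
  have h0 : 0 < h by rewrite divr_gt0// lt_min d0.
  have hm : h < Num.min d e by rewrite /h ltr_pdivrMr// mulr_natr mulr2n ltrDl lt_min d0.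
  have /andP[hd he] : (h < d) && (h < e) by rewrite -lt_min.
  have : 0 < h^-1 * (f (h *: v + x) - f x).
    by apply: eP; [rewrite /ball_/= sub0r normrN gtr0_norm|rewrite gt_eqF].
  rewrite fx0 subr0 pmulr_rgt0 ?invr_gt0// ltNge => /negP; apply.
  by apply: f_le0; apply: dP; rewrite h0.
exists m; first exact: m0.
split; [exact: E0|exact: E1|exact: nn|].
have t0 : tcoord x nu 0 0 = n 0 / (4 * sinv x ^+ 2) := tcoordE x nu 0.
have t1 : tcoord x nu 0 1 = n 1 / (4 * sinv x ^+ 2) := tcoordE x nu 1.
have [_ ->] := C1_on_is_derive (tcoord x nu) oW fW Wx.
rewrite t0 t1 E0 E1.
move: (n 0) (n 1) nn k0 {t0 t1 E0 E1} => a b nn k0.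
rewrite (_ : _ + _ = m * (a ^+ 2 + b ^+ 2) / (4 * sinv x ^+ 2)); last by ring.
by rewrite nn mulfK// gt_eqF.
Qed.

(** * The vector field *)

Lemma sinv_mul (R : realType) (x : 'rV[R]_2) :
  sinv x * (1 + x 0 0 * x 0 0 + x 0 1 * x 0 1) = 1.
Proof. by rewrite mulVf// gt_eqF// s_gt0. Qed.

Lemma dotD (R : realType) (n : nat) (u v w : 'rV[R]_n) : dot (u + v) w = dot u w + dot v w.
Proof. by rewrite /dot -big_split; apply: eq_bigr => i _; rewrite /= mxE mulrDl. Qed.

Lemma dotC (R : realType) (n : nat) (u v : 'rV[R]_n) : dot u v = dot v u.
Proof. by apply: eq_bigr => i _; rewrite mulrC. Qed.

Lemma partial_chart_dot (R : realType) (x : 'rV[R]_2) (i j : 'I_2) :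
  dot (partial i (@chart R) x) (partial j (@chart R) x) = 4 * sinv x ^+ 2 *+ (i == j).
Proof.
have /matrixP/(_ i j) := round_metricE x.
by rewrite mxE => ->; rewrite mxE.
Qed.

Lemma partial_chart_tangent (R : realType) (x : 'rV[R]_2) (i : 'I_2) :
  dot (partial i (@chart R) x) (chart x) = 0.
Proof.
have ks := sinv_mul x.
have := chartE x; have := partial_chart x i.
move: (partial i _ x) (chart x) => P C.
rewrite !dot3E => -[-> -> ->] [-> -> ->].
set k := sinv x in ks *.
rewrite [LHS](_ : _ = 8 * x 0 i * k ^+ 2 * (1 - k * (1 + x 0 0 * x 0 0 + x 0 1 * x 0 1))).
  by rewrite ks subrr mulr0.
clear ks; move: i; apply: ord2_ind => /=; ring.
Qed.

Section flux_component.
Variables (R : realType) (V : normedModType R).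

(* Up to the factor [2], the vector field of the header is [flux] below, with [p], [q] the
   partial derivatives of [f = u] and [K = sinv]. It is split so that no division by [sinv]
   occurs. *)
Definition core_flux (X Y p q f K : V -> R) : V -> R :=
  (p * p + q * q) * X - cst 2 * (X * p + Y * q) * p - cst 2 * f * (cst 2 * K - cst 1 + f) * p.

(** In the chart [grad z] is minus the position vector, because [z] has partial derivatives
    [- 4 x_i sinv^2] and the metric is [4 sinv^2] times the identity; hence the bare factors [X] and
    [Y]. This is the coefficient of [- grad z] in the part of the field free of derivatives of
    [u]. *)
Definition tail_flux (c : R) (f K : V -> R) : V -> R :=
  cst (c * c) + f * (cst 4 * (cst 2 * K - cst 1) + cst 3 * f).

Definition scaled_flux (c : R) (X Y p q f K : V -> R) : V -> R :=
  core_flux X Y p q f K + cst 4 * K * K * tail_flux c f K * X.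

(** The second component of the field is the first with [(X, p)] and [(Y, q)] exchanged, so this
    computation serves for both. *)
Lemma is_derive_scaled_flux (c : R) (X Y p q f K : V -> R) (y v : V) (p1 q1 : R) :
  is_derive y v X 1 -> is_derive y v Y 0 -> is_derive y v f (p y) ->
  is_derive y v p p1 -> is_derive y v q q1 -> is_derive y v K (- 2 * X y * K y ^+ 2) ->
  is_derive y v (scaled_flux c X Y p q f K)
  (2 * (p y * p1 + q y * q1) * X y + p y ^+ 2 + q y ^+ 2
   - 2 * (p y + X y * p1 + Y y * q1) * p y - 2 * (X y * p y + Y y * q y) * p1
   - 2 * p y * (2 * K y - 1 + f y) * p y - 2 * f y * (- 4 * X y * K y ^+ 2 + p y) * p y
   - 2 * f y * (2 * K y - 1 + f y) * p1
   - 16 * K y ^+ 3 * X y ^+ 2 * (c ^+ 2 + f y * (4 * (2 * K y - 1) + 3 * f y))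
   + 4 * K y ^+ 2 * (p y * (4 * (2 * K y - 1) + 3 * f y)
        + f y * (- 16 * X y * K y ^+ 2 + 3 * p y)) * X y
   + 4 * K y ^+ 2 * (c ^+ 2 + f y * (4 * (2 * K y - 1) + 3 * f y))).
Proof.
move=> dX dY df dp dq dK; rewrite /scaled_flux /core_flux /tail_flux.
is_derive_eq_tac.
move: (X y) (Y y) (f y) (p y) (q y) (K y) => *; clear; ring.
Qed.

End flux_component.

(** Here [h] stands for [z], and [p - 4 a k^2], [q - 4 b k^2] are the partial derivatives of
    [u + z]. The value is [8 k^2 (z (c^2 - Q) - 2 u |grad (u + z)|^2)], the divergence of the
    doubled field times the area density [4 k^2]. *)
Definition flux_div (R : realType) (c k h a b u p q : R) : R :=
  2 * (4 * k ^+ 2 * h * c ^+ 2 - h * (p ^+ 2 + q ^+ 2) + 4 * k ^+ 2 * h * (u ^+ 2 + 2 * u * h)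
   - 2 * u * ((p - 4 * a * k ^+ 2) ^+ 2 + (q - 4 * b * k ^+ 2) ^+ 2)).

(** [r], [s], [t] are the second derivatives of [u]. The mixed one cancels between the components,
    and the other two survive only through their sum, which the equation prescribes. *)
Lemma flux_div_sum (R : realType) (c k a b u p q r s t : R) :
  k * (1 + a * a + b * b) = 1 -> r + t = 8 * (2 * k - 1) * k ^+ 2 ->
  (2 * (p * r + q * s) * a + p ^+ 2 + q ^+ 2
   - 2 * (p + a * r + b * s) * p - 2 * (a * p + b * q) * r
   - 2 * p * (2 * k - 1 + u) * p - 2 * u * (- 4 * a * k ^+ 2 + p) * p
   - 2 * u * (2 * k - 1 + u) * r
   - 16 * k ^+ 3 * a ^+ 2 * (c ^+ 2 + u * (4 * (2 * k - 1) + 3 * u))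
   + 4 * k ^+ 2 * (p * (4 * (2 * k - 1) + 3 * u) + u * (- 16 * a * k ^+ 2 + 3 * p)) * a
   + 4 * k ^+ 2 * (c ^+ 2 + u * (4 * (2 * k - 1) + 3 * u))) +
  (2 * (q * t + p * s) * b + q ^+ 2 + p ^+ 2
   - 2 * (q + b * t + a * s) * q - 2 * (b * q + a * p) * t
   - 2 * q * (2 * k - 1 + u) * q - 2 * u * (- 4 * b * k ^+ 2 + q) * q
   - 2 * u * (2 * k - 1 + u) * t
   - 16 * k ^+ 3 * b ^+ 2 * (c ^+ 2 + u * (4 * (2 * k - 1) + 3 * u))
   + 4 * k ^+ 2 * (q * (4 * (2 * k - 1) + 3 * u) + u * (- 16 * b * k ^+ 2 + 3 * q)) * b
   + 4 * k ^+ 2 * (c ^+ 2 + u * (4 * (2 * k - 1) + 3 * u)))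
  = flux_div c k (2 * k - 1) a b u p q.
Proof.
move=> ks rt; have -> : t = 8 * (2 * k - 1) * k ^+ 2 - r by rewrite -rt addrC addKr.
apply/eqP; rewrite -subr_eq0; apply/eqP.
rewrite [LHS](_ : _ = - 16 * k ^+ 2 * (c ^+ 2 + u * (4 * (2 * k - 1) + 3 * u)) *
   (k * (1 + a * a + b * b) - 1)).
  by rewrite ks subrr mulr0.
by rewrite /flux_div; clear; ring.
Qed.

Section flux.
Variables (R : realType) (c : R) (f : 'rV[R]_2 -> R).

Let X (y : 'rV[R]_2) : R := y 0 0.
Let Y (y : 'rV[R]_2) : R := y 0 1.
Let p : 'rV[R]_2 -> R := partial 0 f.
Let q : 'rV[R]_2 -> R := partial 1 f.

Definition flux_num (j : 'I_2) : 'rV[R]_2 -> R :=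
  if j == 0 then scaled_flux c X Y p q f (@sinv R) else scaled_flux c Y X q p f (@sinv R).

(* The round area density times [flux] is [flux_num]. *)
Definition flux (j : 'I_2) : 'rV[R]_2 -> R :=
  cst (4^-1) * (cst 1 + X * X + Y * Y) * (cst 1 + X * X + Y * Y) *
    (if j == 0 then core_flux X Y p q f (@sinv R) else core_flux Y X q p f (@sinv R))
  + tail_flux c f (@sinv R) * (if j == 0 then X else Y).

Lemma flux_numE (j : 'I_2) (y : 'rV[R]_2) : 4 * sinv y ^+ 2 * flux j y = flux_num j y.
Proof.
have ks : sinv y * (1 + X y * X y + Y y * Y y) = 1 := sinv_mul y.
rewrite /flux /flux_num /scaled_flux; case: (j == 0); rewrite !fctE /cst.
- move: (tail_flux _ _ _ y) (core_flux _ _ _ _ _ _ y) => A B.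
  rewrite [LHS](_ : _ = (sinv y * (1 + X y * X y + Y y * Y y)) ^+ 2 * B +
    4 * sinv y * sinv y * A * X y); first by rewrite ks expr1n mul1r.
  by clear ks; move: (sinv y) (X y) (Y y) => *; field.
- move: (tail_flux _ _ _ y) (core_flux _ _ _ _ _ _ y) => A B.
  rewrite [LHS](_ : _ = (sinv y * (1 + X y * X y + Y y * Y y)) ^+ 2 * B +
    4 * sinv y * sinv y * A * Y y); first by rewrite ks expr1n mul1r.
  by clear ks; move: (sinv y) (X y) (Y y) => *; field.
Qed.

Lemma flux_num_div (W : set 'rV[R]_2) (y : 'rV[R]_2) : open W -> C2_on W f -> W y ->
  partial 0 (partial 0 f) y + partial 1 (partial 1 f) y = 8 * height y * sinv y ^+ 2 ->
  partial 0 (flux_num 0) y + partial 1 (flux_num 1) y =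
  flux_div c (sinv y) (height y) (y 0 0) (y 0 1) (f y) (partial 0 f y) (partial 1 f y).
Proof.
move=> oW fW Wy.
have ks := sinv_mul y.
have dX i : is_derive y (delta_mx 0 i : 'rV[R]_2) X (i == 0)%:R.
  have := rV2_coord_derive y (delta_mx 0 i) 0; congr (is_derive _ _ _ _).
  by rewrite mxE eqxx eq_sym.
have dY i : is_derive y (delta_mx 0 i : 'rV[R]_2) Y (i == 1)%:R.
  have := rV2_coord_derive y (delta_mx 0 i) 1; congr (is_derive _ _ _ _).
  by rewrite mxE eqxx eq_sym.
have dK i : is_derive y (delta_mx 0 i : 'rV[R]_2) (@sinv R) (- 2 * y 0 i * sinv y ^+ 2).
  have := is_derive_sinv y (delta_mx 0 i); congr (is_derive _ _ _ _).
  by rewrite !mxE eqxx; move: i; apply: ord2_ind => /=; ring.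
have df i : is_derive y (delta_mx 0 i : 'rV[R]_2) f (partial i f y).
  by apply: derivableP; have [] := fW.1 y Wy i.
have dp i j : is_derive y (delta_mx 0 i : 'rV[R]_2) (partial j f) (partial i (partial j f) y).
  by apply: derivableP; have [] := fW.2 j y Wy i.
move=> lap; have sym := partialC oW fW Wy.
have [_ D0] := @is_derive_scaled_flux _ _ c X Y p q f (@sinv R) y (delta_mx 0 0) _ _
  (dX 0) (dY 0) (df 0) (dp 0 0) (dp 0 1) (dK 0).
have [_ D1] := @is_derive_scaled_flux _ _ c Y X q p f (@sinv R) y (delta_mx 0 1) _ _
  (dY 1) (dX 1) (df 1) (dp 1 1) (dp 1 0) (dK 1).
have := flux_div_sum c (f y) (p y) (q y) (partial 0 (partial 1 f) y) ks lap.
rewrite -D0. rewrite -sym -D1. exact.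
Qed.

End flux.

Lemma C1_on_flux (R : realType) (c : R) (W : set 'rV[R]_2) (f : 'rV[R]_2 -> R) (j : 'I_2) :
  open W -> C2_on W f -> C1_on W (flux c f j).
Proof.
move=> oW fW; have f1 := fW.1; have p1 := fW.2 0; have q1 := fW.2 1.
have X1 := @C1_on_coord _ _ oW 0; have Y1 := @C1_on_coord _ _ oW 1.
have k1 := C1_on_sinv oW.
move: j; apply: ord2_ind; rewrite /flux /core_flux /tail_flux /=; C1_tac.
Qed.

Definition flux_field (R : realType) (c : R) (f : 'rV[R]_2 -> R) (p : 'rV[R]_3) : 'rV[R]_3 :=
  flux c f 0 (stereo p) *: partial 0 (@chart R) (stereo p) +
  flux c f 1 (stereo p) *: partial 1 (@chart R) (stereo p).

Lemma dot_flux_field (R : realType) (c : R) (f : 'rV[R]_2 -> R) (x : 'rV[R]_2) (w : 'rV[R]_3) :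
  dot (flux_field c f (chart x)) w = flux c f 0 x * dot (partial 0 (@chart R) x) w +
    flux c f 1 x * dot (partial 1 (@chart R) x) w.
Proof.
rewrite /flux_field chartK; apply: (etrans (dotD _ _ _)).
by congr (_ + _); exact: dotZ.
Qed.

Lemma flux_field_coord (R : realType) (c : R) (f : 'rV[R]_2 -> R) (x : 'rV[R]_2) (i : 'I_2) :
  field_coord (flux_field c f) x 0 i = flux c f i x.
Proof.
have k0 : 4 * sinv x ^+ 2 != 0 by rewrite gt_eqF// mulr_gt0// exprn_gt0// sinv_gt0.
have E := dot_flux_field c f x (partial i (@chart R) x).
have {}E : dot (flux_field c f (chart x)) (partial i (@chart R) x) =
    flux c f 0 x * (4 * sinv x ^+ 2 *+ (0 == i)) + flux c f 1 x * (4 * sinv x ^+ 2 *+ (1 == i)).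
  by apply: (etrans E); congr (_ * _ + _ * _); exact: partial_chart_dot.
apply: (etrans (tcoordE x _ i)); rewrite [X in X / _]E.
move: (flux c f) k0 => F k0 {E}; move: i.
by apply: ord2_ind; rewrite /= ?mulr1n ?mulr0n mulr0 ?addr0 ?add0r mulfK.
Qed.

(** * The domain and its closure in the plane of the chart *)

Section hemisphere_domain.
Variables (R : realType) (Om : set 'rV[R]_3).
Hypotheses (dom : sphere_domain Om) (hem : closure Om `<=` @hemisphere R).

Let O : set 'rV[R]_2 := [set x | Om (chart x)].
Let K : set 'rV[R]_2 := [set x | closure Om (chart x)].

Lemma flat_open : open O.
Proof.
have [_ _ [U oU OmE]] := dom.
rewrite (_ : O = @chart R @^-1` U); last first.
  apply/seteqP; split=> x; rewrite /O /= OmE; first by case.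
  by move=> Ux; split; [exact: Ux|exact: sphere_chart].
by apply: open_comp => // x _; exact: chart_continuous.
Qed.

Lemma flat_subset x : O x -> K x.
Proof. exact: (@subset_closure _ Om (chart x)). Qed.

Lemma flat_height x : K x -> 0 < height x.
Proof. by move=> /hem/hemisphereE[_]; rewrite chart_height. Qed.

(** The open hemisphere corresponds to the Euclidean unit disc, which is contained in the unit
    square of the sup norm. *)
Lemma flat_norm_lt1 x : K x -> `|x| < 1.
Proof.
move=> /flat_height; rewrite /height => h.
have s0 := s_gt0 x; have k0 := sinv_gt0 x; have ks := sinv_mul x.
have s2 : x 0 0 * x 0 0 + x 0 1 * x 0 1 < 1.
  rewrite ltNge; apply/negP => s1.
  have : 1 <= sinv x * (1 + x 0 0 * x 0 0 + x 0 1 * x 0 1) by rewrite ks.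
  have : sinv x * 2 <= sinv x * (1 + x 0 0 * x 0 0 + x 0 1 * x 0 1).
    by rewrite ler_pM2l//; lra.
  by rewrite ks; lra.
have sqlt (a : R) : a * a < 1 -> `|a| < 1.
  move=> a1; rewrite -(@expr_lt1 _ 2)// real_normK ?num_real// expr2; exact: a1.
have a0 := sqr_ge0 (x 0 0); have b0 := sqr_ge0 (x 0 1); rewrite !expr2 in a0 b0.
by rewrite rV2_norm_lt; apply/andP; split; apply: sqlt; lra.
Qed.

Lemma flat_compact : compact K.
Proof.
apply: bounded_closed_compact.
  by exists 1; split; [exact: num_real|move=> m m1 x /flat_norm_lt1 x1; exact: ltW (lt_trans x1 m1)].
have -> : K = @chart R @^-1` closure Om by [].
by apply: preimage_closed; [move=> x _; exact: chart_continuous|exact: closed_closure].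
Qed.

Lemma stereo_continuous (p : 'rV[R]_3) : p 0 ord_max != -1 -> {for p, continuous (@stereo R)}.
Proof.
move=> pN; apply: row_continuous => k.
pose c i : 'rV[R]_3 -> R := fun q => q 0 i.
have cc i : {for p, continuous (c i)} by exact: coord_continuous.
have ci : {for p, continuous (fun q : 'rV[R]_3 => (1 + q 0 ord_max)^-1)}.
  have cd : {for p, continuous (cst 1 + c ord_max)} by continuous_tac.
  have d0 : (cst 1 + c ord_max) p != 0 by rewrite /c !fctE addrC addr_eq0.
  exact: (@continuousV _ _ (cst 1 + c ord_max) _ d0 cd).
move: k; apply: ord2_ind.
- rewrite (_ : (fun q => _) = (fun q : 'rV[R]_3 => (1 + q 0 ord_max)^-1) * c 0).
    by continuous_tac.
  by apply/funext => q; have [] := stereoE q.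
- rewrite (_ : (fun q => _) = (fun q : 'rV[R]_3 => (1 + q 0 ord_max)^-1) * c 1).
    by continuous_tac.
  by apply/funext => q; have [] := stereoE q.
Qed.

Lemma domain_sphere p : Om p -> sphere p.
Proof. by have [_ _ [U _ ->]] := dom => -[]. Qed.

Lemma hemisphere_neq_south p : closure Om p -> p 0 ord_max != -1.
Proof. by move=> /hem/hemisphereE[_ p0]; rewrite gt_eqF// (lt_trans _ p0)// oppr_lt0. Qed.

Lemma closure_chart p : closure Om p -> chart (stereo p) = p.
Proof.
move=> cp; apply: stereoK; last exact: hemisphere_neq_south.
by have /hem/hemisphereE[] := cp.
Qed.

(** [K] comes from the closure taken in space; continuity of [stereo] away from the south pole turns
    its points into limits of [O] in the plane. *)
Lemma flat_adherent (x : 'rV[R]_2) (N : set 'rV[R]_2) : K x -> nbhs x N ->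
  exists2 y, N y & O y.
Proof.
move=> Kx Nx.
have sc := stereo_continuous (hemisphere_neq_south Kx).
have : nbhs (chart x) (@stereo R @^-1` N) by apply: sc; rewrite chartK.
move=> /Kx[p [Omp Np]]; exists (stereo p); first exact: Np.
by rewrite /O /= closure_chart//; exact: subset_closure.
Qed.

Lemma flat_bd x : K x -> ~ O x -> bd Om (chart x).
Proof. by []. Qed.

Lemma flat_closed_cond (g h : 'rV[R]_2 -> R) x : K x -> {for x, continuous g} ->
  {for x, continuous h} -> (forall y, O y -> g y = h y) -> g x = h x.
Proof.
move=> Kx cg ch E; apply/eqP; rewrite -subr_eq0 -normr_le0; apply/ler_addgt0Pr => e e0.
rewrite add0r.
have c : {for x, continuous (g - h)} by apply: continuousB.
have N : \forall y \near x, `|(g - h) x - (g - h) y| < e by have /cvgr_dist_lt/(_ _ e0) := c.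
have [y + Oy] := flat_adherent Kx N.
by rewrite !fctE [g y]E// subrr subr0 => /ltW.
Qed.

(* Real induction along the segment from [x] to [x + v]. *)
Lemma segment_induction (x v : 'rV[R]_2) :
  O x ->
  (forall s : R, 0 < s <= 1 -> (forall t : R, 0 <= t < s -> O (x + t *: v)) -> O (x + s *: v)) ->
  forall s : R, 0 <= s <= 1 -> O (x + s *: v).
Proof.
move=> Ox step s s01.
pose A : set R := [set r | 0 <= r <= 1 /\ ~ O (x + r *: v)].
apply: contrapT => nO.
have A0 : A !=set0 by exists s.
have lbA : lbound A 0 by move=> r [/andP[]].
have hA : has_inf A by split => //; exists 0.
pose m := inf A.
have m0 : 0 <= m by apply: lb_le_inf.
have ms : m <= s by apply: ge_inf => //; exists 0.
have below t : 0 <= t < m -> O (x + t *: v).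
  move=> /andP[t0 tm]; apply: contrapT => nOt.
  suff : m <= t by rewrite leNgt tm.
  apply: ge_inf; first by exists 0; exact: lbA.
  by split=> //; rewrite t0 (le_trans (ltW tm))// (le_trans ms)//; case/andP: s01.
have Om_ : O (x + m *: v).
  move: m0; rewrite le_eqVlt => /predU1P[<-|m0]; first by rewrite scale0r addr0.
  by apply: step => //; rewrite m0 (le_trans ms)//; case/andP: s01.
have line : (fun r : R => x + r *: v) @ m --> x + m *: v.
  by apply: cvgD; [exact: cvg_cst|apply: cvgZr_tmp; exact: cvg_id].
have : nbhs m [set r : R | O (x + r *: v)].
  by apply: line; apply: open_nbhs_nbhs; split; [exact: flat_open|].
move=> /nbhs_normP[d /= d0 dP].
have [r [r01 nOr] rd] := inf_adherent d0 hA.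
have mr : m <= r by apply: ge_inf; [exists 0; exact: lbA|split].
apply: nOr; apply: dP => /=.
by rewrite distrC ger0_norm ?subr_ge0 ?mr// ltrBlDl; exact: rd.
Qed.

End hemisphere_domain.

(** * Necessity *)

Lemma C1_on_congr (R : realType) (W : set 'rV[R]_2) (f g : 'rV[R]_2 -> R) :
  open W -> (forall x, W x -> f x = g x) -> C1_on W f -> C1_on W g.
Proof.
move=> oW fg fW.
apply: (@C1_on_intro _ _ _ (fun i => partial i f) oW) => x i Wx; last by have [] := fW x Wx i.
apply: (@near_eq_is_derive _ _ _ f).
  by apply: filterS (open_nbhs_nbhs (conj oW Wx)) => y; exact: fg.
by apply: derivableP; have [] := fW x Wx i.
Qed.

Lemma partialD (R : realType) (f g : 'rV[R]_2 -> R) (x : 'rV[R]_2) (i : 'I_2) :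
  derivable f x (delta_mx 0 i) -> derivable g x (delta_mx 0 i) ->
  partial i (f + g) x = partial i f x + partial i g x.
Proof. exact: deriveD. Qed.

Lemma C2_onD (R : realType) (W : set 'rV[R]_2) (f g : 'rV[R]_2 -> R) :
  open W -> C2_on W f -> C2_on W g -> C2_on W (f + g).
Proof.
move=> oW [f1 f2] [g1 g2]; split=> [|i]; first exact: (@C1_onD _ _ oW f g f1 g1).
apply: (C1_on_congr oW _ (@C1_onD _ _ oW _ _ (f2 i) (g2 i))) => x Wx.
by apply/esym; apply: partialD; [exact: (f1 x Wx i).1|exact: (g1 x Wx i).1].
Qed.

Lemma C2_onS (R : realType) (W W' : set 'rV[R]_2) (f : 'rV[R]_2 -> R) :
  W' `<=` W -> C2_on W f -> C2_on W' f.
Proof. by move=> WW [f1 f2]; split=> [x /WW|i x /WW]; [exact: f1|exact: f2]. Qed.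

Lemma is_derive_height (R : realType) (x : 'rV[R]_2) (i : 'I_2) :
  is_derive x (delta_mx 0 i : 'rV[R]_2) (@height R) (- 4 * x 0 i * sinv x ^+ 2).
Proof.
have dk := is_derive_sinv x (delta_mx 0 i).
rewrite (_ : @height R = cst 2 * @sinv R - cst 1)//.
is_derive_eq_tac; rewrite !mxE eqxx; move: i {dk}; apply: ord2_ind => /=; ring.
Qed.

Lemma partial_height (R : realType) (i : 'I_2) :
  partial i (@height R) = (fun x : 'rV[R]_2 => - 4 * x 0 i * sinv x ^+ 2).
Proof. by apply/funext => x; have [_] := is_derive_height x i. Qed.

Lemma C2_on_height (R : realType) (W : set 'rV[R]_2) : open W -> C2_on W (@height R).
Proof.
move=> oW; have k1 := C1_on_sinv oW; split=> [|i].
  by rewrite (_ : @height R = cst 2 * @sinv R - cst 1)//; C1_tac.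
have x1 := @C1_on_coord _ _ oW i.
rewrite partial_height.
rewrite (_ : (fun x => _) = cst (- 4) * (fun x : 'rV[R]_2 => x 0 i) * (@sinv R * @sinv R))//.
by C1_tac.
Qed.

Lemma laplacian_height (R : realType) (x : 'rV[R]_2) :
  partial 0 (partial 0 (@height R)) x + partial 1 (partial 1 (@height R)) x =
  - 8 * height x * sinv x ^+ 2.
Proof.
have ks := sinv_mul x.
have D i : is_derive x (delta_mx 0 i : 'rV[R]_2) (partial i (@height R))
    (- 4 * sinv x ^+ 2 + 16 * x 0 i ^+ 2 * sinv x ^+ 3).
  rewrite partial_height.
  pose X (y : 'rV[R]_2) : R := y 0 i.
  rewrite (_ : (fun x => _) = cst (- 4) * X * (@sinv R * @sinv R))//.
  have dk : is_derive x (delta_mx 0 i : 'rV[R]_2) (@sinv R) (- 2 * x 0 i * sinv x ^+ 2).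
    have := is_derive_sinv x (delta_mx 0 i); congr (is_derive _ _ _ _).
    by rewrite !mxE eqxx; move: {X} i; apply: ord2_ind => /=; ring.
  have dX : is_derive x (delta_mx 0 i : 'rV[R]_2) X 1.
    by have := rV2_coord_derive x (delta_mx 0 i) i; rewrite mxE !eqxx.
  by is_derive_eq_tac; rewrite /X; ring.
have [_ e0] := D 0; have [_ e1] := D 1.
apply: (etrans (congr2 +%R e0 e1)); rewrite /height.
apply/eqP; rewrite -subr_eq0; apply/eqP.
rewrite [LHS](_ : _ = 16 * sinv x ^+ 2 * (sinv x * (1 + x 0 0 * x 0 0 + x 0 1 * x 0 1) - 1)).
  by rewrite ks subrr mulr0.
by clear; ring.
Qed.

Lemma height0 (R : realType) : height (0 : 'rV[R]_2) = 1.
Proof. by rewrite /height /sinv !mxE mulr0 !addr0 invr1; ring. Qed.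

Lemma height_scale (R : realType) (a : R) (x : 'rV[R]_2) : 0 <= a <= 1 ->
  height x <= height (a *: x).
Proof.
move=> /andP[a0 a1]; rewrite /height lerD2r ler_pM2l// /sinv lef_pV2 ?posrE ?s_gt0//.
have aa : a * a <= 1 by rewrite -[leRHS]mulr1 ler_pM.
have sq (b : R) : a * b * (a * b) <= b * b.
  by rewrite (_ : _ * _ = (a * a) * (b * b)); [rewrite ler_piMl// -expr2 sqr_ge0|ring].
by rewrite !mxE !lerD.
Qed.

Lemma Pfn_shift (R : realType) (k a b u p q : R) : k * (1 + a * a + b * b) = 1 ->
  k ^+ 2 * ((1 + a * a + b * b) * (1 + a * a + b * b) *
      ((p - 4 * a * k ^+ 2) * (p - 4 * a * k ^+ 2) + (q - 4 * b * k ^+ 2) * (q - 4 * b * k ^+ 2))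
    + 8 * (a * (p - 4 * a * k ^+ 2) + b * (q - 4 * b * k ^+ 2)) + 4
    - 4 * ((u + (2 * k - 1)) * (u + (2 * k - 1)))) =
  p ^+ 2 + q ^+ 2 - 4 * k ^+ 2 * (u ^+ 2 + 2 * u * (2 * k - 1)).
Proof.
move=> ks; apply/eqP; rewrite -subr_eq0; apply/eqP.
rewrite [LHS](_ : _ = ((k * (1 + a * a + b * b) + 1) *
   ((p - 4 * a * k ^+ 2) ^+ 2 + (q - 4 * b * k ^+ 2) ^+ 2) - 16 * k ^+ 3) *
   (k * (1 + a * a + b * b) - 1)).
  by rewrite ks subrr mulr0.
by clear; ring.
Qed.

Lemma flux_div_Pfn (R : realType) (c k h a b u p q P : R) :
  k ^+ 2 * P = p ^+ 2 + q ^+ 2 - 4 * k ^+ 2 * (u ^+ 2 + 2 * u * h) ->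
  flux_div c k h a b u p q = 2 * (k ^+ 2 * h * (4 * c ^+ 2 - P)
    + 2 * (- u) * ((p - 4 * a * k ^+ 2) ^+ 2 + (q - 4 * b * k ^+ 2) ^+ 2)).
Proof.
move=> E; rewrite /flux_div.
rewrite (_ : k ^+ 2 * h * (4 * c ^+ 2 - P) = h * (4 * c ^+ 2 * k ^+ 2 - k ^+ 2 * P)); last by ring.
by rewrite E; ring.
Qed.

Lemma compact_max (R : realType) (K : set 'rV[R]_2) (g : 'rV[R]_2 -> R) (x : 'rV[R]_2) :
  compact K -> K x -> (forall y, K y -> {for y, continuous g}) ->
  exists2 y, K y & forall z, K z -> g z <= g y.
Proof.
move=> cK Kx cg.
have K0 : K !=set0 by exists x.
have cgK : {within K, continuous g}.
  by apply: continuous_in_subspaceT => y /set_mem; exact: cg.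
have [y /set_mem Ky yP] := @compact_EVT_max _ R g K K0 cK cgK.
by exists y => // z Kz; apply: yP; exact: mem_set.
Qed.

Lemma Pfn_bd_value (R : realType) (c k P p q u z n0 n1 : R) : k != 0 ->
  k ^+ 2 * P = p ^+ 2 + q ^+ 2 - 4 * k ^+ 2 * (u ^+ 2 + 2 * u * z) ->
  u = 0 -> p = c * n0 -> q = c * n1 -> n0 ^+ 2 + n1 ^+ 2 = 4 * k ^+ 2 -> P = 4 * c ^+ 2.
Proof.
move=> k0 E u0 p0 q0 nn; apply: (mulfI (expf_neq0 2 k0)).
by rewrite E u0 p0 q0 !exprMn -mulrDr nn; ring.
Qed.

Lemma penalty_bd_absurd (R : realType) (p C A B : R) :
  0 <= A -> B < (p - 4 * C) / 4 * 2 -> p + A <= 4 * C + B -> ~ 4 * C < p.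
Proof. move=> *; lra. Qed.

(** With [u = 0] and gradient [c n], the normal component is a multiple of
    [c^2 (x . n) (4 k^2 - |n|^2)]: the [c^2] term of the field balances the Pohozaev part. *)
Lemma flux_bd_value (R : realType) (c k x y u p q n0 n1 A B : R) : k != 0 ->
  u = 0 -> p = c * n0 -> q = c * n1 -> n0 ^+ 2 + n1 ^+ 2 = 4 * k ^+ 2 ->
  4 * k ^+ 2 * A = (p * p + q * q) * x - 2 * (x * p + y * q) * p - 2 * u * (2 * k - 1 + u) * p
    + 4 * k * k * (c * c + u * (4 * (2 * k - 1) + 3 * u)) * x ->
  4 * k ^+ 2 * B = (q * q + p * p) * y - 2 * (y * q + x * p) * q - 2 * u * (2 * k - 1 + u) * q
    + 4 * k * k * (c * c + u * (4 * (2 * k - 1) + 3 * u)) * y ->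
  A * n0 + B * n1 = 0.
Proof.
move=> k0 u0 p0 q0 nn EA EB.
have k4 : 4 * k ^+ 2 != 0 by rewrite mulf_neq0 ?expf_neq0// pnatr_eq0.
apply: (mulfI k4); rewrite mulr0 mulrDr (mulrA _ A) (mulrA _ B) EA EB u0 p0 q0.
rewrite [LHS](_ : _ = c ^+ 2 * (x * n0 + y * n1) * (4 * k ^+ 2 - (n0 ^+ 2 + n1 ^+ 2))).
  by rewrite nn subrr mulr0.
by ring.
Qed.

Lemma flux_div_continuous (R : realType) (c : R) (k z X Y u p q : 'rV[R]_2 -> R) (x : 'rV[R]_2) :
  {for x, continuous k} -> {for x, continuous z} -> {for x, continuous X} ->
  {for x, continuous Y} -> {for x, continuous u} -> {for x, continuous p} ->
  {for x, continuous q} ->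
  {for x, continuous (fun y => flux_div c (k y) (z y) (X y) (Y y) (u y) (p y) (q y))}.
Proof.
move=> ck cz cX cY cu cp cq.
have -> : (fun y => flux_div c (k y) (z y) (X y) (Y y) (u y) (p y) (q y)) =
    cst 2 * (cst 4 * (k * k) * z * cst (c * c) - z * (p * p + q * q)
      + cst 4 * (k * k) * z * (u * u + cst 2 * u * z)
      - cst 2 * u * ((p - cst 4 * X * (k * k)) * (p - cst 4 * X * (k * k)) +
                     (q - cst 4 * Y * (k * k)) * (q - cst 4 * Y * (k * k)))) by [].
by continuous_tac.
Qed.

Lemma closed_segment (R : realType) (V : normedModType R) (K : set V) (x v : V) (s : R) :
  closed K -> 0 < s -> (forall t : R, 0 <= t < s -> K (x + t *: v)) -> K (x + s *: v).
Proof.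
move=> cK s0 Ks; apply: contrapT => nK.
have line : (fun r : R => x + r *: v) @ s --> x + s *: v.
  by apply: cvgD; [exact: cvg_cst|apply: cvgZr_tmp; exact: cvg_id].
have nK' : nbhs (x + s *: v) (~` K).
  by apply: open_nbhs_nbhs; split; [exact: closed_openC|].
have : nbhs s ((fun r : R => x + r *: v) @^-1` (~` K)) by exact: (line _ nK').
move=> /nbhs_normP[d /= d0 dP].
pose t := Num.max 0 (s - d / 2).
have ts : t < s by rewrite gt_max s0 ltrBlDr ltrDl divr_gt0.
have t0 : 0 <= t by rewrite le_max lexx.
suff : ~ K (x + t *: v) by apply; apply: Ks; rewrite t0.
apply: dP; rewrite /= ger0_norm ?subr_ge0 ?(ltW ts)//.
rewrite ltrBlDr -ltrBlDl; apply: (@lt_le_trans _ _ (s - d / 2)).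
  by rewrite ltrD2l ltrN2 ltr_pdivrMr// mulr_natr mulr2n ltrDl.
by rewrite le_max lexx orbT.
Qed.

Section forward.
Variables (R : realType) (Om : set 'rV[R]_3) (nu : 'rV[R]_3 -> 'rV[R]_3).
Variables (c : R) (W : set 'rV[R]_2) (f : 'rV[R]_2 -> R).
Hypotheses (dom : sphere_domain Om) (hem : closure Om `<=` @hemisphere R)
  (reg : regular_boundary Om nu).

Let O : set 'rV[R]_2 := [set x | Om (chart x)].
Let K : set 'rV[R]_2 := [set x | closure Om (chart x)].

Hypotheses (oW : open W) (KW : forall x, K x -> W x) (fW : C2_on W f).
Hypotheses (lap : forall x, O x ->
    partial 0 (partial 0 f) x + partial 1 (partial 1 f) x = 8 * height x * sinv x ^+ 2)
  (f_bd : forall x, K x -> ~ O x -> f x = 0)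
  (df_bd : forall x, K x -> ~ O x -> 'D_(tcoord x (nu (chart x))) f x = c).

Let oO : open O. Proof. exact: (@flat_open R Om dom). Qed.
Let OK x : O x -> K x. Proof. exact: (@flat_subset R Om x). Qed.
Let OW x : O x -> W x. Proof. by move=> /OK; exact: KW. Qed.
Let cK : compact K. Proof. exact: (@flat_compact R Om hem). Qed.
Let nO x : O x -> nbhs x O. Proof. by move=> Ox; exact: open_nbhs_nbhs. Qed.

Let cf x : W x -> {for x, continuous f}.
Proof. exact: (@C1_on_continuous _ _ _ _ oW fW.1). Qed.
Let cdf i x : W x -> {for x, continuous (partial i f)}.
Proof. by move=> Wx; have [] := fW.1 x Wx i. Qed.
Let df i x : W x -> is_derive x (delta_mx 0 i : 'rV[R]_2) f (partial i f x).
Proof. by move=> Wx; apply: derivableP; have [] := fW.1 x Wx i. Qed.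
Let ddf i x : W x -> is_derive x (delta_mx 0 i : 'rV[R]_2) (partial i f) (partial i (partial i f) x).
Proof. by move=> Wx; apply: derivableP; have [] := fW.2 i x Wx i. Qed.

Lemma no_interior_max x : O x -> ~ (forall y, K y -> f y <= f x).
Proof.
move=> Ox fmax.
have D i : partial i (partial i f) x <= 0.
  apply: (@second_is_derive_at_max _ _ f (partial i f) x (delta_mx 0 i)).
  - by apply: filterS (nO Ox) => y Oy; apply: df; exact: OW.
  - by apply: ddf; exact: OW.
  - by apply: filterS (nO Ox) => y Oy; apply: fmax; exact: OK.
have := lap Ox.
have k0 : 0 < 8 * height x * sinv x ^+ 2.
  by rewrite !mulr_gt0 ?exprn_gt0 ?sinv_gt0 ?(flat_height hem (OK Ox)).
have := lerD (D 0) (D 1).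
move=> le E; move: k0; rewrite -E ltNge => /negP; apply.
by rewrite -[leRHS]addr0.
Qed.

(** The maximum of [f] over [K] is not interior, so it is the boundary value [0]; a point of [O]
    with [f >= 0] would then be an interior maximum after all. *)
Lemma interior_neg x : O x -> f x < 0.
Proof.
move=> Ox; rewrite ltNge; apply/negP => fx.
have [y Ky yP] := compact_max cK (OK Ox) (fun y Ky => cf (KW Ky)).
have [Oy|nOy] := pselect (O y); first exact: (no_interior_max Oy yP).
apply: (no_interior_max Ox) => z Kz; apply: (le_trans (yP z Kz)).
by rewrite f_bd.
Qed.

Lemma bd_gradient x : K x -> ~ O x ->
  let n i := dot (nu (chart x)) (partial i (@chart R) x) in
  [/\ f x = 0, partial 0 f x = c * n 0, partial 1 f x = c * n 1 &
      n 0 ^+ 2 + n 1 ^+ 2 = 4 * sinv x ^+ 2].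
Proof.
move=> Kx nOx n.
have f_le0 y : Om (chart y) -> f y <= 0 by move=> Oy; apply: ltW; exact: interior_neg.
have [m _ []] := boundary_gradient oW fW.1 (KW Kx) (reg.1 _ (flat_bd Kx nOx)) f_le0 (f_bd Kx nOx).
move=> e0 e1 nn em; have {em} E : c = m := etrans (esym (df_bd Kx nOx)) em.
have fx := f_bd Kx nOx.
split; [exact: fx|exact: etrans e0 (congr1 ( *%R^~ _) (esym E))|exact: etrans e1 (congr1 ( *%R^~ _) (esym E))|exact: nn].

Qed.

Let h : 'rV[R]_2 -> R := f + @height R.

Let hW : C2_on W h. Proof. exact: (C2_onD oW fW (C2_on_height oW)). Qed.

Lemma harmonic_sum x : O x -> partial 0 (partial 0 h) x + partial 1 (partial 1 h) x = 0.
Proof.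
move=> Ox; have Wx := OW Ox.
have [_ H2] := C2_on_height oW.
have E i : partial i (partial i h) x = partial i (partial i f) x + partial i (partial i (@height R)) x.
  have <- : partial i (partial i f + partial i (@height R)) x =
      partial i (partial i f) x + partial i (partial i (@height R)) x.
    by apply: partialD; [exact: (fW.2 i x Wx i).1|exact: (H2 i x Wx i).1].
  apply: near_eq_derive; apply: filterS (nO Ox) => y Oy.
  apply: partialD; first exact: (fW.1 y (OW Oy) i).1.
  by have [] := is_derive_height y i.
have := laplacian_height x; have := lap Ox; rewrite !E.
move: (partial 0 _ x) (partial 1 _ x) (partial 0 _ x) (partial 1 _ x) => a b a' b' e e'.
by rewrite addrACA e e'; clear; ring.
Qed.

Let X (y : 'rV[R]_2) : R := y 0 0.
Let Y (y : 'rV[R]_2) : R := y 0 1.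
Let P : 'rV[R]_2 -> R := Pfn X Y (partial 0 h) (partial 1 h) h.

Let partial_h i x : W x -> partial i h x = partial i f x - 4 * x 0 i * sinv x ^+ 2.
Proof.
move=> Wx; rewrite partialD.
- by rewrite partial_height -!mulNr.
- exact: (fW.1 x Wx i).1.
- by have [] := is_derive_height x i.
Qed.

Lemma PfnE x : W x -> sinv x ^+ 2 * P x = partial 0 f x ^+ 2 + partial 1 f x ^+ 2
  - 4 * sinv x ^+ 2 * (f x ^+ 2 + 2 * f x * height x).
Proof.
move=> Wx; have := Pfn_shift (f x) (partial 0 f x) (partial 1 f x) (sinv_mul x).
rewrite -(partial_h 0 Wx) -(partial_h 1 Wx); exact.
Qed.

Lemma Pfn_bd x : K x -> ~ O x -> P x = 4 * c ^+ 2.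
Proof.
move=> Kx nOx; have [e0 e1 e2 e3] := bd_gradient Kx nOx.
exact: (Pfn_bd_value (lt0r_neq0 (sinv_gt0 x)) (PfnE (KW Kx)) e0 e1 e2 e3).
Qed.

Lemma Pfn_le x : O x -> P x <= 4 * c ^+ 2.
Proof.
move=> Ox; rewrite leNgt; apply/negP => Px.
(* On [K] the squared norm is below [2], so the penalty adds less than [2 * d], half of the supposed
   excess of [P x], to the boundary value. *)
pose d := (P x - 4 * c ^+ 2) / 4.
have d0 : 0 < d by rewrite divr_gt0// subr_gt0.
pose G := P + cst d * (X * X + Y * Y).
have cG y : K y -> {for y, continuous G}.
  move=> /KW Wy.
  have cX : {for y, continuous X} by exact: coord_continuous.
  have cY : {for y, continuous Y} by exact: coord_continuous.
  have cP : {for y, continuous P}.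
    apply: (Pfn_continuous cX cY).
    - by have [] := hW.1 y Wy 0.
    - by have [] := hW.1 y Wy 1.
    - exact: (@C1_on_continuous _ _ _ _ oW hW.1).
  by rewrite /G; continuous_tac.
have [y Ky yP] := compact_max cK (OK Ox) cG.
have [Oy|nOy] := pselect (O y).
  apply: (@Pfn_no_local_max R O h oO (C2_onS OW hW) harmonic_sum y d Oy d0).
  by apply: filterS (nO Oy) => z Oz; exact: yP (OK Oz).
have GE z : G z = P z + d * (X z * X z + Y z * Y z) by [].
have := yP _ (OK Ox); rewrite (GE x) (GE y) (Pfn_bd Ky nOy).
have := flat_norm_lt1 hem Ky; rewrite rV2_norm_lt => /andP[y0 y1].
have sq (a : R) : `|a| < 1 -> a * a < 1.
  by move=> a1; rewrite -expr2 -real_normK ?num_real// expr_lt1.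
have s2 : X y * X y + Y y * Y y < 2 by rewrite (_ : 2 = 1 + 1)// ltrD// sq.
have : d * (X y * X y + Y y * Y y) < d * 2 by rewrite ltr_pM2l.
have : 0 <= d * (X x * X x + Y x * Y x).
  by rewrite mulr_ge0 ?(ltW d0)// addr_ge0// -expr2 sqr_ge0.
move=> A0 B0 AB; exact: (penalty_bd_absurd A0 B0 AB Px).
Qed.

Let D (x : 'rV[R]_2) : R :=
  flux_div c (sinv x) (height x) (x 0 0) (x 0 1) (f x) (partial 0 f x) (partial 1 f x).

Let DE x : W x -> D x = 2 * (sinv x ^+ 2 * height x * (4 * c ^+ 2 - P x)
    + 2 * (- f x) * (partial 0 h x ^+ 2 + partial 1 h x ^+ 2)).
Proof.
move=> Wx; have := flux_div_Pfn c (x 0 0) (x 0 1) (PfnE Wx).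
rewrite -(partial_h 0 Wx) -(partial_h 1 Wx); exact.
Qed.

Lemma flux_div_ge0 x : O x -> 0 <= D x.
Proof.
move=> Ox; have Px := Pfn_le Ox; have fx := interior_neg Ox.
have z0 := flat_height hem (OK Ox); have k0 := sinv_gt0 x.
rewrite (DE (OW Ox)); move: (P x) (f x) (partial 0 h x) (partial 1 h x) Px fx => p u a b Pu u0.
apply: mulr_ge0; first exact: ler0n.
apply: addr_ge0; first by rewrite mulr_ge0 ?subr_ge0// mulr_ge0 ?(ltW z0)// exprn_ge0// ltW.
by rewrite mulr_ge0 ?addr_ge0 ?sqr_ge0// mulr_ge0// oppr_ge0 ltW.
Qed.

Let cD x : W x -> {for x, continuous D}.
Proof.
move=> Wx; apply: (@flux_div_continuous R c (@sinv R) (@height R) X Y f (partial 0 f) (partial 1 f) x).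
- exact: sinv_continuous.
- exact: height_continuous.
- exact: coord_continuous.
- exact: coord_continuous.
- exact: cf.
- exact: cdf.
- exact: cdf.
Qed.

Lemma flux_field_C1 : C1_field_closure Om (flux_field c f).
Proof.
exists W; split; first exact: oW.
- by move=> p cp; apply: KW; rewrite /K /= (closure_chart hem cp).
- move=> x _; apply: (etrans (dot_flux_field _ _ _ _)).
  have lin0 (a b u v : R) : u = 0 -> v = 0 -> a * u + b * v = 0.
    by move=> -> ->; rewrite !mulr0 addr0.
  exact: lin0 (partial_chart_tangent x 0) (partial_chart_tangent x 1).
- move=> i; rewrite (_ : (fun x => _) = flux c f i); first exact: C1_on_flux oW fW.
  by apply/funext => x; exact: flux_field_coord.
Qed.

Lemma flux_field_div x : O x ->
  sphere_div (flux_field c f) (chart x) * vol (@round_metric R) x = D x.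
Proof.
move=> Ox; rewrite /sphere_div chartK /divergence sum_ord2.
have E i : (fun y => vol (@round_metric R) y * field_coord (flux_field c f) y 0 i) = flux_num c f i.
  by apply/funext => y; rewrite vol_round flux_field_coord flux_numE.
rewrite !E (flux_num_div c oW fW (OW Ox) (lap Ox)) mulrC mulrA mulfV ?mul1r//.
by rewrite vol_round mulf_neq0// expf_neq0// gt_eqF// sinv_gt0.
Qed.

Lemma flux_field_bd p : bd Om p -> dot (flux_field c f p) (nu p) = 0.
Proof.
move=> bp; have cp := closure_chart hem bp.1.
pose x := stereo p.
have Kx : K x by rewrite /K /= cp; exact: bp.1.
have nOx : ~ O x by rewrite /O /= cp; exact: bp.2.
rewrite -cp -/x; apply: (etrans (dot_flux_field _ _ _ _)).
have [e0 e1 e2 e3] := bd_gradient Kx nOx.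
apply: (etrans (congr2 (fun a b => _ * a + _ * b) (dotC _ _) (dotC _ _))).
exact: (flux_bd_value (lt0r_neq0 (sinv_gt0 x)) e0 e1 e2 e3 (flux_numE c f 0 x) (flux_numE c f 1 x)).
Qed.

(** The integral of [D] over [O] is the flux through the boundary, which is zero, while [D] is
    continuous and nonnegative. The required upper bound is its maximum over [K]. *)
Lemma flux_div_eq0 x : O x -> D x = 0.
Proof.
move=> Ox.
have [y _ yP] := compact_max cK (OK Ox) (fun y Ky => cD (KW Ky)).
apply: (@continuous_Rintegral_eq0 R O D (D y) oO _ _ flux_div_ge0 _ _ x Ox).
- by move=> z /OK; exact: (flat_norm_lt1 hem).
- by move=> z /OW; exact: cD.
- by move=> z /OK; exact: yP.
have [sigma] := reg.2; move=> /(_ _ flux_field_C1)[_ E].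
apply: (etrans _ (etrans E _)).
  by apply: eq_Rintegral => z /set_mem Oz; rewrite flux_field_div.
rewrite /Rintegral integral0_eq// => p bp.
by congr EFin; exact: flux_field_bd.
Qed.

Lemma sum_gradient_eq0 x i : O x -> partial i h x = 0.
Proof.
move=> Ox; have := flux_div_eq0 Ox; rewrite (DE (OW Ox)).
have Px := Pfn_le Ox; have fx := interior_neg Ox.
have z0 := flat_height hem (OK Ox); have k0 := sinv_gt0 x.
have A0 : 0 <= sinv x ^+ 2 * height x * (4 * c ^+ 2 - P x).
  by rewrite mulr_ge0 ?subr_ge0// mulr_ge0 ?(ltW z0)// exprn_ge0// ltW.
move: i; apply: ord2_ind; move: (partial 0 h x) (partial 1 h x) (f x) fx A0 => a b u u0.
all: move: (_ * (_ - _)) => A A0 /eqP.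
all: rewrite mulf_eq0 pnatr_eq0/= paddr_eq0// ?mulr_ge0 ?oppr_ge0 ?(ltW u0) ?addr_ge0 ?sqr_ge0//.
all: rewrite !mulf_eq0 pnatr_eq0/= oppr_eq0 (lt_eqF u0)/= paddr_eq0 ?sqr_ge0// !sqrf_eq0.
all: by move=> /and3P[_ /eqP a0 /eqP b0].
Qed.

Let gradient0 x i : K x -> partial i h x = 0.
Proof.
move=> Kx; apply: (@flat_closed_cond R Om hem (partial i h) (cst 0) x Kx).
- exact: (hW.1 x (KW Kx) i).2.
- exact: cst_continuous.
- by move=> y Oy; exact: sum_gradient_eq0.
Qed.

Lemma sum_const_segment x v (s : R) : 0 < s ->
  (forall t : R, 0 <= t < s -> O (x + t *: v)) -> K (x + s *: v) /\ h (x + s *: v) = h x.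
Proof.
move=> s0 Os.
have Ks : K (x + s *: v).
  apply: (@closed_segment _ _ K x v s (compact_closed _ cK) s0); first exact: norm_hausdorff.
  by move=> t /Os; exact: OK.
split; first exact: Ks.
have D0 (t : R) : 0 <= t <= s -> is_derive (x + t *: v) v h 0.
  move=> /andP[t0 ts].
  have Kt : K (x + t *: v).
    move: ts; rewrite le_eqVlt => /predU1P[->|ts]; first exact: Ks.
    by apply: OK; apply: Os; rewrite t0.
  have := C1_on_is_derive v oW hW.1 (KW Kt).
  by rewrite !(gradient0 _ Kt) !mulr0 addr0.
(* [mvt_line] asks for a symmetric range of parameters, so both ends are compared with the midpoint;
   nothing is known of the line beyond the segment. *)
pose m := x + (s / 2) *: v.
have mid (a : R) : `|a| <= s / 2 -> h (m + a *: v) = h m.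
  move=> a2.
  have D1 (t : R) : `|t| <= `|a| -> is_derive (m + t *: v) v h 0.
    move=> ta; rewrite /m -addrA -scalerDl; apply: D0.
    have := le_trans ta a2; rewrite ler_norml => /andP[t1 t2].
    by apply/andP; split; [rewrite addrC -lerBlDr sub0r|rewrite [leRHS](splitr s) lerD2l].
  have [t ta E] := @mvt_line R _ h m v a (fun t ta => let: DeriveDef d _ := D1 t ta in d).
  by apply/eqP; rewrite -subr_eq0 E; have [_ ->] := D1 t ta; rewrite mulr0.
have s2 : 0 <= s / 2 by rewrite divr_ge0// ltW.
have e1 : m + (s / 2) *: v = x + s *: v by rewrite /m -addrA -scalerDl -splitr.
have e2 : m + (- (s / 2)) *: v = x by rewrite /m -addrA -scalerDl subrr scale0r addr0.
have E1 : h (m + (s / 2) *: v) = h m by apply: mid; rewrite ger0_norm.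
have E2 : h (m + (- (s / 2)) *: v) = h m by apply: mid; rewrite normrN ger0_norm.
by rewrite e1 in E1; rewrite e2 in E2; rewrite E1 E2.
Qed.

(** As long as a segment stays in [O], [h] is constant on it and [f] is a constant minus [height].
    Moving towards the origin, [height] does not decrease, so [f] stays negative and the boundary,
    where [f = 0], is never met; hence [0] lies in [O] and [h = h 0]. Moving outwards from the
    origin, the same reasoning applies as long as [height > h 0]. *)
Lemma domain_superlevel : exists k0 : R, [/\ 0 <= k0, k0 < 1,
  forall x, O x <-> k0 < height x & forall x, K x -> f x = k0 - height x].
Proof.
have fE x : f x = h x - height x by rewrite /h !fctE addrK.
have to0 x : O x -> O 0 /\ h x = h 0.
  move=> Ox.
  have O1 : forall s : R, 0 <= s <= 1 -> O (x + s *: (- x)).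
    apply: (@segment_induction R Om dom x (- x) Ox) => s /andP[s0 s1] Os.
    have [Ks hs] := sum_const_segment s0 Os.
    apply: contrapT => nOs; have := f_bd Ks nOs; rewrite fE hs.
    have : height x <= height (x + s *: - x).
      rewrite (_ : x + s *: - x = (1 - s) *: x); last by rewrite scalerBl scale1r scalerN.
      by apply: height_scale; rewrite subr_ge0 s1 gerBl ltW.
    move=> le_xs e0; have := interior_neg Ox; rewrite fE subr_lt0 => lt_x.
    by move: (lt_le_trans lt_x le_xs); rewrite -subr_lt0 e0 ltxx.
  have [|_ E] := @sum_const_segment x (- x) 1 ltr01.
    by move=> t /andP[t0 t1]; apply: O1; rewrite t0 ltW.
  have O0 : O (x + 1 *: - x) by apply: O1; rewrite ler01 lexx.
  by rewrite scale1r subrr in O0 E; split; [exact: O0|rewrite E].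
have [[p Omp] _ _] := dom.
have OmE : O (stereo p) by rewrite /O /= (closure_chart hem)//; exact: subset_closure.
have [zO _] := to0 _ OmE.
have hO x : O x -> h x = h 0 by move=> /to0[].
pose k0 := h 0.
have fO x : O x -> f x = k0 - height x by move=> Ox; rewrite fE hO.
have hK x : K x -> h x = k0.
  move=> Kx; apply: (@flat_closed_cond R Om hem h (cst k0) x Kx).
  - exact: (@C1_on_continuous _ _ _ _ oW hW.1 (KW Kx)).
  - exact: cst_continuous.
  - exact: hO.
have fK x : K x -> f x = k0 - height x by move=> Kx; rewrite fE hK.
have k1 : k0 < 1 by have := interior_neg zO; rewrite fO// height0 subr_lt0.
have OP x : k0 < height x -> O x.
  move=> kx.
  suff : O (0 + 1 *: x) by rewrite add0r scale1r.
  apply: (@segment_induction R Om dom 0 x zO); last by rewrite ler01 lexx.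
  move=> s /andP[s0 s1] Os; have [Ks _] := sum_const_segment s0 Os.
  apply: contrapT => nOs; have := f_bd Ks nOs; rewrite fK//.
  have : height x <= height (0 + s *: x) by rewrite add0r; apply: height_scale; rewrite s1 ltW.
  move=> le_sx e0; have := lt_le_trans kx le_sx.
  by rewrite -subr_lt0 e0 ltxx.
exists k0; split=> //.
(* For [k0 < 0] the domain would contain the point of chart coordinates [(1, 0)], which lies on the
   equator. *)
- rewrite leNgt; apply/negP => k_lt0.
  have [e0 e1] := pt2E ((1 : R), (0 : R)).
  have z0 : height (pt2 ((1 : R), (0 : R))) = 0.
    by rewrite /height /sinv e0 e1/= mulr0 addr0 mulr1 mulfV ?subrr.
  have := flat_height hem (OK (OP (pt2 (1, 0)) _)); rewrite z0 ltxx => /(_ k_lt0).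
  by [].
- move=> x; split=> [Ox|]; last exact: OP.
  by have := interior_neg Ox; rewrite fO// subr_lt0.
Qed.
End forward.

(** * The equivalence *)

(** This is [|grad z|^2 = 1 - z^2], read in the chart for the gradient [m n] of [- z]. *)
Lemma boundary_slope (R : realType) (k a b m n0 n1 : R) :
  k * (1 + a * a + b * b) = 1 -> k != 0 ->
  4 * a * k ^+ 2 = m * n0 -> 4 * b * k ^+ 2 = m * n1 -> n0 ^+ 2 + n1 ^+ 2 = 4 * k ^+ 2 ->
  m ^+ 2 = 1 - (2 * k - 1) ^+ 2.
Proof.
move=> ks k0 e0 e1 nn.
have k4 : 4 * k ^+ 2 != 0 by rewrite mulf_neq0 ?expf_neq0// pnatr_eq0.
apply: (mulIf k4); rewrite -{1}nn mulrDr -!exprMn -e0 -e1.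
apply/eqP; rewrite -subr_eq0; apply/eqP.
rewrite [LHS](_ : _ = 16 * k ^+ 3 * (k * (1 + a * a + b * b) - 1)).
  by rewrite ks subrr mulr0.
by clear; ring.
Qed.

Section superlevel.
Variables (R : realType) (Om : set 'rV[R]_3) (nu : 'rV[R]_3 -> 'rV[R]_3).
Variables (c : R) (u : 'rV[R]_3 -> R).
Hypotheses (dom : sphere_domain Om) (hem : closure Om `<=` @hemisphere R)
  (reg : regular_boundary Om nu) (sol : overdetermined_solution Om nu c u).

Lemma solution_superlevel : exists k0 : R, [/\ 0 <= k0, k0 < 1,
  forall p, Om p <-> sphere p /\ k0 < p 0 ord_max &
  forall p, closure Om p -> u p = k0 - p 0 ord_max].
Proof.
have [[W [oW WOm uW]] lapu u0 du] := sol.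
have KW x : closure Om (chart x) -> W x by move=> /WOm; rewrite chartK.
have lap x : Om (chart x) -> partial 0 (partial 0 (u \o @chart R)) x +
    partial 1 (partial 1 (u \o @chart R)) x = 8 * height x * sinv x ^+ 2.
  move=> Ox; have z0 := flat_height hem (flat_subset Ox).
  have := lapu _ Ox; rewrite chartK laplacian_tilde//.
  move: (_ + _) => S E; have k0 := sinv_gt0 x.
  have d0 : height x * (4 * sinv x ^+ 2) != 0.
    by rewrite gt_eqF// mulr_gt0// mulr_gt0// exprn_gt0.
  by rewrite -[S](mulVKf d0) E; ring.
have f_bd x : closure Om (chart x) -> ~ Om (chart x) -> (u \o @chart R) x = 0.
  by move=> Kx nOx; apply: u0.
have df_bd x : closure Om (chart x) -> ~ Om (chart x) ->
    'D_(tcoord x (nu (chart x))) (u \o @chart R) x = c.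
  by move=> Kx nOx; have := du _ (conj Kx nOx); rewrite /tdiff chartK.
have [k0 [k00 k01 OE fE]] := domain_superlevel dom hem reg oW KW uW lap f_bd df_bd.
exists k0; split=> // p.
  split=> [Omp|[sp kp]].
    split; first exact: (domain_sphere dom Omp).
    have cp := closure_chart hem (subset_closure Omp).
    by have := (OE (stereo p)).1; rewrite /= -chart_height cp; apply.
  have cp : chart (stereo p) = p.
    by apply: stereoK => //; rewrite gt_eqF// (lt_trans _ kp)// (lt_le_trans _ k00)// oppr_lt0.
  by have := (OE (stereo p)).2; rewrite /= -chart_height cp; apply.
move=> cOm; have cp := closure_chart hem cOm.
have := fE (stereo p); rewrite /= cp -chart_height cp; exact.
Qed.

Lemma solution_polar_ball : polar_ball Om.
Proof.
have [k0 [k00 k01 OmE _]] := solution_superlevel.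
have k0N : -1 <= k0 <= 1 by rewrite (le_trans _ k00)/= ?ltW// oppr_le0.
exists (acos k0); first by rewrite acos_gt0// k01 andbT; case/andP: k0N.
apply/seteqP; split=> p.
  move=> /OmE sk; apply/geoballE; first by rewrite acos_ge0// acos_lepi.
  by rewrite acosK.
by move=> /geoballE; rewrite acos_ge0// acos_lepi// => /(_ isT); rewrite acosK// => /OmE.
Qed.

Lemma solution_radial : radial_on (closure Om) u.
Proof.
have [k0 [_ _ _ uE]] := solution_superlevel.
exists (fun d => k0 - cos d) => p cp.
have /hemisphereE[sp _] := hem cp.
rewrite uE// geodist_north// acosK//; exact: sphere_height.
Qed.

End superlevel.

(** * The explicit solution on a ball *)

Section ball_solution.
Variables (R : realType) (Om : set 'rV[R]_3) (nu : 'rV[R]_3 -> 'rV[R]_3) (r : R).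
Hypotheses (hem : closure Om `<=` @hemisphere R)
  (normal : forall p, bd Om p -> outward_normal_at Om (nu p) p)
  (r0 : 0 < r) (OmE : Om = geoball (north R) r).

(** A larger ball would contain a point of the equator, at distance [acos 0 = pi / 2] from the
    pole. *)
Lemma hemispherical_radius : r <= pi / 2.
Proof.
rewrite leNgt; apply/negP => rpi.
pose e : 'rV[R]_3 := chart (pt2 (1, 0)).
have [e0 e1] := pt2E ((1 : R), (0 : R)).
have ez : e 0 ord_max = 0.
  by rewrite chart_height /height /sinv e0 e1/= mulr0 addr0 mulr1 mulfV ?subrr.
have Ome : Om e.
  rewrite OmE; split; first exact: sphere_chart.
  by rewrite geodist_north ?ez ?acos0//; exact: sphere_chart.
by have /hemisphereE[_] := hem (subset_closure Ome); rewrite ez ltxx.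
Qed.

Let r_pi : 0 <= r <= pi.
Proof.
rewrite (ltW r0) (le_trans hemispherical_radius)// ler_pdivrMr// ler_peMr ?pi_ge0//.
by rewrite ler1n.
Qed.

Lemma ball_solution :
  sin r != 0 /\ overdetermined_solution Om nu (sin r) (fun p => cos r - p 0 ord_max).
Proof.
have sr : 0 < sin r.
  by rewrite sin_gt0_pi// r0 (le_lt_trans hemispherical_radius)// ltr_pdivrMr// ltr_pMr ?pi_gt0// ltr1n.
split; first by rewrite gt_eqF.
have cr0 : 0 <= cos r.
  by apply: cos_ge0_pihalf; rewrite hemispherical_radius andbT (le_trans _ (ltW r0))// oppr_le0 divr_ge0// pi_ge0.
have OmP p : Om p <-> sphere p /\ cos r < p 0 ord_max by rewrite OmE; exact: geoballE.
pose f : 'rV[R]_2 -> R := cst (cos r) - @height R.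
have fE : (fun p : 'rV[R]_3 => cos r - p 0 ord_max) \o @chart R = f.
  by apply/funext => x; rewrite /= chart_height.
have closP p : closure Om p -> sphere p /\ cos r <= p 0 ord_max.
  move=> cp; have /hemisphereE[sp _] := hem cp; split; first exact: sp.
  have cl : closed [set q : 'rV[R]_3 | cos r <= q 0 ord_max].
    apply: (@closed_comp _ _ (fun q : 'rV[R]_3 => q 0 ord_max) [set x | cos r <= x]).
      by move=> q _; exact: coord_continuous.
    exact: closed_ge.
  by apply: cl; apply: closure_subset cp => q /OmP[_ /ltW].
have bdE p : bd Om p -> p 0 ord_max = cos r.
  move=> [cp nOp]; have [sp ge] := closP _ cp; apply/eqP; rewrite eq_le ge andbT leNgt.
  by apply/negP => lt; apply: nOp; apply/OmP.
have pf i : partial i f = - partial i (@height R).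
  apply/funext => x; have [dz _] := is_derive_height x i.
  by rewrite /f /partial deriveB ?derive_cst ?sub0r//; exact: derivable_cst.
have H := C2_on_height (@openT 'rV[R]_2).
have fT : C2_on setT f.
  split=> [|i].
    by rewrite /f; apply: C1_onB; [exact: openT|exact: C1_on_cst openT _|exact: H.1].
  by rewrite pf; apply: C1_onN; [exact: openT|exact: H.2].
have lapf x : partial 0 (partial 0 f) x + partial 1 (partial 1 f) x = 8 * height x * sinv x ^+ 2.
  have E i : partial i (partial i f) x = - partial i (partial i (@height R)) x.
    by rewrite pf; apply: deriveN; have [] := H.2 i x I i.
  by rewrite !E -opprD laplacian_height -!mulNr opprK.
split.
- exists setT; split; [exact: openT|by []|by rewrite fE; exact: fT].
- move=> p Omp; rewrite fE.
  have cp := closure_chart hem (subset_closure Omp).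
  have z0 : 0 < height (stereo p).
    by rewrite -chart_height cp (le_lt_trans cr0)//; have /OmP[] := Omp.
  rewrite laplacian_tilde// lapf.
  have k0 := sinv_gt0 (stereo p).
  by move: (height _) (sinv _) z0 k0 => z k z0 k0; field; rewrite !gt_eqF.
- by move=> p /bdE ->; rewrite subrr.
- move=> p bp; have cp := closure_chart hem bp.1.
  pose x := stereo p; have zx : height x = cos r by rewrite -chart_height cp bdE.
  have f_le0 y : Om (chart y) -> f y <= 0.
    by move=> /OmP[_ /ltW]; rewrite chart_height /f !fctE subr_le0.
  have fx : f x = 0 by rewrite /f !fctE zx subrr.
  have on : outward_normal_at Om (nu p) (chart x) by rewrite cp; exact: normal.
  have [m m0 [e0 e1 nn]] := boundary_gradient openT fT.1 I on f_le0 fx.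
  rewrite /tdiff fE => Dm; apply: (etrans Dm); apply/eqP.
  (* Both [m] and [sin r] are nonnegative, so comparing squares suffices; the sign of [m] comes from
     [f <= 0] inside. *)
  rewrite -(@eqrXn2 _ 2)// ?(ltW sr)//; apply/eqP.
  have p0 : partial 0 f x = 4 * x 0 0 * sinv x ^+ 2.
    by rewrite pf; have [_ E] := is_derive_height x 0; rewrite !fctE [partial _ _ _]E; ring.
  have p1 : partial 1 f x = 4 * x 0 1 * sinv x ^+ 2.
    by rewrite pf; have [_ E] := is_derive_height x 1; rewrite !fctE [partial _ _ _]E; ring.
  rewrite sin2cos2 -zx; apply: (boundary_slope (sinv_mul x) (lt0r_neq0 (sinv_gt0 x)) _ _ nn).
  + exact: etrans (esym p0) e0.
  + exact: etrans (esym p1) e1.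
Qed.

End ball_solution.

Theorem corollary1p2 (R : realType) (Om : set 'rV[R]_3)
    (nu : 'rV[R]_3 -> 'rV[R]_3)
    (Om_domain : sphere_domain Om)
    (Om_hemisphere : closure Om `<=` @hemisphere R)
    (Om_regular : regular_boundary Om nu) :
  ((exists (c : R) (u : 'rV[R]_3 -> R),
      c != 0 /\ overdetermined_solution Om nu c u)
   <-> polar_ball Om) /\
  (polar_ball Om ->
    forall (c : R) (u : 'rV[R]_3 -> R),
      c != 0 -> overdetermined_solution Om nu c u ->
      radial_on (closure Om) u).
Proof.
split; first split.
- move=> [c [u [_ sol]]].
  exact: (solution_polar_ball Om_domain Om_hemisphere Om_regular sol).
- move=> [r r0 OmE]; exists (sin r), (fun p => cos r - p 0 ord_max).
  exact: (ball_solution Om_hemisphere Om_regular.1 r0 OmE).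
- move=> _ c u _ sol.
  exact: (solution_radial Om_domain Om_hemisphere Om_regular sol).
Qed.
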